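(* Let $a\in\mathbb{C}$, $a\neq 0$, be fixed. Consider the Mathieu operator $L(y)=-y''+2a\cos(2x)\,y$ on $[0,\pi]$ with periodic boundary conditions ($y(0)=y(\pi)$, $y'(0)=y'(\pi)$) or with anti-periodic boundary conditions ($y(0)=-y(\pi)$, $y'(0)=-y'(\pi)$). For all sufficiently large $n\in\mathbb{N}$, $L$ has, close to $n^2$ (in the disc $|\lambda-n^2|<1$), exactly two (counted with algebraic multiplicity) periodic (if $n$ is even) or anti-periodic (if $n$ is odd) eigenvalues $\lambda_n^-,\lambda_n^+$, and $$\lambda_n^+-\lambda_n^- = \pm\frac{8(a/4)^n}{[(n-1)!]^2}\left[1-\frac{a^2}{4n^3}+O\left(\frac{1}{n^4}\right)\right],\qquad n\to\infty .$$
   Context: The two eigenvalues are labelled so that $\mathrm{Re}\,\lambda_n^-<\mathrm{Re}\,\lambda_n^+$, or $\mathrm{Re}\,\lambda_n^-=\mathrm{Re}\,\lambda_n^+$ and $\mathrm{Im}\,\lambda_n^-\le \mathrm{Im}\,\lambda_n^+$. The symbol $\pm$ means that for each large $n$ the formula holds with one of the two signs (the sign may depend on $n$). The constant in $O(\cdot)$ may depend on $a$ but not on $n$. *)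

(* Defs.v *)
From Stdlib Require Export Reals List Factorial.
From Coquelicot Require Export Coquelicot.
Open Scope R_scope.

(** A function on [[0, PI]] is represented by a total function [R -> C]; every
    notion below depends only on its values on [[0, PI]]. *)
Definition on_0pi (x : R) : Prop := 0 <= x <= PI.

(** The derivative is one-sided at the endpoints [0] and [PI]. *)
Definition has_deriv (y dy : R -> C) : Prop :=
  forall x : R, on_0pi x ->
    @filterdiff R_AbsRing R_NormedModule C_R_NormedModule y
      (within on_0pi (locally x)) (fun h : R => scal h (dy x : C_R_NormedModule)).

Inductive bc : Set := periodic | antiperiodic.

Definition bc_holds (b : bc) (y dy : R -> C) : Prop :=
  match b with
  | periodic => y 0 = y PI /\ dy 0 = dy PI
  | antiperiodic => y 0 = Copp (y PI) /\ dy 0 = Copp (dy PI)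
  end.

(** [mathieu a b y f]: [y] belongs to the domain of [L] (it is of class [C^2] and
    satisfies the boundary conditions) and [L y = - y'' + 2 a cos(2x) y = f].
    Taking the domain to be the Sobolev space [H^2] would give the same
    eigenvalues and root spaces: a root vector solves a linear ODE with smooth
    coefficients, so it is smooth. *)
Definition mathieu (a : C) (b : bc) (y f : R -> C) : Prop :=
  exists dy ddy : R -> C,
    has_deriv y dy /\ has_deriv dy ddy /\
    continuous_on (T := R_UniformSpace) (U := C_UniformSpace) on_0pi ddy /\
    bc_holds b y dy /\
    forall x : R, on_0pi x ->
      f x = (- ddy x + 2 * a * RtoC (cos (2 * x)) * y x)%C.

Definition eigenvalue (a : C) (b : bc) (mu : C) : Prop :=
  exists y : R -> C,
    mathieu a b y (fun x => (mu * y x)%C) /\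
    exists x : R, on_0pi x /\ y x <> RtoC 0.

Fixpoint in_ker_pow (a : C) (b : bc) (mu : C) (k : nat) (y : R -> C) : Prop :=
  match k with
  | O => forall x : R, on_0pi x -> y x = RtoC 0
  | S k' => exists f : R -> C,
      mathieu a b y f /\ in_ker_pow a b mu k' (fun x => (f x - mu * y x)%C)
  end.

Definition root_space (a : C) (b : bc) (mu : C) (y : R -> C) : Prop :=
  exists k : nat, in_ker_pow a b mu k y.

(** The sum is empty when [m = 0]. *)
Definition lin_comb (m : nat) (c : nat -> C) (e : nat -> R -> C) (x : R) : C :=
  sum_n_m (fun i => (c i * e i x)%C) 1 m.

(** The complex vector space [E] of functions on [[0, PI]] has dimension [m]:
    it has a basis [e 1, ..., e m]. *)
Definition has_dim (E : (R -> C) -> Prop) (m : nat) : Prop :=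
  exists e : nat -> R -> C,
    (forall i : nat, (1 <= i <= m)%nat -> E (e i)) /\
    (forall c : nat -> C,
       (forall x : R, on_0pi x -> lin_comb m c e x = RtoC 0) ->
       forall i : nat, (1 <= i <= m)%nat -> c i = RtoC 0) /\
    (forall y : R -> C, E y ->
       exists c : nat -> C, forall x : R, on_0pi x -> y x = lin_comb m c e x).

Definition alg_mult (a : C) (b : bc) (mu : C) (m : nat) : Prop :=
  has_dim (root_space a b mu) m.

(** The list [l] enumerates the eigenvalues in the disc [|mu - z| < r], each one
    repeated according to its algebraic multiplicity. *)
Definition eigenvalues_in_disc (a : C) (b : bc) (z : C) (r : R) (l : list C) : Prop :=
  (forall mu : C, In mu l <-> eigenvalue a b mu /\ Cmod (mu - z) < r) /\
  (forall mu : C, In mu l -> alg_mult a b mu (count_occ Ceq_dec l mu)).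

Definition bc_of_parity (n : nat) : bc :=
  if Nat.even n then periodic else antiperiodic.

Definition lex_le (z w : C) : Prop :=
  Re z < Re w \/ (Re z = Re w /\ Im z <= Im w).

(* Main.v *)
Require Import Defs.
From Stdlib Require Import ZArith Lia Lra Classical IndefiniteDescription.

(** In the exponentials [exp (i (n - 2 j) x)], [j] in [Z], which satisfy the
    boundary condition, the equation [L y = (n ^ 2 + delta) y] becomes
    [(4 j (n - j) + delta) x_j = a (x_(j-1) + x_(j+1))].
    The two resonant indices [0] and [n] belong to the double eigenvalue [n ^ 2]
    of the unperturbed operator. At every other index the factor of [x_j] is of
    size at least [3 n], so dividing by it is a contraction of bounded
    sequences. The reversal [j -> n - j] splits the solutions into symmetric
    and antisymmetric ones, and for each of the two parities there is exactly
    one eigenvalue with [|delta| <= 1] ([mode_exists], [mode_unique]). The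
    entries of its eigenvector decrease by the factor [|a| / n] with each step
    away from [0] and [n].

    Back to functions ([spectrum_in_disc]): the series with these coefficients
    is an eigenfunction. Conversely, the Fourier coefficients of an
    eigenfunction solve the recurrence, because [L] is symmetric for the
    bilinear pairing given by the integral of [y z] ([mathieu_symmetric]), and
    they determine it ([fourier_uniqueness]). The eigenvalue is simple: from
    [(L - mu) y = c phi] the same symmetry gives [c] times the integral of
    [phi ^ 2] equal to [0], but [phi] is close to
    [exp (i n x) + exp (- i n x)] or [exp (i n x) - exp (- i n x)], whose
    squares have the integrals [2 PI] and [- 2 PI].

    For the gap, let [p] be the solution of the recurrence with [p_0 = 0] and
    [p_1 = 1]. A mode satisfies [x_1 p_n = p_(n-1) + 1] or
    [x_1 p_n = p_(n-1) - 1], according to its parity, and two applications of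
    the Lagrange identity lead to [gap_identity], which reads
    [gap (1 + Z) = a / p_n + a / p_n'] with one term for each of the two shifts
    and [Z = a ^ 2 / (8 n ^ 2) + O(n ^ -4)]. Up to a power of [a], [p_n] is the
    determinant of a tridiagonal matrix: the product of the
    [4 j (n - j) + delta] over [0 < j < n] times a continuant. The product of
    the [4 j (n - j)] is [4 ^ (n - 1) (n - 1)! ^ 2], which gives the leading
    term of the formula. Since [delta = a ^ 2 / (2 n ^ 2) + O(n ^ -4)]
    ([shift_expansion]), the shift changes the product by the factor
    [1 + a ^ 2 H / (4 n ^ 3)], where [H] is the harmonic number of [n - 1],
    while the continuant is
    [1 - a ^ 2 / (8 n ^ 2) - a ^ 2 H / (4 n ^ 3) + a ^ 2 / (4 n ^ 3)], both up to
    [O(n ^ -4)]. The harmonic numbers cancel ([rel_det_expansion]), the terms in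
    [n ^ -2] cancel against [Z], and [1 - a ^ 2 / (4 n ^ 3)] remains. *)

(** * Complex numbers and limits *)

Lemma Cmod_le_Re_Im (z : C) : Cmod z <= Rabs (Re z) + Rabs (Im z).
Proof.
  replace z with (RtoC (Re z) + Ci * RtoC (Im z))%C.
  - eapply Rle_trans; [apply Cmod_triangle|].
    rewrite Cmod_mult, Cmod_Ci, !Cmod_R, !re_plus, !im_plus. simpl.
    apply Req_le. f_equal; [|rewrite Rmult_1_l]; f_equal; ring.
  - destruct z as [u v]. unfold Cplus, Cmult, Ci, RtoC, Re, Im. simpl. f_equal; ring.
Qed.

Lemma Cmod_Im_le (z : C) : Rabs (Im z) <= Cmod z.
Proof. eapply Rle_trans; [|apply Rmax_Cmod]. apply Rmax_r. Qed.

Ltac triangle := eapply Rle_trans; [apply Cmod_triangle|].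

Lemma Cmod_minus_comm (z w : C) : Cmod (z - w) = Cmod (w - z).
Proof. rewrite <- Cmod_opp. f_equal. ring. Qed.

Lemma Cmod_minus_ge (z w : C) : Cmod z - Cmod w <= Cmod (z + w).
Proof.
  pose proof (Cmod_triangle (z + w) (- w)) as H. rewrite Cmod_opp in H.
  replace (z + w + - w)%C with z in H by ring. lra.
Qed.

Lemma Cmod_le_0 (z : C) : Cmod z <= 0 -> z = RtoC 0.
Proof. intros H. apply Cmod_eq_0, Rle_antisym; [exact H|apply Cmod_ge_0]. Qed.

Lemma Cmod_div_le (z w : C) (K : R) : w <> RtoC 0 -> Cmod z <= K * Cmod w -> Cmod (z / w) <= K.
Proof.
  intros Hw H. rewrite Cmod_div by exact Hw. apply Cmod_gt_0 in Hw.
  apply Rmult_le_reg_r with (Cmod w); [exact Hw|].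
  unfold Rdiv. rewrite Rmult_assoc, Rinv_l; lra.
Qed.

Lemma RtoC_neq_0 (t : R) : t <> 0 -> RtoC t <> RtoC 0.
Proof. intros Ht H. now apply Ht, RtoC_inj. Qed.

Lemma half_pow_pos (m : nat) : 0 < (/ 2) ^ m.
Proof. apply pow_lt; lra. Qed.

Lemma half_pow_small (K eps : R) : 0 < eps -> exists m : nat, K * (/ 2) ^ m < eps.
Proof.
  intros He. destruct (Rle_dec K 0) as [HK|HK].
  - exists O. simpl. lra.
  - assert (Hlt : Rabs (/ 2) < 1) by (rewrite Rabs_pos_eq; lra).
    assert (HKe : 0 < eps / K) by (apply Rdiv_lt_0_compat; lra).
    destruct (pow_lt_1_zero (/ 2) Hlt (eps / K) HKe) as [N HN].
    exists N. specialize (HN N (le_n N)).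
    rewrite Rabs_pos_eq in HN by (left; apply half_pow_pos).
    replace eps with (K * (eps / K)) by (field; lra).
    apply Rmult_lt_compat_l; lra.
Qed.

Lemma le_of_half_pow (u v K : R) :
  (forall m : nat, u <= v + K * (/ 2) ^ m) -> u <= v.
Proof.
  intros H. apply Rnot_lt_le. intros Hlt.
  destruct (half_pow_small K (u - v) ltac:(lra)) as [m Hm].
  specialize (H m). lra.
Qed.

(** This takes the place of the supremum of [u] in contraction arguments. *)
Lemma halving (T : Type) (u : T -> R) (B : R) :
  (forall t, u t <= B) ->
  (forall B', (forall t, u t <= B') -> forall t, u t <= B' / 2) ->
  forall t, u t <= 0.
Proof.
  intros HB Hstep t. apply (le_of_half_pow _ _ B). intros m.
  rewrite Rplus_0_l. revert t. induction m as [|m IH]; intros t.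
  - simpl. rewrite Rmult_1_r. apply HB.
  - replace (B * (/ 2) ^ S m) with (B * (/ 2) ^ m / 2) by (simpl; field).
    now apply Hstep.
Qed.

Lemma geometric_limit (u : nat -> R) (K : R) :
  (forall m, Rabs (u (S m) - u m) <= K * (/ 2) ^ m) ->
  forall m, Rabs (u m - real (Lim_seq u)) <= 2 * K * (/ 2) ^ m.
Proof.
  intros H.
  assert (Hd : forall m k, Rabs (u (m + k)%nat - u m)
                           <= 2 * K * (/ 2) ^ m - 2 * K * (/ 2) ^ (m + k)).
  { intros m. induction k as [|k IH].
    - rewrite Nat.add_0_r, Rminus_diag, Rabs_R0. lra.
    - replace (u (m + S k)%nat - u m)
        with ((u (S (m + k)) - u (m + k)%nat) + (u (m + k)%nat - u m))
        by (rewrite Nat.add_succ_r; ring).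
      eapply Rle_trans; [apply Rabs_triang|].
      specialize (H (m + k)%nat). rewrite Nat.add_succ_r. simpl. lra. }
  assert (HK : 0 <= K).
  { specialize (H O). simpl in H. pose proof (Rabs_pos (u 1%nat - u O)). lra. }
  assert (Hd' : forall m k, Rabs (u (m + k)%nat - u m) <= 2 * K * (/ 2) ^ m).
  { intros m k. eapply Rle_trans; [apply Hd|].
    assert (0 <= K * (/ 2) ^ (m + k))
      by (apply Rmult_le_pos; [lra|left; apply half_pow_pos]). lra. }
  assert (Hc : ex_finite_lim_seq u).
  { apply ex_lim_seq_cauchy_corr. intros eps.
    destruct (half_pow_small (4 * K) eps (cond_pos eps)) as [N HN].
    exists N. intros p m Hp Hm.
    replace p with (N + (p - N))%nat by lia. replace m with (N + (m - N))%nat by lia.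
    replace (u (N + (p - N))%nat - u (N + (m - N))%nat)
      with ((u (N + (p - N))%nat - u N) - (u (N + (m - N))%nat - u N)) by ring.
    eapply Rle_lt_trans; [apply Rabs_triang|]. rewrite Rabs_Ropp.
    pose proof (Hd' N (p - N)%nat). pose proof (Hd' N (m - N)%nat). lra. }
  apply Lim_seq_correct' in Hc. intros m.
  assert (Hl : is_lim_seq (fun k => Rabs (u (k + m)%nat - u m))
                 (Rabs (real (Lim_seq u) - u m))).
  { apply (is_lim_seq_abs _ (Finite (real (Lim_seq u) - u m))).
    apply is_lim_seq_minus'; [|apply is_lim_seq_const].
    now apply (is_lim_seq_incr_n u m). }
  rewrite Rabs_minus_sym.
  assert (Hle : Rbar_le (Rabs (real (Lim_seq u) - u m)) (2 * K * (/ 2) ^ m)).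
  { refine (is_lim_seq_le _ _ _ _ _ Hl (is_lim_seq_const _)).
    intros k. rewrite (Nat.add_comm k m). apply Hd'. }
  exact Hle.
Qed.

(** Banach's theorem for the sup distance. The invariant set of functions
    dominated by [w] is what makes the fixed point decay. *)
Lemma contraction_fixpoint (T : Type) (w : T -> R) (W : R) (Phi : (T -> C) -> T -> C) :
  (forall t, 0 <= w t <= W) ->
  (forall x, (forall t, Cmod (x t) <= w t) -> forall t, Cmod (Phi x t) <= w t) ->
  (forall x y, (forall t, Cmod (x t) <= w t) -> (forall t, Cmod (y t) <= w t) ->
     forall B, (forall t, Cmod (x t - y t) <= B) ->
     forall t, Cmod (Phi x t - Phi y t) <= B / 2) ->
  exists x, (forall t, Cmod (x t) <= w t) /\ forall t, Phi x t = x t.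
Proof.
  intros Hw Hball Hctr.
  set (u := fun m => Nat.iter m Phi (fun _ => RtoC 0)).
  assert (Hu : forall m t, Cmod (u m t) <= w t).
  { induction m as [|m IH]; intros t.
    - simpl. rewrite Cmod_0. apply Hw.
    - apply (Hball (u m)). exact IH. }
  assert (Hd : forall m t, Cmod (u (S m) t - u m t) <= 2 * W * (/ 2) ^ m).
  { induction m as [|m IH]; intros t.
    - unfold Cminus. triangle. rewrite Cmod_opp.
      pose proof (Hu 1%nat t). pose proof (Hu O t). pose proof (Hw t). simpl (_ ^ 0). lra.
    - replace (2 * W * (/ 2) ^ S m) with (2 * W * (/ 2) ^ m / 2) by (simpl; field).
      apply (Hctr (u (S m)) (u m)); auto. }
  set (x := fun t => (real (Lim_seq (fun m => Re (u m t))),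
                      real (Lim_seq (fun m => Im (u m t)))) : C).
  assert (Hx : forall m t, Cmod (u m t - x t) <= 8 * W * (/ 2) ^ m).
  { intros m t. eapply Rle_trans; [apply Cmod_le_Re_Im|].
    assert (H1 : Rabs (Re (u m t) - Re (x t)) <= 2 * (2 * W) * (/ 2) ^ m).
    { apply (geometric_limit (fun m => Re (u m t))). intros k.
      eapply Rle_trans; [|apply (Hd k t)].
      rewrite <- (re_le_Cmod (u (S k) t - u k t)). right. f_equal. }
    assert (H2 : Rabs (Im (u m t) - Im (x t)) <= 2 * (2 * W) * (/ 2) ^ m).
    { apply (geometric_limit (fun m => Im (u m t))). intros k.
      eapply Rle_trans; [|apply (Hd k t)].
      rewrite <- (Cmod_Im_le (u (S k) t - u k t)). right. f_equal. }
    change (Re (u m t - x t)) with (Re (u m t) - Re (x t)).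
    change (Im (u m t - x t)) with (Im (u m t) - Im (x t)). lra. }
  assert (Hxw : forall t, Cmod (x t) <= w t).
  { intros t. apply (le_of_half_pow _ _ (8 * W)). intros m.
    replace (x t) with (u m t + - (u m t - x t))%C by ring.
    triangle. rewrite Cmod_opp.
    pose proof (Hu m t). pose proof (Hx m t). lra. }
  exists x. split; [exact Hxw|]. intros t.
  apply Ceq_minus, Cmod_le_0.
  apply (le_of_half_pow _ _ (8 * W)). intros m. rewrite Rplus_0_l.
  replace (Phi x t - x t)%C
    with (- (Phi (u m) t - Phi x t) + (u (S m) t - x t))%C by (simpl; ring).
  triangle. rewrite Cmod_opp.
  pose proof (Hctr (u m) x (Hu m) Hxw (8 * W * (/ 2) ^ m) (Hx m) t).
  pose proof (Hx (S m) t) as H2. simpl in H2 |- *. lra.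
Qed.

(** * The recurrence for the Fourier coefficients *)

(** The threshold makes [decay] at most [/ 200] and the shift of an eigenvalue
    less than [1]. *)
Definition large (a : C) (n : nat) : Prop := 200 * (1 + Cmod a) ^ 2 <= INR n.

(** The ratio at which coefficients decrease away from the indices [0] and [n]. *)
Definition decay (a : C) (n : nat) : R := Cmod a / INR n.

(** The index [j] stands for the frequency [n - 2 j]; this is
    [n ^ 2 - (n - 2 j) ^ 2]. *)
Definition offset (n : nat) (j : Z) : R := 4 * IZR j * (INR n - IZR j).

Definition denom (n : nat) (delta : C) (j : Z) : C := (RtoC (offset n j) + delta)%C.

(** The coefficient of [exp (i (n - 2 j) x)] in [L y = (n ^ 2 + delta) y]. *)
Definition recurrence (a : C) (n : nat) (delta : C) (x : Z -> C) (j : Z) : Prop :=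
  (denom n delta j * x j = a * (x (j - 1)%Z + x (j + 1)%Z))%C.

Definition bounded (x : Z -> C) : Prop := exists B, forall j, Cmod (x j) <= B.

(** The indices of the frequencies [n] and [- n]. *)
Definition resonant (n : nat) (j : Z) : Prop := j = 0%Z \/ j = Z.of_nat n.

Lemma resonant_dec (n : nat) (j : Z) : {resonant n j} + {~ resonant n j}.
Proof.
  unfold resonant. destruct (Z.eq_dec j 0); [left; now left|].
  destruct (Z.eq_dec j (Z.of_nat n)); [left; now right|right; tauto].
Qed.

Section Recurrence.
Variables (a : C) (n : nat).
Hypothesis Hn : large a n.

Lemma large_n : 100 <= INR n.
Proof.
  eapply Rle_trans; [|exact Hn]. pose proof (Cmod_ge_0 a). nra.
Qed.

Lemma large_A : 200 * Cmod a <= INR n.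
Proof.
  eapply Rle_trans; [|exact Hn]. nra.
Qed.

Lemma large_A2 : 100 * (Cmod a * Cmod a) <= INR n.
Proof.
  eapply Rle_trans; [|exact Hn]. pose proof (Cmod_ge_0 a). nra.
Qed.

Lemma decay_bounds : 0 <= decay a n <= / 200.
Proof.
  unfold decay. pose proof large_n. pose proof large_A. pose proof (Cmod_ge_0 a). split.
  - apply Rmult_le_pos; [lra|]. left. apply Rinv_0_lt_compat. lra.
  - apply Rmult_le_reg_r with (INR n); [lra|].
    replace (Cmod a / INR n * INR n) with (Cmod a) by (field; lra). lra.
Qed.

Lemma decay_mult : Cmod a = decay a n * INR n.
Proof. unfold decay. pose proof large_n. field. lra. Qed.

Lemma offset_bound (j : Z) : ~ resonant n j -> 4 * INR n - 4 <= Rabs (offset n j).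
Proof.
  intros Hj. unfold offset. pose proof large_n as Hl. rewrite INR_IZR_INZ in *.
  unfold resonant in Hj.
  assert (Hc : (j <= -1 \/ (1 <= j /\ j <= Z.of_nat n - 1) \/ Z.of_nat n + 1 <= j)%Z) by lia.
  destruct Hc as [H|[[H1 H2]|H]].
  - apply IZR_le in H. rewrite Rabs_left1 by nra. nra.
  - apply IZR_le in H1, H2. rewrite minus_IZR in H2. rewrite Rabs_pos_eq by nra. nra.
  - apply IZR_le in H. rewrite plus_IZR in H. rewrite Rabs_left1 by nra. nra.
Qed.

Lemma denom_bound (delta : C) (j : Z) :
  Cmod delta <= 1 -> ~ resonant n j -> 3 * INR n <= Cmod (denom n delta j).
Proof.
  intros Hd Hj. pose proof (offset_bound j Hj). pose proof large_n.
  unfold denom. pose proof (Cmod_minus_ge (RtoC (offset n j)) delta) as H1.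
  rewrite Cmod_R in H1. lra.
Qed.

Lemma denom_neq_0 (delta : C) (j : Z) :
  Cmod delta <= 1 -> ~ resonant n j -> denom n delta j <> RtoC 0.
Proof.
  intros Hd Hj. apply Cmod_gt_0. pose proof (denom_bound delta j Hd Hj).
  pose proof large_n. lra.
Qed.

Lemma recurrence_div (delta : C) (x : Z -> C) (j : Z) :
  Cmod delta <= 1 -> ~ resonant n j -> recurrence a n delta x j ->
  x j = (a * (x (j - 1)%Z + x (j + 1)%Z) / denom n delta j)%C.
Proof.
  intros Hd Hj Hr. rewrite <- Hr. field. now apply denom_neq_0.
Qed.

Lemma quotient_bound (delta z : C) (j : Z) :
  Cmod delta <= 1 -> ~ resonant n j ->
  Cmod (a * z / denom n delta j)%C <= decay a n / 3 * Cmod z.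
Proof.
  intros Hd Hj. pose proof (denom_bound delta j Hd Hj).
  pose proof (Cmod_ge_0 z). pose proof decay_bounds.
  apply Cmod_div_le; [now apply denom_neq_0|]. rewrite Cmod_mult, decay_mult.
  assert (0 <= decay a n * Cmod z) by (apply Rmult_le_pos; lra). nra.
Qed.

(** At a non-resonant index the diagonal entry dominates, so the recurrence
    halves bounds: the resonant entries determine a bounded solution. *)
Lemma recurrence_unique (delta : C) (x : Z -> C) :
  Cmod delta <= 1 -> bounded x ->
  (forall j, resonant n j -> x j = RtoC 0) ->
  (forall j, ~ resonant n j -> recurrence a n delta x j) ->
  forall j, x j = RtoC 0.
Proof.
  intros Hd [B HB] H0 Hr j.
  apply Cmod_le_0. revert j.
  apply (halving Z (fun j => Cmod (x j)) B HB).
  intros B' HB' j. pose proof (HB' 0%Z). pose proof (Cmod_ge_0 (x 0%Z)).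
  destruct (resonant_dec n j) as [Hj|Hj].
  - rewrite H0, Cmod_0 by exact Hj. lra.
  - rewrite (recurrence_div delta x j Hd Hj (Hr j Hj)).
    eapply Rle_trans; [now apply quotient_bound|].
    pose proof (Cmod_triangle (x (j - 1)%Z) (x (j + 1)%Z)).
    pose proof (HB' (j - 1)%Z). pose proof (HB' (j + 1)%Z). pose proof decay_bounds.
    nra.
Qed.

(** A sum of two profiles, instead of their maximum, makes [weight_step] hold
    term by term. *)
Definition weight (j : Z) : R :=
  decay a n ^ Z.abs_nat j + decay a n ^ Z.abs_nat (Z.of_nat n - j).

Lemma decay_pow_le (k l : nat) : (k <= l)%nat -> decay a n ^ l <= decay a n ^ k.
Proof.
  intros H. pose proof decay_bounds as Hq. replace l with (k + (l - k))%nat by lia.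
  rewrite pow_add. rewrite <- (Rmult_1_r (decay a n ^ k)) at 2.
  apply Rmult_le_compat_l; [apply pow_le; lra|].
  rewrite <- (pow1 (l - k)). apply pow_incr. lra.
Qed.

Lemma decay_pow_bounds (k : nat) : 0 <= decay a n ^ k <= 1.
Proof.
  pose proof decay_bounds. split; [apply pow_le; lra|].
  rewrite <- (pow_O (decay a n)). apply decay_pow_le. lia.
Qed.

Lemma weight_bounds (j : Z) : 0 <= weight j <= 2.
Proof.
  unfold weight. pose proof (decay_pow_bounds (Z.abs_nat j)).
  pose proof (decay_pow_bounds (Z.abs_nat (Z.of_nat n - j))). lra.
Qed.

Lemma weight_bounded (x : Z -> C) : (forall j, Cmod (x j) <= weight j) -> bounded x.
Proof.
  intros H. exists 2. intros j. eapply Rle_trans; [apply H|apply weight_bounds].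
Qed.

Lemma weight_step (j : Z) : decay a n * (weight (j - 1) + weight (j + 1)) <= 2 * weight j.
Proof.
  unfold weight.
  assert (H : forall i k, (i <= S k)%nat -> decay a n * decay a n ^ k <= decay a n ^ i).
  { intros i k Hik. apply (decay_pow_le i (S k) Hik). }
  pose proof (H (Z.abs_nat j) (Z.abs_nat (j - 1)) ltac:(lia)).
  pose proof (H (Z.abs_nat j) (Z.abs_nat (j + 1)) ltac:(lia)).
  pose proof (H (Z.abs_nat (Z.of_nat n - j)) (Z.abs_nat (Z.of_nat n - (j - 1))) ltac:(lia)).
  pose proof (H (Z.abs_nat (Z.of_nat n - j)) (Z.abs_nat (Z.of_nat n - (j + 1))) ltac:(lia)).
  lra.
Qed.

Lemma weight_near (j : Z) (k : nat) :
  (k <= Z.abs_nat j)%nat -> (k <= Z.abs_nat (Z.of_nat n - j))%nat ->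
  weight j <= 2 * decay a n ^ k.
Proof.
  intros H1 H2. unfold weight.
  pose proof (decay_pow_le _ _ H1). pose proof (decay_pow_le _ _ H2). lra.
Qed.

Lemma nat_large : (100 <= n)%nat.
Proof. apply INR_le. change (INR 100) with (INR (Z.to_nat 100)). rewrite (INR_IZR_INZ (Z.to_nat 100)). simpl. apply large_n. Qed.

(** * Modes *)

(** The equation of index [0] gives the eigenvalue in terms of the other entries. *)
Definition shift_of (x : Z -> C) : C := (a * (x (-1)%Z + x 1%Z))%C.

(** Each non-resonant equation is solved for its diagonal term. Since the shift
    is read off from the sequence, one fixed point yields the eigenvalue
    together with its eigenvector. *)
Definition mode_map (eps : C) (x : Z -> C) (j : Z) : C :=
  if Z.eq_dec j 0 then RtoC 1
  else if Z.eq_dec j (Z.of_nat n) then eps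
  else (a * (x (j - 1)%Z + x (j + 1)%Z) / denom n (shift_of x) j)%C.

Lemma mode_map_nonresonant (eps : C) (x : Z -> C) (j : Z) :
  ~ resonant n j ->
  mode_map eps x j = (a * (x (j - 1)%Z + x (j + 1)%Z) / denom n (shift_of x) j)%C.
Proof.
  intros Hj. unfold resonant in Hj. unfold mode_map.
  destruct (Z.eq_dec j 0); [tauto|]. destruct (Z.eq_dec j (Z.of_nat n)); tauto.
Qed.

Lemma shift_bound (x : Z -> C) :
  (forall j, Cmod (x j) <= weight j) ->
  Cmod (shift_of x) < 1.
Proof.
  intros Hx. unfold shift_of. rewrite Cmod_mult.
  pose proof (Cmod_triangle (x (-1)%Z) (x 1%Z)). pose proof (Cmod_ge_0 a).
  pose proof nat_large.
  pose proof (weight_near 1 1 ltac:(lia) ltac:(lia)).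
  pose proof (weight_near (-1) 1 ltac:(lia) ltac:(lia)).
  pose proof (Hx 1%Z). pose proof (Hx (-1)%Z). simpl in *.
  pose proof large_n. pose proof large_A2. pose proof decay_mult.
  apply Rle_lt_trans with (Cmod a * (4 * decay a n)).
  - apply Rmult_le_compat_l; lra.
  - apply Rmult_lt_reg_r with (INR n); nra.
Qed.

(** The difference has two terms, one from the numerators and one from the
    dependence of the denominators on the shift. *)
Lemma mode_map_contracts (eps : C) (x y : Z -> C) (B : R) :
  Cmod (shift_of x) <= 1 -> Cmod (shift_of y) <= 1 ->
  (forall j, Cmod (y j) <= 2) ->
  (forall j, Cmod (x j - y j) <= B) ->
  forall j, Cmod (mode_map eps x j - mode_map eps y j) <= B / 2.
Proof.
  intros Hdx Hdy Hy HB j.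
  assert (HB0 : 0 <= B) by (eapply Rle_trans; [apply Cmod_ge_0|apply (HB 0%Z)]).
  destruct (resonant_dec n j) as [Hj|Hj].
  - replace (mode_map eps x j - mode_map eps y j)%C with (RtoC 0).
    + rewrite Cmod_0. lra.
    + unfold mode_map. destruct (Z.eq_dec j 0); [ring|].
      destruct (Z.eq_dec j (Z.of_nat n)); [ring|]. now destruct Hj.
  - rewrite !mode_map_nonresonant by exact Hj.
    pose proof (denom_neq_0 _ _ Hdx Hj) as Hx0. pose proof (denom_neq_0 _ _ Hdy Hj) as Hy0.
    pose proof decay_bounds as Hq.

    set (s := (a * (y (j - 1)%Z + y (j + 1)%Z) / denom n (shift_of y) j)%C).
    replace (a * (x (j - 1)%Z + x (j + 1)%Z) / denom n (shift_of x) j - s)%C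
      with (a * ((x (j - 1)%Z - y (j - 1)%Z) + (x (j + 1)%Z - y (j + 1)%Z))
              / denom n (shift_of x) j
            - a * (s * ((x (-1)%Z - y (-1)%Z) + (x 1%Z - y 1%Z))) / denom n (shift_of x) j)%C.
    2:{ unfold s. unfold denom in *. unfold shift_of in *. field. split; assumption. }
    assert (Hd2 : forall i k, Cmod ((x i - y i) + (x k - y k)) <= 2 * B).
    { intros i k. triangle.
      pose proof (HB i). pose proof (HB k). lra. }
    assert (Hs : Cmod s <= 1).
    { unfold s. eapply Rle_trans; [now apply quotient_bound|].
      pose proof (Cmod_triangle (y (j - 1)%Z) (y (j + 1)%Z)).
      pose proof (Hy (j - 1)%Z). pose proof (Hy (j + 1)%Z).
      nra. }
    unfold Cminus at 1. triangle. rewrite Cmod_opp.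
    pose proof (quotient_bound (shift_of x) ((x (j - 1)%Z - y (j - 1)%Z) + (x (j + 1)%Z - y (j + 1)%Z)) j Hdx Hj) as Q1.
    pose proof (quotient_bound (shift_of x) (s * ((x (-1)%Z - y (-1)%Z) + (x 1%Z - y 1%Z))) j Hdx Hj) as Q2.
    rewrite Cmod_mult in Q2.
    pose proof (Hd2 (j - 1)%Z (j + 1)%Z) as E1. pose proof (Hd2 (-1)%Z 1%Z) as E2.
    pose proof (Cmod_ge_0 ((x (j - 1)%Z - y (j - 1)%Z) + (x (j + 1)%Z - y (j + 1)%Z))) as G1.
    pose proof (Cmod_ge_0 ((x (-1)%Z - y (-1)%Z) + (x 1%Z - y 1%Z))) as G2.
    pose proof (Cmod_ge_0 s) as G3.
    set (u1 := Cmod ((x (j - 1)%Z - y (j - 1)%Z) + (x (j + 1)%Z - y (j + 1)%Z))) in *.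
    set (u2 := Cmod ((x (-1)%Z - y (-1)%Z) + (x 1%Z - y 1%Z))) in *.
    assert (Cmod s * u2 <= 2 * B) by nra.
    assert (0 <= Cmod s * u2) by nra.
    assert (decay a n / 3 * u1 <= / 300 * (2 * B)) by (apply Rmult_le_compat; lra).
    assert (decay a n / 3 * (Cmod s * u2) <= / 300 * (2 * B)) by (apply Rmult_le_compat; lra).
    lra.
Qed.

(** An eigenvector in Fourier coordinates, normalized at index [0]. For
    [eps = 1] it is symmetric under [j -> n - j], for [eps = -1]
    antisymmetric. *)
Record mode (eps delta : C) (x : Z -> C) : Prop := {
  mode_0 : x 0%Z = RtoC 1;
  mode_n : x (Z.of_nat n) = eps;
  mode_rec : forall j, recurrence a n delta x j
}.

Lemma mode_fixed (eps delta : C) (x : Z -> C) :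
  Cmod delta <= 1 -> mode eps delta x ->
  shift_of x = delta /\ forall j, mode_map eps x j = x j.
Proof.
  intros Hd [H0 H1 Hr].
  assert (Hs : shift_of x = delta).
  { pose proof (Hr 0%Z) as E. unfold recurrence, denom, offset in E. rewrite H0 in E.
    unfold shift_of. simpl in E. rewrite <- E.
    replace (4 * 0 * (INR n - 0)) with 0 by ring. ring. }
  split; [exact Hs|]. intros j. destruct (resonant_dec n j) as [Hj|Hj].
  - unfold mode_map. destruct (Z.eq_dec j 0); [now subst|].
    destruct (Z.eq_dec j (Z.of_nat n)); [now subst|]. now destruct Hj.
  - rewrite mode_map_nonresonant by exact Hj. rewrite Hs. symmetry.
    now apply recurrence_div.
Qed.

(** Turns an arbitrary bound into the one that [mode_map_contracts] requires. *)
Lemma mode_bounded_1 (eps delta : C) (x : Z -> C) :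
  Cmod eps = 1 -> Cmod delta <= 1 -> mode eps delta x -> bounded x ->
  forall j, Cmod (x j) <= 1.
Proof.
  intros He Hd [H0 H1 Hr] [B HB] j.
  cut (Cmod (x j) - 1 <= 0); [lra|]. revert j.
  apply (halving Z (fun j => Cmod (x j) - 1) (B - 1)).
  { intros j. specialize (HB j). lra. }
  intros B' HB' j. pose proof (HB' 0%Z) as B0. rewrite H0, Cmod_1 in B0.
  destruct (resonant_dec n j) as [[Hj|Hj]|Hj].
  - subst j. rewrite H0, Cmod_1. lra.
  - subst j. rewrite H1, He. lra.
  - rewrite (recurrence_div delta x j Hd Hj (Hr j)).
    pose proof (quotient_bound delta (x (j - 1)%Z + x (j + 1)%Z) j Hd Hj).
    pose proof (Cmod_triangle (x (j - 1)%Z) (x (j + 1)%Z)).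
    pose proof (HB' (j - 1)%Z). pose proof (HB' (j + 1)%Z). pose proof decay_bounds.
    nra.
Qed.

Lemma mode_unique (eps d1 d2 : C) (x y : Z -> C) :
  Cmod eps = 1 ->
  Cmod d1 <= 1 -> mode eps d1 x -> bounded x ->
  Cmod d2 <= 1 -> mode eps d2 y -> bounded y ->
  d1 = d2 /\ forall j, x j = y j.
Proof.
  intros He H1 M1 B1 H2 M2 B2.
  pose proof (mode_bounded_1 _ _ _ He H1 M1 B1) as Bx.
  pose proof (mode_bounded_1 _ _ _ He H2 M2 B2) as By.
  destruct (mode_fixed _ _ _ H1 M1) as [S1 F1].
  destruct (mode_fixed _ _ _ H2 M2) as [S2 F2].
  assert (E : forall j, x j = y j).
  { intros j. apply Ceq_minus, Cmod_le_0. revert j.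
    apply (halving Z (fun j => Cmod (x j - y j)) 2).
    - intros j. unfold Cminus. triangle.
      rewrite Cmod_opp. pose proof (Bx j). pose proof (By j). lra.
    - intros B HB j. rewrite <- F1, <- F2. apply mode_map_contracts.
      + now rewrite S1.
      + now rewrite S2.
      + intros k. pose proof (By k). lra.
      + exact HB. }
  split; [|exact E]. rewrite <- S1, <- S2. unfold shift_of. now rewrite !E.
Qed.

Lemma offset_sym (j : Z) : offset n (Z.of_nat n - j) = offset n j.
Proof. unfold offset. rewrite minus_IZR, <- INR_IZR_INZ. ring. Qed.

Lemma recurrence_reverse (delta : C) (x : Z -> C) (j : Z) :
  recurrence a n delta x (Z.of_nat n - j) ->
  recurrence a n delta (fun i => x (Z.of_nat n - i)%Z) j.
Proof.
  unfold recurrence, denom. rewrite offset_sym. intros H. rewrite H.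
  replace (Z.of_nat n - (j - 1))%Z with (Z.of_nat n - j + 1)%Z by ring.
  replace (Z.of_nat n - (j + 1))%Z with (Z.of_nat n - j - 1)%Z by ring. ring.
Qed.

Lemma resonant_reverse (j : Z) : resonant n (Z.of_nat n - j) -> resonant n j.
Proof. unfold resonant. lia. Qed.

Lemma recurrence_lin (delta c d : C) (x y : Z -> C) (j : Z) :
  recurrence a n delta x j -> recurrence a n delta y j ->
  recurrence a n delta (fun i => c * x i + d * y i)%C j.
Proof.
  unfold recurrence. intros H1 H2.
  transitivity (c * (denom n delta j * x j) + d * (denom n delta j * y j))%C; [ring|].
  rewrite H1, H2. ring.
Qed.

(** The reversal [j -> n - j] preserves the recurrence, and both sides agree at
    the resonant indices. *)
Lemma reverse_symmetric (eps delta : C) (x : Z -> C) :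
  (eps * eps = 1)%C -> Cmod delta <= 1 -> bounded x ->
  x 0%Z = RtoC 1 -> x (Z.of_nat n) = eps ->
  (forall j, ~ resonant n j -> recurrence a n delta x j) ->
  forall j, x (Z.of_nat n - j)%Z = (eps * x j)%C.
Proof.
  intros He2 Hd [B HB] H0 H1 Hr j. apply Ceq_minus.
  cut ((1 * x (Z.of_nat n - j)%Z + (- eps) * x j)%C = RtoC 0).
  { intros E. rewrite <- E. ring. }
  revert j. apply (recurrence_unique delta); [exact Hd| | |].
  - exists (B + Cmod eps * B). intros j. triangle.
    rewrite !Cmod_mult, Cmod_opp, Cmod_1, Rmult_1_l.
    apply Rplus_le_compat; [apply HB|]. apply Rmult_le_compat_l; [apply Cmod_ge_0|apply HB].
  - intros j [-> | ->].
    + rewrite Z.sub_0_r, H0, H1. ring.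
    + rewrite Z.sub_diag, H0, H1. transitivity (1 - eps * eps)%C; [ring|rewrite He2; ring].
  - intros j Hj.
    apply (recurrence_lin delta 1 (- eps) (fun i => x (Z.of_nat n - i)%Z) x); [|auto].
    apply recurrence_reverse, Hr. intros H. apply Hj. now apply resonant_reverse.
Qed.

(** The fixed point solves the equations of all indices but [n]. It is
    symmetric or antisymmetric by [reverse_symmetric], and then the equation of
    index [n] is that of index [0]. *)
Theorem mode_exists (eps : C) : Cmod eps = 1 -> (eps * eps = 1)%C ->
  exists delta x, Cmod delta < 1 /\ mode eps delta x /\
    (forall j, Cmod (x j) <= weight j).
Proof.
  intros He He2.
  destruct (contraction_fixpoint Z weight 2 (mode_map eps)) as [x [Hw Hf]].
  - apply weight_bounds.
  - intros x Hx j. destruct (resonant_dec n j) as [Hj|Hj].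
    + assert (Hw : 1 <= weight j).
      { unfold weight. destruct Hj as [-> | ->].
        - pose proof (decay_pow_bounds (Z.abs_nat (Z.of_nat n - 0))). simpl (Z.abs_nat 0).
          rewrite pow_O. lra.
        - rewrite Z.sub_diag. pose proof (decay_pow_bounds (Z.abs_nat (Z.of_nat n))).
          simpl (Z.abs_nat 0). rewrite pow_O. lra. }
      unfold mode_map. destruct (Z.eq_dec j 0); [rewrite Cmod_1; lra|].
      destruct (Z.eq_dec j (Z.of_nat n)); [lra|]. now destruct Hj.
    + rewrite mode_map_nonresonant by exact Hj.
      eapply Rle_trans; [apply quotient_bound; [now apply Rlt_le, shift_bound|exact Hj]|].
      pose proof (weight_step j). pose proof decay_bounds.
      pose proof (Cmod_triangle (x (j - 1)%Z) (x (j + 1)%Z)).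
      pose proof (Hx (j - 1)%Z). pose proof (Hx (j + 1)%Z). pose proof (weight_bounds j).
      assert (decay a n * Cmod (x (j - 1)%Z + x (j + 1)%Z)
              <= decay a n * (weight (j - 1) + weight (j + 1)))
        by (apply Rmult_le_compat_l; lra). lra.
  - intros x y Hx Hy B HB. apply mode_map_contracts; auto using Rlt_le, shift_bound.
    intros j. eapply Rle_trans; [apply Hy|]. apply weight_bounds.
  - pose proof (shift_bound x Hw) as Hd1. pose proof (Rlt_le _ _ Hd1) as Hd.
    set (delta := shift_of x) in *. exists delta, x. split; [exact Hd1|].
    pose proof nat_large as Hnl.
    assert (H0 : x 0%Z = RtoC 1) by (rewrite <- Hf; reflexivity).
    assert (H1 : x (Z.of_nat n) = eps).
    { rewrite <- Hf. unfold mode_map. destruct (Z.eq_dec (Z.of_nat n) 0); [lia|].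
      destruct (Z.eq_dec (Z.of_nat n) (Z.of_nat n)); [reflexivity|lia]. }
    assert (Hr : forall j, ~ resonant n j -> recurrence a n delta x j).
    { intros j Hj. unfold recurrence. rewrite <- (Hf j) at 1.
      rewrite mode_map_nonresonant by exact Hj. fold delta. field.
      now apply denom_neq_0. }
    assert (Hr0 : recurrence a n delta x 0).
    { unfold recurrence, denom, offset. rewrite H0.
      replace (4 * 0 * (INR n - 0)) with 0 by ring. unfold delta, shift_of. simpl. ring. }
    assert (Hsym : forall j, x (Z.of_nat n - j)%Z = (eps * x j)%C).
    { apply (reverse_symmetric eps delta); auto using weight_bounded. }
    split; [|exact Hw]. split; [exact H0|exact H1|].
    intros j. destruct (Z.eq_dec j 0) as [->|Hj0]; [exact Hr0|].
    destruct (Z.eq_dec j (Z.of_nat n)) as [->|Hjn].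
    + assert (R : recurrence a n delta (fun i => x (Z.of_nat n - i)%Z) (Z.of_nat n)).
      { apply recurrence_reverse. now rewrite Z.sub_diag. }
      unfold recurrence in R |- *.
      rewrite (Hsym (Z.of_nat n)), (Hsym (Z.of_nat n - 1)%Z), (Hsym (Z.of_nat n + 1)%Z) in R.
      transitivity (eps * (denom n delta (Z.of_nat n) * (eps * x (Z.of_nat n))))%C.
      * transitivity ((eps * eps) * (denom n delta (Z.of_nat n) * x (Z.of_nat n)))%C;
          [rewrite He2|]; ring.
      * rewrite R.
        transitivity ((eps * eps) * (a * (x (Z.of_nat n - 1)%Z + x (Z.of_nat n + 1)%Z)))%C;
          [|rewrite He2]; ring.
    + apply Hr. unfold resonant. tauto.
Qed.

End Recurrence.

(** * Orders of magnitude *)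

Definition recip (n : nat) : C := RtoC (/ INR n).

Definition bigO (p : nat) (f : nat -> C) : Prop :=
  exists N K, forall n, (N <= n)%nat -> Cmod (f n) <= K * (/ INR n) ^ p.

Lemma recip_bounds (n : nat) : (1 <= n)%nat -> 0 < / INR n <= 1.
Proof.
  intros Hn. apply le_INR in Hn. simpl in Hn. split.
  - apply Rinv_0_lt_compat. lra.
  - rewrite <- Rinv_1. apply Rinv_le_contravar; lra.
Qed.

Lemma eventually_large (a : C) : exists N, forall n, (N <= n)%nat -> large a n.
Proof.
  destruct (INR_unbounded (200 * (1 + Cmod a) ^ 2)) as [N HN].
  exists N. intros n Hn. apply le_INR in Hn. unfold large. lra.
Qed.

(** Here and below, the parameter [a] expresses that only large [n] matter. *)
Lemma bigO_ext (a : C) (p : nat) (f g : nat -> C) :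
  (forall n, large a n -> f n = g n) -> bigO p f -> bigO p g.
Proof.
  intros H [N [K HK]]. destruct (eventually_large a) as [N' HN'].
  exists (max N N'), K. intros n Hn. rewrite <- H by (apply HN'; lia). apply HK. lia.
Qed.

Lemma bigO_bound (a : C) (p : nat) (K : R) (f : nat -> C) :
  (forall n, large a n -> Cmod (f n) <= K * (/ INR n) ^ p) -> bigO p f.
Proof.
  intros H. destruct (eventually_large a) as [N HN]. exists N, K. auto.
Qed.

Lemma bigO_le (a : C) (p : nat) (f g : nat -> C) :
  (forall n, large a n -> Cmod (f n) <= Cmod (g n)) -> bigO p g -> bigO p f.
Proof.
  intros H [N [K HK]]. destruct (eventually_large a) as [N' HN'].
  exists (max N N'), K. intros n Hn. eapply Rle_trans; [apply H, HN'; lia|apply HK; lia].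
Qed.

Lemma bigO_plus (p : nat) (f g : nat -> C) :
  bigO p f -> bigO p g -> bigO p (fun n => f n + g n)%C.
Proof.
  intros [N [K HK]] [N' [K' HK']]. exists (max N N'), (K + K'). intros n Hn.
  triangle.
  pose proof (HK n ltac:(lia)). pose proof (HK' n ltac:(lia)). lra.
Qed.

Lemma bigO_opp (p : nat) (f : nat -> C) : bigO p f -> bigO p (fun n => - f n)%C.
Proof. intros [N [K HK]]. exists N, K. intros n Hn. rewrite Cmod_opp. auto. Qed.

Lemma bigO_minus (p : nat) (f g : nat -> C) :
  bigO p f -> bigO p g -> bigO p (fun n => f n - g n)%C.
Proof. intros Hf Hg. apply (bigO_plus p f); [exact Hf|now apply bigO_opp]. Qed.

Lemma bigO_mult (p q : nat) (f g : nat -> C) :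
  bigO p f -> bigO q g -> bigO (p + q) (fun n => f n * g n)%C.
Proof.
  intros [N [K HK]] [N' [K' HK']]. exists (max N N'), (K * K'). intros n Hn.
  rewrite Cmod_mult, pow_add.
  replace (K * K' * ((/ INR n) ^ p * (/ INR n) ^ q))
    with (K * (/ INR n) ^ p * (K' * (/ INR n) ^ q)) by ring.
  apply Rmult_le_compat; try apply Cmod_ge_0; [apply HK|apply HK']; lia.
Qed.

Lemma bigO_const (c : C) : bigO 0 (fun _ => c).
Proof. exists O, (Cmod c). intros n _. simpl. lra. Qed.

Lemma bigO_scal (p : nat) (c : C) (f : nat -> C) : bigO p f -> bigO p (fun n => c * f n)%C.
Proof. intros H. apply (bigO_mult 0 p _ _ (bigO_const c) H). Qed.

Lemma bigO_weaken (p q : nat) (f : nat -> C) : (p <= q)%nat -> bigO q f -> bigO p f.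
Proof.
  intros Hpq [N [K HK]]. exists (max 1 N), (Rabs K). intros n Hn.
  eapply Rle_trans; [apply HK; lia|].
  destruct (recip_bounds n ltac:(lia)) as [H1 H2].
  replace q with (p + (q - p))%nat by lia. rewrite pow_add.
  pose proof (pow_le (/ INR n) p ltac:(lra)) as P1.
  pose proof (pow_le (/ INR n) (q - p) ltac:(lra)) as P2.
  assert (P3 : (/ INR n) ^ (q - p) <= 1).
  { rewrite <- (pow1 (q - p)). apply pow_incr. lra. }
  apply Rle_trans with (Rabs K * ((/ INR n) ^ p * (/ INR n) ^ (q - p))).
  - apply Rmult_le_compat_r; [|apply Rle_abs]. apply Rmult_le_pos; lra.
  - apply Rmult_le_compat_l; [apply Rabs_pos|].
    rewrite <- (Rmult_1_r ((/ INR n) ^ p)) at 2. apply Rmult_le_compat_l; lra.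
Qed.

Lemma bigO_recip (p : nat) : bigO p (fun n => recip n ^ p)%C.
Proof.
  exists 1%nat, 1. intros n Hn. unfold recip. rewrite <- RtoC_pow, Cmod_R.
  destruct (recip_bounds n Hn). rewrite Rabs_pos_eq by (apply pow_le; lra). lra.
Qed.

Lemma bigO_recip_le (p q : nat) : (p <= q)%nat -> bigO p (fun n => recip n ^ q)%C.
Proof. intros H. exact (bigO_weaken p q _ H (bigO_recip q)). Qed.

Lemma recip_inv (a : C) (n : nat) : large a n ->
  RtoC (INR n) <> RtoC 0 /\ recip n = (/ RtoC (INR n))%C.
Proof.
  intros Hn. pose proof (large_n a n Hn). unfold recip. split.
  - apply RtoC_neq_0. lra.
  - apply RtoC_inv. lra.
Qed.

(** The remainder is [w ^ 2 / (1 + w)]. *)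
Lemma bigO_inv (a : C) (p : nat) (w : nat -> C) :
  (forall n, large a n -> (1 + w n)%C <> RtoC 0) -> (1 <= p)%nat -> bigO p w ->
  bigO (p + p) (fun n => / (1 + w n) - (1 - w n))%C.
Proof.
  intros H0 Hp Hw.
  assert (Hi : bigO 0 (fun n => / (1 + w n))%C).
  { destruct (bigO_weaken 1 p w Hp Hw) as [N [K HK]].
    destruct (eventually_large a) as [N1 HN1]. destruct (INR_unbounded (2 * Rabs K)) as [N2 HN2].
    exists (max 1 (max N (max N1 N2))), 2. intros n Hn.
    specialize (HK n ltac:(lia)). specialize (H0 n (HN1 n ltac:(lia))).
    assert (Hn2 : INR N2 <= INR n) by (apply le_INR; lia).
    assert (Hw2 : Cmod (w n) <= / 2).
    { eapply Rle_trans; [exact HK|]. simpl. rewrite Rmult_1_r.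
      pose proof (Rabs_pos K). pose proof (Rle_abs K).
      apply Rmult_le_reg_r with (INR n); [lra|]. rewrite Rmult_assoc, Rinv_l by lra. lra. }
    pose proof (Cmod_minus_ge 1 (w n)) as Hg. rewrite Cmod_1 in Hg.
    rewrite Cmod_inv by exact H0. simpl. rewrite Rmult_1_r.
    rewrite <- (Rinv_inv 2). apply Rinv_le_contravar; lra. }
  apply (bigO_ext a _ (fun n => w n * w n * / (1 + w n))%C).
  - intros n Hn. field. now apply H0.
  - rewrite <- (Nat.add_0_r (p + p)). apply bigO_mult; [now apply bigO_mult|exact Hi].
Qed.

(** * Sums, products and continuants *)

(** Over [i < m], so that the empty sum is available, unlike with [sum_f_R0]. *)
Fixpoint csum (f : nat -> C) (m : nat) : C :=
  match m with O => RtoC 0 | S m' => (csum f m' + f m')%C end.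

Fixpoint rsum (f : nat -> R) (m : nat) : R :=
  match m with O => 0 | S m' => rsum f m' + f m' end.

Fixpoint cprod (f : nat -> C) (m : nat) : C :=
  match m with O => RtoC 1 | S m' => (cprod f m' * f m')%C end.

Lemma rsum_nonneg (f : nat -> R) (m : nat) : (forall i, (i < m)%nat -> 0 <= f i) -> 0 <= rsum f m.
Proof.
  intros H. induction m as [|m IH]; simpl; [lra|].
  assert (0 <= rsum f m) by (apply IH; intros; apply H; lia). specialize (H m ltac:(lia)). lra.
Qed.

Lemma rsum_le (f g : nat -> R) (m : nat) :
  (forall i, (i < m)%nat -> f i <= g i) -> rsum f m <= rsum g m.
Proof.
  intros H. induction m as [|m IH]; simpl; [lra|].
  assert (rsum f m <= rsum g m) by (apply IH; intros; apply H; lia).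
  specialize (H m ltac:(lia)). lra.
Qed.

Lemma rsum_scal (c : R) (f : nat -> R) (m : nat) : rsum (fun i => c * f i) m = c * rsum f m.
Proof. induction m as [|m IH]; simpl; [ring|rewrite IH; ring]. Qed.

Lemma csum_scal_real (c : C) (f : nat -> R) (m : nat) :
  csum (fun i => c * RtoC (f i))%C m = (c * RtoC (rsum f m))%C.
Proof. induction m as [|m IH]; simpl; [ring|rewrite IH, RtoC_plus; ring]. Qed.

Lemma csum_diff (f g : nat -> C) (b : nat -> R) (m : nat) :
  (forall i, (i < m)%nat -> Cmod (f i - g i) <= b i) ->
  Cmod (csum f m - csum g m) <= rsum b m.
Proof.
  intros H. induction m as [|m IH]; simpl.
  - replace (0 - 0)%C with (RtoC 0) by ring. rewrite Cmod_0. lra.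
  - replace (csum f m + f m - (csum g m + g m))%C
      with ((csum f m - csum g m) + (f m - g m))%C by ring.
    triangle.
    apply Rplus_le_compat; [apply IH; intros; apply H; lia|apply H; lia].
Qed.

Lemma cprod_nonzero (f : nat -> C) (m : nat) :
  (forall i, (i < m)%nat -> f i <> RtoC 0) -> cprod f m <> RtoC 0.
Proof.
  intros H. induction m as [|m IH]; simpl; [apply C1_nz|].
  apply Cmult_neq_0; [apply IH; intros; apply H; lia|apply H; lia].
Qed.

Lemma cprod_ext (f g : nat -> C) (m : nat) :
  (forall i, (i < m)%nat -> f i = g i) -> cprod f m = cprod g m.
Proof.
  intros H. induction m as [|m IH]; simpl; [reflexivity|].
  rewrite IH by (intros; apply H; lia). now rewrite H by lia.
Qed.

(** The partial products stay within twice [s], the sum of the [Cmod (z i)], of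
    [1]; so replacing the product by [1] in front of the next term of the sum
    costs an error of second order in [s]. *)
Lemma cprod_expansion (z : nat -> C) (m : nat) :
  rsum (fun i => Cmod (z i)) m <= / 2 ->
  Cmod (cprod (fun i => 1 + z i)%C m - (1 + csum z m)) <= 2 * rsum (fun i => Cmod (z i)) m ^ 2.
Proof.
  intros Hs. set (s := rsum (fun i => Cmod (z i))) in *.
  assert (Hinc : forall i, 0 <= s i) by (intros i; apply rsum_nonneg; intros; apply Cmod_ge_0).
  assert (H : Cmod (cprod (fun i => 1 + z i)%C m - 1) <= 2 * s m
           /\ Cmod (cprod (fun i => 1 + z i)%C m - (1 + csum z m)) <= 2 * s m ^ 2).
  { induction m as [|m IH].
    - simpl. replace (1 - 1)%C with (RtoC 0) by ring.
      replace (1 - (1 + 0))%C with (RtoC 0) by ring. rewrite Cmod_0.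
      change (s O) with 0. lra.
    - pose proof (Cmod_ge_0 (z m)) as Pz. pose proof (Hinc m) as Ps.
      change (s (S m)) with (s m + Cmod (z m)) in *.
      destruct (IH ltac:(lra)) as [I1 I2]. simpl cprod. simpl csum.
      set (P := cprod (fun i => 1 + z i)%C m) in *. set (S := csum z m) in *.
      split.
      + replace (P * (1 + z m) - 1)%C with ((P - 1) + z m * (P - 1) + z m)%C by ring.
        triangle.
        eapply Rle_trans; [apply Rplus_le_compat_r, Cmod_triangle|]. rewrite Cmod_mult. nra.
      + replace (P * (1 + z m) - (1 + (S + z m)))%C
          with ((P - (1 + S)) + z m * (P - 1))%C by ring.
        triangle. rewrite Cmod_mult. nra. }
  apply H.
Qed.

(** The argument of [cprod_expansion], for the recurrence of a continuant with
    unit diagonal. *)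
Lemma continuant_expansion (k t : nat -> C) (m : nat) :
  k O = RtoC 1 -> k 1%nat = RtoC 1 ->
  (forall i, (i < m)%nat -> k (S (S i)) = (k (S i) - t i * k i)%C) ->
  rsum (fun i => Cmod (t i)) m <= / 2 ->
  Cmod (k (S m) - (1 - csum t m)) <= 2 * rsum (fun i => Cmod (t i)) m ^ 2.
Proof.
  intros K0 K1 Hk Hs. set (s := rsum (fun i => Cmod (t i))) in *.
  assert (Hinc : forall i, 0 <= s i) by (intros i; apply rsum_nonneg; intros; apply Cmod_ge_0).
  assert (Hmono : forall i, s i <= s (S i)).
  { intros i. change (s (S i)) with (s i + Cmod (t i)). pose proof (Cmod_ge_0 (t i)). lra. }
  assert (H : Cmod (k m - 1) <= 2 * s m /\ Cmod (k (S m) - 1) <= 2 * s m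
           /\ Cmod (k (S m) - (1 - csum t m)) <= 2 * s m ^ 2).
  { induction m as [|m IH].
    - rewrite K0, K1. simpl. replace (1 - 1)%C with (RtoC 0) by ring.
      replace (1 - (1 - 0))%C with (RtoC 0) by ring. rewrite Cmod_0.
      change (s O) with 0. lra.
    - pose proof (Cmod_ge_0 (t m)) as Pz. pose proof (Hinc m) as Ps.
      change (s (S m)) with (s m + Cmod (t m)) in *.
      destruct (IH ltac:(intros; apply Hk; lia) ltac:(lra)) as [I0 [I1 I2]].
      rewrite Hk by lia. simpl csum.
      set (S := csum t m) in *. set (T := t m) in *.
      assert (Bk : Cmod (k m) <= 2).
      { replace (k m) with (1 + (k m - 1))%C by ring.
        triangle. rewrite Cmod_1. lra. }
      split; [lra|]. split.
      + replace (k (Datatypes.S m) - T * k m - 1)%C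
          with ((k (Datatypes.S m) - 1) + - (T * k m))%C by ring.
        triangle. rewrite Cmod_opp, Cmod_mult. nra.
      + replace (k (Datatypes.S m) - T * k m - (1 - (S + T)))%C
          with ((k (Datatypes.S m) - (1 - S)) + - (T * (k m - 1)))%C by ring.
        triangle. rewrite Cmod_opp, Cmod_mult. nra. }
  apply H.
Qed.

Definition harmonic (m : nat) : R := rsum (fun i => / INR (S i)) m.

Lemma harmonic_S (m : nat) : harmonic (S m) = harmonic m + / (INR m + 1).
Proof. unfold harmonic at 1. cbn [rsum]. now rewrite S_INR. Qed.

Lemma harmonic_le (m : nat) : 0 <= harmonic m <= INR m.
Proof.
  split.
  - apply rsum_nonneg. intros i _. left. apply Rinv_0_lt_compat, lt_0_INR. lia.
  - induction m as [|m IH]; [unfold harmonic; simpl; lra|].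
    rewrite harmonic_S. destruct (recip_bounds (S m) ltac:(lia)) as [_ H].
    rewrite S_INR in *. lra.
Qed.

(** [1 / (j (n - j)) = (1 / j + 1 / (n - j)) / n]. *)
Lemma sum_inv_offset (n m r : nat) : (m + r = n - 1)%nat -> (1 <= n)%nat ->
  rsum (fun i => / (4 * INR (S i) * (INR n - INR (S i)))) m
  = (harmonic m + harmonic (n - 1) - harmonic r) / (4 * INR n).
Proof.
  intros Hmr Hn. revert r Hmr. induction m as [|m IH]; intros r Hmr.
  - replace r with (n - 1)%nat by lia. simpl. unfold harmonic at 1. simpl.
    unfold Rdiv. ring.
  - cbn [rsum]. rewrite (IH (S r)) by lia. rewrite !harmonic_S.
    assert (E : INR n = INR m + INR r + 2).
    { replace n with (m + r + 2)%nat by lia. rewrite !plus_INR. simpl. ring. }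
    rewrite !S_INR, E. pose proof (pos_INR m). pose proof (pos_INR r).
    field. repeat split; lra.
Qed.

(** In the partial fraction decomposition the products of consecutive integers
    telescope and the other products are summed as in [sum_inv_offset]. *)
Lemma sum_inv_offset_pairs (n m r : nat) : (m + r + 2 = n)%nat ->
  rsum (fun i => / (INR (S i) * (INR n - INR (S i)) * (INR (S i) + 1) * (INR n - INR (S i) - 1))) m
  = (1 - / (INR m + 1) + / (INR r + 1) - / (INR n - 1)
     + (harmonic m + harmonic (n - 1) - harmonic (S r)
        + harmonic (n - 2) - harmonic r + harmonic (S m) - 1) / INR n) / (INR n ^ 2 - 1).
Proof.
  revert r. induction m as [|m IH]; intros r Hmr.
  - replace (n - 1)%nat with (S r) by lia. replace (n - 2)%nat with r by lia.
    assert (E : INR n = INR r + 2) by (replace n with (r + 2)%nat by lia; rewrite plus_INR; simpl; ring).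
    pose proof (pos_INR r). rewrite E. unfold harmonic at 1 6. simpl.
    field. repeat split; nra.
  - cbn [rsum]. rewrite (IH (S r)) by lia. rewrite !harmonic_S.
    assert (E : INR n = INR m + INR r + 3).
    { replace n with (m + r + 3)%nat by lia. rewrite !plus_INR. simpl. ring. }
    rewrite !S_INR, E. pose proof (pos_INR m). pose proof (pos_INR r).
    field. repeat split; nra.
Qed.

(** At [m = n - 1] this gives [4 ^ (n - 1) (n - 1)! ^ 2]; the factor [r!] is what
    makes the induction on [m] work. *)
Lemma prod_offset (n m r : nat) : (m + r + 1 = n)%nat ->
  (cprod (fun i => RtoC (4 * INR (S i) * (INR n - INR (S i)))) m * RtoC (INR (fact r))
  = RtoC (4 ^ m) * RtoC (INR (fact m)) * RtoC (INR (fact (n - 1))))%C.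
Proof.
  revert r. induction m as [|m IH]; intros r Hmr.
  - replace (n - 1)%nat with r by lia. simpl. ring.
  - cbn [cprod]. specialize (IH (S r) ltac:(lia)).
    assert (E : INR n - INR (S m) = INR (S r)).
    { rewrite <- minus_INR by lia. f_equal. lia. }
    rewrite E. rewrite (fact_simpl r), mult_INR, RtoC_mult in IH.
    rewrite (fact_simpl m), mult_INR.
    transitivity (RtoC 4 * RtoC (INR (S m)) *
      (cprod (fun i => RtoC (4 * INR (S i) * (INR n - INR (S i)))) m
        * (RtoC (INR (S r)) * RtoC (INR (fact r)))))%C.
    + rewrite !RtoC_mult. ring.
    + rewrite IH. simpl (4 ^ S m). rewrite !RtoC_mult. ring.
Qed.

(** * Expansion of the shift and of the first coefficients *)

Section Expansions.
Variables (a eps : C) (d : nat -> C) (x : nat -> Z -> C).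
Hypothesis Hd : forall n, large a n -> Cmod (d n) <= 1.
Hypothesis Hm : forall n, large a n -> mode a n eps (d n) (x n).
Hypothesis Hw : forall n, large a n -> forall j, Cmod (x n j) <= weight a n j.

Definition inv_denom (n : nat) (j : Z) : C := (/ denom n (d n) j)%C.

Lemma small_nonresonant (n : nat) (j : Z) : large a n -> j <> 0%Z -> (j <= 10)%Z -> ~ resonant n j.
Proof. intros Hn Hj Hj2. pose proof (nat_large a n Hn). unfold resonant. lia. Qed.

Lemma shift_bigO_0 : bigO 0 d.
Proof. apply (bigO_bound a 0 1). intros n Hn. simpl. rewrite Rmult_1_l. auto. Qed.

Lemma entry_bigO (j : Z) (k : nat) : (k <= Z.abs_nat j)%nat -> (Z.abs_nat j <= 10)%nat ->
  bigO k (fun n => x n j).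
Proof.
  intros H1 H2. apply (bigO_bound a k (2 * Cmod a ^ k)). intros n Hn.
  pose proof (nat_large a n Hn).
  eapply Rle_trans; [apply (Hw n Hn)|].
  eapply Rle_trans; [apply (weight_near a n Hn j k); lia|].
  unfold decay, Rdiv. rewrite Rpow_mult_distr. lra.
Qed.

Lemma inv_denom_bigO (j : Z) : j <> 0%Z -> (j <= 10)%Z -> bigO 1 (fun n => inv_denom n j).
Proof.
  intros H1 H2. apply (bigO_bound a 1 1). intros n Hn. unfold inv_denom.
  pose proof (small_nonresonant n j Hn H1 H2) as Hj. pose proof (large_n a n Hn).
  rewrite Cmod_inv by (apply (denom_neq_0 a n Hn); auto).
  pose proof (denom_bound a n Hn (d n) j (Hd n Hn) Hj).
  simpl. rewrite Rmult_1_l, Rmult_1_r. apply Rinv_le_contravar; lra.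
Qed.

Lemma denom_formula (n : nat) (j : Z) :
  denom n (d n) j
  = (4 * RtoC (IZR j) * RtoC (INR n) - 4 * RtoC (IZR j) * RtoC (IZR j) + d n)%C.
Proof.
  unfold denom, offset. rewrite !RtoC_mult, RtoC_minus. ring.
Qed.

Lemma denom_formula_neq_0 (n : nat) (j : Z) : large a n -> j <> 0%Z -> (j <= 10)%Z ->
  (4 * RtoC (IZR j) * RtoC (INR n) - 4 * RtoC (IZR j) * RtoC (IZR j) + d n)%C <> RtoC 0.
Proof.
  intros Hn H1 H2. rewrite <- denom_formula. apply (denom_neq_0 a n Hn); [auto|].
  now apply small_nonresonant.
Qed.

Lemma IZR_C_neq_0 (j : Z) : j <> 0%Z -> RtoC (IZR j) <> RtoC 0.
Proof. intros Hj. now apply RtoC_neq_0, IZR_neq. Qed.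

Lemma inv_denom_first (j : Z) : j <> 0%Z -> (j <= 10)%Z ->
  bigO 2 (fun n => inv_denom n j - / (4 * RtoC (IZR j)) * recip n)%C.
Proof.
  intros H1 H2. pose proof (IZR_C_neq_0 j H1) as Hj.
  apply (bigO_ext a _ (fun n => / (4 * RtoC (IZR j)) * (4 * RtoC (IZR j) * RtoC (IZR j) - d n)
                                 * (recip n ^ 1 * inv_denom n j))%C).
  - intros n Hn. pose proof (denom_formula_neq_0 n j Hn H1 H2) as E.
    destruct (recip_inv a n Hn) as [Hz ->]. unfold inv_denom. rewrite denom_formula.
    field. repeat split; assumption.
  - apply (bigO_mult 0 2).
    + apply bigO_scal, bigO_minus; [apply bigO_const|apply shift_bigO_0].
    + apply (bigO_mult 1 1); [apply bigO_recip|now apply inv_denom_bigO].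
Qed.

Lemma inv_denom_second (j : Z) : bigO 1 d -> j <> 0%Z -> (j <= 10)%Z ->
  bigO 3 (fun n => inv_denom n j - (/ (4 * RtoC (IZR j)) * recip n + / 4 * recip n ^ 2))%C.
Proof.
  intros Hd1 H1 H2. pose proof (IZR_C_neq_0 j H1) as Hj.
  apply (bigO_ext a _ (fun n => (RtoC (IZR j) * RtoC (IZR j) * recip n ^ 2
           - d n * (/ (4 * RtoC (IZR j)) * recip n ^ 1 + / 4 * recip n ^ 2)) * inv_denom n j)%C).
  - intros n Hn. pose proof (denom_formula_neq_0 n j Hn H1 H2) as E.
    destruct (recip_inv a n Hn) as [Hz ->]. unfold inv_denom. rewrite denom_formula.
    field. repeat split; assumption.
  - apply (bigO_mult 2 1); [|now apply inv_denom_bigO]. apply bigO_minus.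
    + apply bigO_scal, bigO_recip.
    + apply (bigO_mult 1 1); [exact Hd1|].
      apply bigO_plus; apply bigO_scal, bigO_recip_le; lia.
Qed.

Lemma shift_eq (n : nat) : large a n -> d n = (a * (x n (-1)%Z + x n 1%Z))%C.
Proof.
  intros Hn. symmetry. exact (proj1 (mode_fixed a n Hn eps (d n) (x n) (Hd n Hn) (Hm n Hn))).
Qed.

Lemma shift_bigO_1 : bigO 1 d.
Proof.
  apply (bigO_ext a _ (fun n => a * (x n (-1)%Z + x n 1%Z))%C).
  - intros n Hn. now rewrite <- shift_eq.
  - apply bigO_scal, bigO_plus; apply entry_bigO; simpl; lia.
Qed.

Lemma entry_eq (n : nat) (j : Z) : large a n -> j <> 0%Z -> (j <= 10)%Z ->
  x n j = (a * (x n (j - 1)%Z + x n (j + 1)%Z) * inv_denom n j)%C.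
Proof.
  intros Hn H1 H2. destruct (Hm n Hn) as [_ _ Hr].
  apply (recurrence_div a n Hn (d n) (x n) j (Hd n Hn)); [|apply Hr].
  now apply small_nonresonant.
Qed.

Lemma entry_1_eq (n : nat) (j : Z) : large a n -> (j = 1 \/ j = -1)%Z ->
  x n j = (a * (1 + x n (2 * j)%Z) * inv_denom n j)%C.
Proof.
  intros Hn Hj. rewrite (entry_eq n j Hn) by lia. destruct (Hm n Hn) as [H0 _ _].
  destruct Hj as [-> | ->]; simpl; rewrite H0; ring.
Qed.

Lemma entry_1_first (j : Z) : (j = 1 \/ j = -1)%Z ->
  bigO 2 (fun n => x n j - a * (/ (4 * RtoC (IZR j)) * recip n))%C.
Proof.
  intros Hj.
  apply (bigO_ext a _ (fun n => a * (inv_denom n j - / (4 * RtoC (IZR j)) * recip n)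
                                 + a * (x n (2 * j)%Z * inv_denom n j))%C).
  - intros n Hn. rewrite (entry_1_eq n j Hn Hj). ring.
  - apply bigO_plus; apply bigO_scal.
    + apply inv_denom_first; lia.
    + apply (bigO_weaken 2 3); [lia|].
      apply (bigO_mult 2 1); [apply entry_bigO; lia|apply inv_denom_bigO; lia].
Qed.

Lemma entry_1_second (j : Z) : (j = 1 \/ j = -1)%Z ->
  bigO 3 (fun n => x n j - a * (/ (4 * RtoC (IZR j)) * recip n + / 4 * recip n ^ 2))%C.
Proof.
  intros Hj.
  apply (bigO_ext a _ (fun n => a * (inv_denom n j - (/ (4 * RtoC (IZR j)) * recip n + / 4 * recip n ^ 2))
                                 + a * (x n (2 * j)%Z * inv_denom n j))%C).
  - intros n Hn. rewrite (entry_1_eq n j Hn Hj). ring.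
  - apply bigO_plus; apply bigO_scal.
    + apply inv_denom_second; [exact shift_bigO_1|lia|lia].
    + apply (bigO_mult 2 1); [apply entry_bigO; lia|apply inv_denom_bigO; lia].
Qed.

(** The leading coefficient is the same at the indices [2] and [-2]; this is
    what makes [shift_remainder] small. *)
Lemma entry_2_first (j : Z) : (j = 1 \/ j = -1)%Z ->
  bigO 3 (fun n => x n (2 * j)%Z - a ^ 2 / 32 * recip n ^ 2)%C.
Proof.
  intros Hj. assert (Hc : RtoC (IZR j) <> RtoC 0) by (apply IZR_C_neq_0; lia).
  assert (Hcc : (RtoC (IZR j) * RtoC (IZR j) = 1)%C).
  { destruct Hj as [-> | ->]; rewrite <- RtoC_mult; f_equal; ring. }
  set (c := RtoC (IZR j)) in *.
  apply (bigO_ext a _ (fun n => a * ((x n j - a * (/ (4 * c) * recip n)) * inv_denom n (2 * j))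
     + a * (x n (3 * j)%Z * inv_denom n (2 * j))
     + a ^ 2 / (4 * c) * (recip n ^ 1 * (inv_denom n (2 * j) - / (4 * RtoC (IZR (2 * j))) * recip n)))%C).
  - intros n Hn.
    assert (E : x n (2 * j)%Z = (a * (x n j + x n (3 * j)%Z) * inv_denom n (2 * j))%C).
    { rewrite (entry_eq n (2 * j) Hn) by lia. destruct Hj as [-> | ->]; simpl; ring. }
    rewrite E. rewrite mult_IZR, RtoC_mult. fold c.
    transitivity (a * (x n j + x n (3 * j)%Z) * inv_denom n (2 * j)
                    - a ^ 2 / (32 * (c * c)) * recip n ^ 2)%C.
    + field. exact Hc.
    + rewrite Hcc. field.
  - apply bigO_plus; [apply bigO_plus|]; apply bigO_scal.
    + apply (bigO_mult 2 1); [now apply entry_1_first|apply inv_denom_bigO; lia].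
    + apply (bigO_weaken 3 4); [lia|].
      apply (bigO_mult 3 1); [apply entry_bigO; lia|apply inv_denom_bigO; lia].
    + apply (bigO_mult 1 2); [apply bigO_recip|apply inv_denom_first; lia].
Qed.

Lemma inv_denom_sum : bigO 2 (fun n => inv_denom n 1 + inv_denom n (-1))%C.
Proof.
  apply (bigO_ext a _ (fun n => (-8 + 2 * d n) * (inv_denom n 1 * inv_denom n (-1)))%C).
  - intros n Hn. pose proof (denom_formula_neq_0 n 1 Hn ltac:(lia) ltac:(lia)) as E1.
    pose proof (denom_formula_neq_0 n (-1) Hn ltac:(lia) ltac:(lia)) as E2.
    unfold inv_denom. rewrite !denom_formula.
    set (D1 := (4 * RtoC 1 * RtoC (INR n) - 4 * RtoC 1 * RtoC 1 + d n)%C) in *.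
    set (D2 := (4 * RtoC (-1) * RtoC (INR n) - 4 * RtoC (-1) * RtoC (-1) + d n)%C) in *.
    replace (-8 + 2 * d n)%C with (D1 + D2)%C by (unfold D1, D2; ring).
    field. split; assumption.
  - apply (bigO_mult 0 2).
    + apply bigO_plus; [apply bigO_const|apply bigO_scal, shift_bigO_0].
    + apply (bigO_mult 1 1); apply inv_denom_bigO; lia.
Qed.

Lemma shift_split (n : nat) : large a n ->
  d n = (a ^ 2 * (inv_denom n 1 + inv_denom n (-1))
         + a ^ 2 * (x n 2%Z * (inv_denom n 1 + inv_denom n (-1))
                    + (x n (-2)%Z - x n 2%Z) * inv_denom n (-1)))%C.
Proof.
  intros Hn. rewrite (shift_eq n Hn) at 1.
  rewrite (entry_1_eq n 1 Hn), (entry_1_eq n (-1) Hn) by lia. simpl. ring.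
Qed.

Lemma shift_remainder : bigO 4 (fun n => x n 2%Z * (inv_denom n 1 + inv_denom n (-1))
                    + (x n (-2)%Z - x n 2%Z) * inv_denom n (-1))%C.
Proof.
  apply bigO_plus.
  - apply (bigO_mult 2 2); [apply entry_bigO; simpl; lia|exact inv_denom_sum].
  - apply (bigO_mult 3 1); [|apply inv_denom_bigO; lia].
    apply (bigO_ext a _ (fun n => (x n (2 * -1)%Z - a ^ 2 / 32 * recip n ^ 2)
                                   - (x n (2 * 1)%Z - a ^ 2 / 32 * recip n ^ 2))%C).
    + intros n _. simpl. ring.
    + apply bigO_minus; apply entry_2_first; lia.
Qed.

Lemma shift_bigO_2 : bigO 2 d.
Proof.
  apply (bigO_ext a _ (fun n => a ^ 2 * (inv_denom n 1 + inv_denom n (-1))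
         + a ^ 2 * (x n 2%Z * (inv_denom n 1 + inv_denom n (-1))
                    + (x n (-2)%Z - x n 2%Z) * inv_denom n (-1)))%C).
  - intros n Hn. symmetry. now apply shift_split.
  - apply bigO_plus; apply bigO_scal; [exact inv_denom_sum|].
    apply (bigO_weaken 2 4); [lia|exact shift_remainder].
Qed.

(** The neighbours [1] and [-1] of the index [0] have denominators [D] with
    nearly opposite values, so the main term [a ^ 2 (1 / D_1 + 1 / D_(-1))] is
    close to [a ^ 2 / (2 n ^ 2)] and the next one, of apparent order [n ^ -3],
    is of order [n ^ -4]. *)
Theorem shift_expansion : bigO 4 (fun n => d n - a ^ 2 / 2 * recip n ^ 2)%C.
Proof.
  apply (bigO_ext a _ (fun n =>
      a ^ 2 * ((2 * d n + (-16 + 8 * d n - d n * d n) / 2 * recip n ^ 2)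
               * (inv_denom n 1 * inv_denom n (-1)))
      + a ^ 2 * (x n 2%Z * (inv_denom n 1 + inv_denom n (-1))
                    + (x n (-2)%Z - x n 2%Z) * inv_denom n (-1)))%C).
  - intros n Hn. rewrite (shift_split n Hn) at 5.
    pose proof (denom_formula_neq_0 n 1 Hn ltac:(lia) ltac:(lia)) as E1.
    pose proof (denom_formula_neq_0 n (-1) Hn ltac:(lia) ltac:(lia)) as E2.
    assert (E : (inv_denom n 1 + inv_denom n (-1) - / 2 * recip n ^ 2
      = (2 * d n + (-16 + 8 * d n - d n * d n) / 2 * recip n ^ 2)
               * (inv_denom n 1 * inv_denom n (-1)))%C).
    { destruct (recip_inv a n Hn) as [Hz ->].
      unfold inv_denom. rewrite !denom_formula.
      set (D1 := (4 * RtoC 1 * RtoC (INR n) - 4 * RtoC 1 * RtoC 1 + d n)%C) in *.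
      set (D2 := (4 * RtoC (-1) * RtoC (INR n) - 4 * RtoC (-1) * RtoC (-1) + d n)%C) in *.
      assert (ED : (2 * d n + (-16 + 8 * d n - d n * d n) / 2 * (/ RtoC (INR n)) ^ 2
                   = D1 + D2 - D1 * D2 / 2 * (/ RtoC (INR n)) ^ 2)%C).
      { unfold D1, D2. field. exact Hz. }
      rewrite ED. field. repeat split; assumption. }
    rewrite <- E. field.
  - apply bigO_plus; apply bigO_scal; [|exact shift_remainder].
    apply (bigO_mult 2 2).
    + apply bigO_plus; [apply bigO_scal, shift_bigO_2|].
      apply (bigO_mult 0 2); [|apply bigO_recip].
      apply (bigO_ext a _ (fun n => / 2 * (-16 + 8 * d n - d n * d n))%C).
      { intros n _. field. }
      apply bigO_scal, bigO_minus.
      * apply bigO_plus; [apply bigO_const|apply bigO_scal, shift_bigO_0].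
      * apply (bigO_mult 0 0); apply shift_bigO_0.
    + apply (bigO_mult 1 1); apply inv_denom_bigO; lia.
Qed.

End Expansions.

(** * Determinants of the truncated recurrence *)

Lemma cprod_mult (f g : nat -> C) (m : nat) :
  cprod (fun i => f i * g i)%C m = (cprod f m * cprod g m)%C.
Proof. induction m as [|m IH]; simpl; [ring|rewrite IH; ring]. Qed.

(** Two consecutive terms of the solution of the recurrence that starts with
    [0] and [1]. Up to a power of [a], its term of index [i] is the determinant
    of the tridiagonal matrix of the indices from [1] to [i - 1]. *)
Fixpoint fwd_pair (a : C) (n : nat) (delta : C) (i : nat) : C * C :=
  match i with
  | O => (RtoC 0, RtoC 1)
  | S i' => let p := fwd_pair a n delta i' in
            (snd p, (denom n delta (Z.of_nat i) * snd p - a * fst p) / a)%C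
  end.

Definition fwd (a : C) (n : nat) (delta : C) (i : nat) : C := fst (fwd_pair a n delta i).

Definition offs (n i : nat) : R := 4 * INR (S i) * (INR n - INR (S i)).

Lemma offset_offs (n i : nat) : offset n (Z.of_nat (S i)) = offs n i.
Proof. unfold offset, offs. now rewrite <- INR_IZR_INZ. Qed.

Section Forward.
Variables (a : C) (n : nat) (delta : C).
Hypothesis Hn : large a n.
Hypothesis Ha : a <> RtoC 0.
Hypothesis Hd : Cmod delta <= 1.

Let D (i : nat) : C := denom n delta (Z.of_nat (S i)).

Lemma fwd_rec (i : nat) :
  (a * fwd a n delta (S (S i)) = D i * fwd a n delta (S i) - a * fwd a n delta i)%C.
Proof.
  transitivity (a * ((D i * fwd a n delta (S i) - a * fwd a n delta i) / a))%C; [reflexivity|].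
  field. exact Ha.
Qed.

Lemma middle_nonresonant (i : nat) : (S i < n)%nat -> ~ resonant n (Z.of_nat (S i)).
Proof. unfold resonant. lia. Qed.

Lemma offs_bound (i : nat) : (S i < n)%nat -> 3 * INR n <= offs n i.
Proof.
  intros Hi. pose proof (offset_bound a n Hn _ (middle_nonresonant i Hi)) as H.
  rewrite offset_offs in H. pose proof (large_n a n Hn).
  assert (0 < offs n i).
  { unfold offs. apply lt_INR in Hi. assert (0 < INR (S i)) by (apply lt_0_INR; lia).
    apply Rmult_lt_0_compat; lra. }
  rewrite Rabs_pos_eq in H; lra.
Qed.

Lemma D_formula (i : nat) : D i = (RtoC (offs n i) + delta)%C.
Proof. unfold D, denom. now rewrite offset_offs. Qed.

Lemma D_neq_0 (i : nat) : (S i < n)%nat -> D i <> RtoC 0.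
Proof. intros Hi. apply (denom_neq_0 a n Hn); [exact Hd|now apply middle_nonresonant]. Qed.

(** The diagonal entry dominates in the recurrence. *)
Lemma fwd_growth (i : nat) : (S i <= n)%nat ->
  fwd a n delta (S i) <> RtoC 0 /\
  Cmod (fwd a n delta i) <= decay a n * Cmod (fwd a n delta (S i)).
Proof.
  pose proof (large_n a n Hn) as Hl. pose proof (decay_bounds a n Hn) as Hq.
  pose proof (decay_mult a n Hn) as HA.
  induction i as [|i IH]; intros Hi.
  - unfold fwd. simpl. split; [apply C1_nz|]. rewrite Cmod_0, Cmod_1. lra.
  - destruct (IH ltac:(lia)) as [I1 I2].
    pose proof (fwd_rec i) as E. apply (f_equal Cmod) in E.
    pose proof (Cmod_minus_ge (D i * fwd a n delta (S i)) (- (a * fwd a n delta i))) as G.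
    rewrite Cmod_opp in G. unfold Cminus in E. rewrite <- E in G. rewrite !Cmod_mult in G.
    pose proof (denom_bound a n Hn delta _ Hd (middle_nonresonant i ltac:(lia))) as B.
    fold (D i) in B.
    apply Cmod_gt_0 in I1. set (f0 := Cmod (fwd a n delta i)) in *.
    set (f1 := Cmod (fwd a n delta (S i))) in *.
    set (f2 := Cmod (fwd a n delta (S (S i)))) in *.
    assert (P0 : 0 <= f0) by apply Cmod_ge_0. assert (P2 : 0 <= f2) by apply Cmod_ge_0.
    assert (L1 : 3 * INR n * f1 <= Cmod (D i) * f1) by (apply Rmult_le_compat_r; lra).
    assert (L2 : f0 <= f1) by nra.
    assert (L3 : Cmod a * f0 <= INR n * f1).
    { apply Rmult_le_compat; [apply Cmod_ge_0|exact P0| |exact L2]. rewrite HA. nra. }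
    assert (L4 : 2 * INR n * f1 <= INR n * (decay a n * f2)).
    { assert (E2 : Cmod a * f2 = INR n * (decay a n * f2)) by (rewrite HA; ring). lra. }
    assert (L5 : 2 * f1 <= decay a n * f2).
    { apply Rmult_le_reg_l with (INR n); lra. }
    split; [|lra]. apply Cmod_gt_0. fold f2. nra.
Qed.

Lemma fwd_n_neq_0 : fwd a n delta n <> RtoC 0.
Proof.
  pose proof (nat_large a n Hn). replace n with (S (n - 1)) at 2 by lia.
  apply fwd_growth. lia.
Qed.

Lemma fwd_ratio : exists r, (fwd a n delta (n - 1) = r * fwd a n delta n)%C /\
  Cmod r <= decay a n.
Proof.
  pose proof (nat_large a n Hn). exists (fwd a n delta (n - 1) / fwd a n delta n)%C.
  split; [field; exact fwd_n_neq_0|].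
  destruct (fwd_growth (n - 1) ltac:(lia)) as [_ G].
  replace (S (n - 1)) with n in G by lia.
  apply Cmod_div_le; [exact fwd_n_neq_0|exact G].
Qed.

Lemma fwd_before_last : Cmod (fwd a n delta (n - 2)) <= decay a n ^ 2 * Cmod (fwd a n delta n).
Proof.
  pose proof (nat_large a n Hn). pose proof (decay_bounds a n Hn).
  destruct (fwd_growth (n - 1) ltac:(lia)) as [_ G1].
  destruct (fwd_growth (n - 2) ltac:(lia)) as [_ G2].
  replace (S (n - 1)) with n in G1 by lia. replace (S (n - 2)) with (n - 1)%nat in G2 by lia.
  eapply Rle_trans; [exact G2|]. simpl. rewrite Rmult_1_r, Rmult_assoc.
  apply Rmult_le_compat_l; lra.
Qed.

Lemma fwd_ratio_eq :
  (fwd a n delta (n - 1) / fwd a n delta n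
   = a * (1 + fwd a n delta (n - 2) / fwd a n delta n) / denom n delta 1)%C.
Proof.
  pose proof (nat_large a n Hn). pose proof fwd_n_neq_0 as Hf.
  pose proof (fwd_rec (n - 2)) as E.
  replace (S (S (n - 2))) with n in E by lia. replace (S (n - 2)) with (n - 1)%nat in E by lia.
  assert (ED : D (n - 2) = denom n delta 1).
  { unfold D, denom. replace (Z.of_nat (S (n - 2))) with (Z.of_nat n - 1)%Z by lia.
    now rewrite offset_sym. }
  rewrite ED in E.
  assert (HD : denom n delta 1 <> RtoC 0).
  { apply (denom_neq_0 a n Hn); [exact Hd|]. unfold resonant. lia. }
  assert (E' : fwd a n delta (n - 1)
    = (a * (fwd a n delta n + fwd a n delta (n - 2)) / denom n delta 1)%C).
  { transitivity ((denom n delta 1 * fwd a n delta (n - 1) - a * fwd a n delta (n - 2)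
       + a * fwd a n delta (n - 2)) / denom n delta 1)%C; [field; exact HD|].
    rewrite <- E. field. exact HD. }
  rewrite E'. field. split; assumption.
Qed.

(** The Casoratian of the mode and the forward solution is constant; its values
    at the two ends of the range from [0] to [n] are compared. *)
Lemma mode_fwd (eps : C) (x : Z -> C) : (eps * eps = 1)%C ->
  mode a n eps delta x -> bounded x ->
  (x 1%Z * fwd a n delta n = fwd a n delta (n - 1) + eps)%C.
Proof.
  intros He2 Hm Hb. pose proof (nat_large a n Hn) as Hnat. destruct Hm as [H0 H1 Hr].
  assert (HC : forall i, (i < n)%nat ->
    (x (Z.of_nat (S i)) * fwd a n delta i - x (Z.of_nat i) * fwd a n delta (S i) = -1)%C).
  { induction i as [|i IH]; intros Hi.
    - change (Z.of_nat 0) with 0%Z. rewrite H0. unfold fwd. simpl. ring.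
    - rewrite <- (IH ltac:(lia)).
      pose proof (Hr (Z.of_nat (S i))) as R. unfold recurrence in R. fold (D i) in R.
      replace (Z.of_nat (S i) - 1)%Z with (Z.of_nat i) in R by lia.
      replace (Z.of_nat (S i) + 1)%Z with (Z.of_nat (S (S i))) in R by lia.
      pose proof (fwd_rec i) as F.
      set (x0 := x (Z.of_nat i)) in *. set (x1 := x (Z.of_nat (S i))) in *.
      set (x2 := x (Z.of_nat (S (S i)))) in *.
      set (f0 := fwd a n delta i) in *. set (f1 := fwd a n delta (S i)) in *.
      set (f2 := fwd a n delta (S (S i))) in *.
      transitivity (/ a * ((a * (x0 + x2)) * f1 - x1 * (a * f2) - a * x0 * f1))%C; [field; exact Ha|].
      rewrite <- R, F. field. exact Ha. }
  specialize (HC (n - 1)%nat ltac:(lia)). replace (S (n - 1)) with n in HC by lia.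
  assert (Hs : x (Z.of_nat n - 1)%Z = (eps * x 1%Z)%C).
  { apply (reverse_symmetric a n Hn eps delta); auto. }
  replace (Z.of_nat (n - 1)) with (Z.of_nat n - 1)%Z in HC by lia.
  rewrite H1, Hs in HC.
  transitivity ((eps * eps) * (fwd a n delta (n - 1))
     - eps * (eps * fwd a n delta (n - 1) - eps * x 1%Z * fwd a n delta n)
     + (1 - eps * eps) * (x 1%Z * fwd a n delta n))%C; [|rewrite HC, He2; ring].
  transitivity ((eps * eps) * x 1%Z * fwd a n delta n
     + (1 - eps * eps) * (x 1%Z * fwd a n delta n))%C; [rewrite He2|]; ring.
Qed.

(** The determinant divided by the product of its diagonal; it satisfies the
    recurrence of a continuant with off-diagonal products [coupling]. *)
Definition kappa (i : nat) : C := (fwd a n delta (S i) * a ^ i / cprod D i)%C.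

Definition coupling (i : nat) : C := (a ^ 2 / (D i * D (S i)))%C.

Lemma kappa_0 : kappa 0 = RtoC 1.
Proof. unfold kappa, fwd. simpl. field. Qed.

Lemma kappa_1 : kappa 1 = RtoC 1.
Proof.
  pose proof (nat_large a n Hn). unfold kappa. pose proof (fwd_rec 0) as E.
  unfold fwd at 2 3 in E. simpl in E. simpl.
  transitivity ((a * fwd a n delta 2) / D 0)%C; [field; apply D_neq_0; lia|].
  rewrite E. field. apply D_neq_0. lia.
Qed.

Lemma kappa_rec (i : nat) : (i < n - 2)%nat ->
  kappa (S (S i)) = (kappa (S i) - coupling i * kappa i)%C.
Proof.
  intros Hi. unfold kappa, coupling. pose proof (fwd_rec (S i)) as E.
  assert (H1 : D i <> RtoC 0) by (apply D_neq_0; lia).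
  assert (H2 : D (S i) <> RtoC 0) by (apply D_neq_0; lia).
  assert (H3 : cprod D i <> RtoC 0) by (apply cprod_nonzero; intros; apply D_neq_0; lia).
  cbn [cprod].
  transitivity (a ^ (S i) * (a * fwd a n delta (S (S (S i)))) / (cprod D i * D i * D (S i)))%C.
  - simpl. field. repeat split; assumption.
  - rewrite E. simpl. field. repeat split; assumption.
Qed.

(** The determinant divided by the product of its diagonal at [delta = 0]. *)
Definition rel_det : C := (cprod (fun i => 1 + delta / RtoC (offs n i)) (n - 1) * kappa (n - 1))%C.

Lemma fwd_n_factor :
  (fwd a n delta n * a ^ (n - 1) = cprod (fun i => RtoC (offs n i)) (n - 1) * rel_det)%C.
Proof.
  pose proof (nat_large a n Hn). unfold rel_det. rewrite Cmult_assoc, <- cprod_mult.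
  rewrite (cprod_ext _ D).
  - unfold kappa. replace (S (n - 1)) with n by lia. field.
    apply cprod_nonzero. intros i Hi. apply D_neq_0. lia.
  - intros i Hi. rewrite D_formula. field. apply RtoC_neq_0.
    pose proof (offs_bound i ltac:(lia)). pose proof (large_n a n Hn). lra.
Qed.

Lemma rel_det_neq_0 : rel_det <> RtoC 0.
Proof.
  intros H0. pose proof fwd_n_factor as E. rewrite H0, Cmult_0_r in E.
  apply (Cmult_neq_0 (fwd a n delta n) (a ^ (n - 1))%C fwd_n_neq_0); [|exact E].
  now apply Cpow_nz.
Qed.

Lemma sum_inv_offs : rsum (fun i => / offs n i) (n - 1) = harmonic (n - 1) / (2 * INR n).
Proof.
  pose proof (nat_large a n Hn). pose proof (large_n a n Hn).
  unfold offs. rewrite (sum_inv_offset n (n - 1) 0) by lia.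
  unfold harmonic at 3. simpl rsum. field. lra.
Qed.

Lemma harmonic_n_le : 0 <= harmonic (n - 1) / INR n <= 1.
Proof.
  pose proof (nat_large a n Hn).
  destruct (harmonic_le (n - 1)) as [H1 H2]. rewrite minus_INR in H2 by lia. simpl in H2.
  split.
  - apply Rmult_le_pos; [lra|]. left. apply Rinv_0_lt_compat. lra.
  - apply Rmult_le_reg_r with (INR n); [lra|].
    unfold Rdiv. rewrite Rmult_assoc, Rinv_l by lra. lra.
Qed.

Lemma product_bound :
  Cmod (cprod (fun i => 1 + delta / RtoC (offs n i))%C (n - 1)
        - (1 + delta * RtoC (harmonic (n - 1) / (2 * INR n)))) <= Cmod (delta * delta).
Proof.
  pose proof (large_n a n Hn). pose proof harmonic_n_le as Hh.
  set (s := rsum (fun i => Cmod (delta / RtoC (offs n i))%C) (n - 1)).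
  assert (Hs : s <= Cmod delta / 2).
  { unfold s. apply Rle_trans with (rsum (fun i => Cmod delta * / offs n i) (n - 1)).
    - apply rsum_le. intros i Hi. pose proof (offs_bound i ltac:(lia)).
      rewrite Cmod_div by (apply RtoC_neq_0; lra).
      rewrite Cmod_R, Rabs_pos_eq by lra. unfold Rdiv. lra.
    - rewrite rsum_scal, sum_inv_offs. apply Rmult_le_compat_l; [apply Cmod_ge_0|].
      replace (harmonic (n - 1) / (2 * INR n)) with (harmonic (n - 1) / INR n / 2) by (field; lra).
      lra. }
  assert (Hs0 : 0 <= s) by (apply rsum_nonneg; intros; apply Cmod_ge_0).
  assert (Es : csum (fun i => delta / RtoC (offs n i))%C (n - 1)
    = (delta * RtoC (harmonic (n - 1) / (2 * INR n)))%C).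
  { rewrite <- sum_inv_offs, <- csum_scal_real.
    assert (X : forall m, (m <= n - 1)%nat -> csum (fun i => delta / RtoC (offs n i))%C m
       = csum (fun i => delta * RtoC (/ offs n i))%C m).
    { induction m as [|m IH]; intros Hm; simpl; [reflexivity|]. rewrite IH by lia. f_equal.
      pose proof (offs_bound m ltac:(lia)). rewrite RtoC_inv by lra. reflexivity. }
    now apply X. }
  rewrite <- Es.
  eapply Rle_trans; [apply (cprod_expansion (fun i => delta / RtoC (offs n i))%C (n - 1));
    change (s <= / 2); lra|].
  change (2 * s ^ 2 <= Cmod (delta * delta)). rewrite Cmod_mult.
  assert (s * s <= Cmod delta / 2 * (Cmod delta / 2)) by (apply Rmult_le_compat; lra).
  assert (0 <= Cmod delta * Cmod delta) by (apply Rmult_le_pos; lra). lra.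
Qed.

(** Divided by [16], the sum of [coupling i / a ^ 2] at [delta = 0]. *)
Definition pair_sum : R :=
  rsum (fun i => / (INR (S i) * (INR n - INR (S i)) * (INR (S i) + 1) * (INR n - INR (S i) - 1))) (n - 2).

Lemma pair_sum_eq :
  pair_sum = (2 - 2 * / (INR n - 1)
     + (4 * harmonic (n - 1) - 2 * / (INR n - 1) - 2) / INR n) / (INR n ^ 2 - 1).
Proof.
  pose proof (nat_large a n Hn). pose proof (large_n a n Hn).
  unfold pair_sum. rewrite (sum_inv_offset_pairs n (n - 2) 0) by lia.
  replace (S (n - 2)) with (n - 1)%nat by lia.
  replace (harmonic (n - 1)) with (harmonic (n - 2) + / (INR n - 1)).
  - rewrite minus_INR by lia. replace (harmonic 1) with 1 by (unfold harmonic; simpl; field).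
    replace (harmonic 0) with 0 by reflexivity. simpl. field. repeat split; nra.
  - replace (n - 1)%nat with (S (n - 2)) by lia. rewrite harmonic_S. f_equal. f_equal.
    rewrite minus_INR by lia. simpl. ring.
Qed.

Lemma pair_sum_bounds : 0 <= pair_sum <= 8 * (/ INR n) ^ 2.
Proof.
  pose proof (large_n a n Hn). pose proof harmonic_n_le as Hh.
  split.
  - unfold pair_sum. apply rsum_nonneg. intros i Hi. left. apply Rinv_0_lt_compat.
    assert (Hin : INR (S i) <= INR (n - 2)) by (apply le_INR; lia).
    rewrite minus_INR in Hin by lia. change (INR 2) with (1 + 1) in Hin.
    assert (0 < INR (S i)) by (apply lt_0_INR; lia).
    repeat apply Rmult_lt_0_compat; lra.
  - rewrite pair_sum_eq.
    assert (V : 0 < / (INR n - 1)) by (apply Rinv_0_lt_compat; lra).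
    apply Rmult_le_reg_r with (INR n ^ 2 - 1); [nra|].
    unfold Rdiv at 1. rewrite Rmult_assoc, Rinv_l, Rmult_1_r by nra.
    replace ((4 * harmonic (n - 1) - 2 * / (INR n - 1) - 2) / INR n)
      with (4 * (harmonic (n - 1) / INR n) - 2 * (/ (INR n - 1) * / INR n) - 2 * / INR n)
      by (field; lra).
    assert (U : 0 < / INR n <= / 100).
    { split; [apply Rinv_0_lt_compat; lra|apply Rinv_le_contravar; lra]. }
    replace (8 * (/ INR n) ^ 2 * (INR n ^ 2 - 1)) with (8 - 8 * (/ INR n) ^ 2) by (field; lra).
    assert (0 < / (INR n - 1) * / INR n) by (apply Rmult_lt_0_compat; lra).
    nra.
Qed.

Lemma coupling_bound (i : nat) : (i < n - 2)%nat ->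
  Cmod (coupling i) <= 2 * Cmod a ^ 2 * / (offs n i * offs n (S i)) /\
  Cmod (coupling i - a ^ 2 * RtoC (/ (offs n i * offs n (S i))))
    <= 4 * Cmod a ^ 2 * Cmod delta * / INR n * / (offs n i * offs n (S i)).
Proof.
  intros Hi. pose proof (large_n a n Hn) as Hl.
  pose proof (offs_bound i ltac:(lia)) as B1. pose proof (offs_bound (S i) ltac:(lia)) as B2.
  assert (N1 : D i <> RtoC 0) by (apply D_neq_0; lia).
  assert (N2 : D (S i) <> RtoC 0) by (apply D_neq_0; lia).
  assert (M1 : offs n i - 1 <= Cmod (D i)).
  { rewrite D_formula. pose proof (Cmod_minus_ge (RtoC (offs n i)) delta) as G.
    rewrite Cmod_R, Rabs_pos_eq in G by lra. lra. }
  assert (M2 : offs n (S i) - 1 <= Cmod (D (S i))).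
  { rewrite D_formula. pose proof (Cmod_minus_ge (RtoC (offs n (S i))) delta) as G.
    rewrite Cmod_R, Rabs_pos_eq in G by lra. lra. }
  set (o1 := offs n i) in *. set (o2 := offs n (S i)) in *.
  pose proof (Cmod_ge_0 a) as PA. pose proof (Cmod_ge_0 delta) as PD.
  assert (Po : 0 < o1 * o2) by (apply Rmult_lt_0_compat; lra).
  assert (MM : o1 * o2 / 2 <= Cmod (D i) * Cmod (D (S i))).
  { apply Rle_trans with ((o1 - 1) * (o2 - 1)); [nra|]. apply Rmult_le_compat; lra. }
  assert (PM : 0 < Cmod (D i) * Cmod (D (S i))) by lra.
  assert (A2 : 0 <= Cmod a ^ 2) by (apply pow_le; lra).
  assert (IM : / (Cmod (D i) * Cmod (D (S i))) <= 2 * / (o1 * o2)).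
  { replace (2 * / (o1 * o2)) with (/ (o1 * o2 / 2)) by (field; lra).
    apply Rinv_le_contravar; lra. }
  assert (B : Cmod (coupling i) <= 2 * Cmod a ^ 2 * / (o1 * o2)).
  { unfold coupling. rewrite Cmod_div by (now apply Cmult_neq_0).
    rewrite Cmod_pow, Cmod_mult. unfold Rdiv.
    replace (2 * Cmod a ^ 2 * / (o1 * o2)) with (Cmod a ^ 2 * (2 * / (o1 * o2))) by ring.
    apply Rmult_le_compat_l; lra. }
  split; [exact B|].
  assert (O1 : RtoC o1 <> RtoC 0) by (apply RtoC_neq_0; lra).
  assert (O2 : RtoC o2 <> RtoC 0) by (apply RtoC_neq_0; lra).
  replace (coupling i - a ^ 2 * RtoC (/ (o1 * o2)))%C
    with (- (coupling i * (delta * RtoC ((o1 + o2) / (o1 * o2)) + delta * delta * RtoC (/ (o1 * o2)))))%C.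
  2:{ unfold coupling. rewrite RtoC_div, RtoC_inv, RtoC_plus, RtoC_mult by lra.
      assert (F1 : D i = (RtoC o1 + delta)%C) by apply D_formula.
      assert (F2 : D (S i) = (RtoC o2 + delta)%C) by apply D_formula.
      rewrite F1, F2 in *. field. repeat split; assumption. }
  rewrite Cmod_opp, Cmod_mult.
  assert (S1 : (o1 + o2) / (o1 * o2) <= / INR n).
  { replace ((o1 + o2) / (o1 * o2)) with (/ o1 + / o2) by (field; lra).
    assert (I1 : / o1 <= / (3 * INR n)) by (apply Rinv_le_contravar; lra).
    assert (I2 : / o2 <= / (3 * INR n)) by (apply Rinv_le_contravar; lra).
    rewrite Rinv_mult in I1, I2. pose proof (Rinv_0_lt_compat (INR n) ltac:(lra)). lra. }
  assert (S2 : / (o1 * o2) <= / INR n).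
  { apply Rinv_le_contravar; [lra|]. nra. }
  assert (S0 : 0 < / (o1 * o2)) by (now apply Rinv_0_lt_compat).
  assert (S3 : 0 <= (o1 + o2) / (o1 * o2)).
  { apply Rmult_le_pos; [lra|]. left. exact S0. }
  assert (Bz : Cmod (delta * RtoC ((o1 + o2) / (o1 * o2)) + delta * delta * RtoC (/ (o1 * o2)))
               <= 2 * Cmod delta * / INR n).
  { triangle.
    rewrite !Cmod_mult, !Cmod_R, !Rabs_pos_eq by lra.
    assert (Cmod delta * ((o1 + o2) / (o1 * o2)) <= Cmod delta * / INR n)
      by (apply Rmult_le_compat_l; lra).
    assert (Cmod delta * Cmod delta * / (o1 * o2) <= Cmod delta * / INR n).
    { apply Rmult_le_compat; [nra|lra|nra|lra]. }
    lra. }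
  replace (4 * Cmod a ^ 2 * Cmod delta * / INR n * / (o1 * o2))
    with (2 * Cmod a ^ 2 * / (o1 * o2) * (2 * Cmod delta * / INR n)) by ring.
  apply Rmult_le_compat; auto using Cmod_ge_0.
Qed.

Lemma pair_offs (i : nat) : (i < n - 2)%nat ->
  / (offs n i * offs n (S i))
  = / 16 * / (INR (S i) * (INR n - INR (S i)) * (INR (S i) + 1) * (INR n - INR (S i) - 1)).
Proof.
  intros Hi. unfold offs. rewrite (S_INR (S i)).
  assert (Hin : INR (S i) <= INR (n - 2)) by (apply le_INR; lia).
  rewrite minus_INR in Hin by lia. change (INR 2) with (1 + 1) in Hin.
  assert (0 < INR (S i)) by (apply lt_0_INR; lia).
  field. repeat split; lra.
Qed.

Lemma kappa_bound :
  Cmod (kappa (n - 1) - (1 - a ^ 2 / 16 * RtoC pair_sum))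
  <= 10 * Cmod a ^ 4 * (/ INR n) ^ 4 + 2 * Cmod a ^ 2 * Cmod delta * (/ INR n) ^ 3.
Proof.
  pose proof (nat_large a n Hn) as Hnat. pose proof (large_n a n Hn) as Hl.
  pose proof pair_sum_bounds as Hp. pose proof (large_A2 a n Hn) as HA2.
  pose proof (Cmod_ge_0 a) as PA. pose proof (Cmod_ge_0 delta) as PD.
  assert (U : 0 < / INR n <= / 100).
  { split; [apply Rinv_0_lt_compat; lra|apply Rinv_le_contravar; lra]. }
  set (s := rsum (fun i => Cmod (coupling i)) (n - 2)).
  assert (Hs0 : 0 <= s) by (apply rsum_nonneg; intros; apply Cmod_ge_0).
  assert (Hs : s <= Cmod a ^ 2 * (/ INR n) ^ 2).
  { unfold s. apply Rle_trans with (rsum (fun i => 2 * Cmod a ^ 2 * / 16 *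
       / (INR (S i) * (INR n - INR (S i)) * (INR (S i) + 1) * (INR n - INR (S i) - 1))) (n - 2)).
    - apply rsum_le. intros i Hi. destruct (coupling_bound i Hi) as [B _].
      rewrite pair_offs in B by exact Hi. lra.
    - rewrite rsum_scal. fold pair_sum.
      assert (0 <= Cmod a ^ 2) by (apply pow_le; lra). nra. }
  assert (Hs2 : s <= / 2).
  { eapply Rle_trans; [exact Hs|].
    replace (Cmod a ^ 2 * (/ INR n) ^ 2) with (Cmod a * Cmod a * / INR n * / INR n) by ring.
    assert (Cmod a * Cmod a * / INR n <= / 100).
    { apply Rmult_le_reg_r with (INR n); [lra|]. rewrite Rmult_assoc, Rinv_l by lra. lra. }
    assert (0 <= Cmod a * Cmod a * / INR n) by (apply Rmult_le_pos; [nra|lra]). nra. }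
  pose proof (continuant_expansion kappa coupling (n - 2) kappa_0 kappa_1 kappa_rec Hs2) as E1.
  fold s in E1. replace (S (n - 2)) with (n - 1)%nat in E1 by lia.
  assert (E2 : Cmod (csum coupling (n - 2) - a ^ 2 / 16 * RtoC pair_sum)
     <= 2 * Cmod a ^ 2 * Cmod delta * (/ INR n) ^ 3).
  { unfold pair_sum. rewrite <- csum_scal_real.
    eapply Rle_trans; [apply (csum_diff _ _ (fun i => 4 * Cmod a ^ 2 * Cmod delta * / INR n * / 16 *
       / (INR (S i) * (INR n - INR (S i)) * (INR (S i) + 1) * (INR n - INR (S i) - 1))))|].
    - intros i Hi. destruct (coupling_bound i Hi) as [_ B].
      rewrite pair_offs in B by exact Hi.
      eapply Rle_trans; [|eapply Rle_trans; [exact B|right; ring]]. right. f_equal. f_equal.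
      rewrite (RtoC_mult (/ 16)), (RtoC_inv 16) by lra.
      match goal with |- context [RtoC (/ ?X)] => generalize (RtoC (/ X)) end.
      intros z. field.
    - rewrite rsum_scal. fold pair_sum.
      assert (0 <= Cmod a ^ 2 * Cmod delta * / INR n).
      { apply Rmult_le_pos; [apply Rmult_le_pos; [apply pow_le|]|]; lra. } nra. }
  replace (kappa (n - 1) - (1 - a ^ 2 / 16 * RtoC pair_sum))%C
    with ((kappa (n - 1) - (1 - csum coupling (n - 2)))
          + - (csum coupling (n - 2) - a ^ 2 / 16 * RtoC pair_sum))%C by ring.
  triangle. rewrite Cmod_opp.
  apply Rplus_le_compat; [|exact E2]. eapply Rle_trans; [exact E1|].
  assert (s ^ 2 <= (Cmod a ^ 2 * (/ INR n) ^ 2) ^ 2) by (apply pow_incr; lra).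
  replace (10 * Cmod a ^ 4 * (/ INR n) ^ 4) with (10 * (Cmod a ^ 2 * (/ INR n) ^ 2) ^ 2) by ring.
  pose proof (pow2_ge_0 (Cmod a ^ 2 * (/ INR n) ^ 2)). lra.
Qed.

End Forward.

(** * Expansion of the determinants *)

Section ForwardExpansions.
Variables (a : C) (d : nat -> C).
Hypothesis Ha : a <> RtoC 0.
Hypothesis Hd : forall n, large a n -> Cmod (d n) <= 1.
Hypothesis Hs : bigO 4 (fun n => d n - a ^ 2 / 2 * recip n ^ 2)%C.

Definition hratio (n : nat) : C := RtoC (harmonic (n - 1) / INR n).

Lemma hratio_bigO : bigO 0 hratio.
Proof.
  apply (bigO_bound a 0 1). intros n Hn. unfold hratio. rewrite Cmod_R.
  pose proof (harmonic_n_le a n Hn). rewrite Rabs_pos_eq by lra. simpl. lra.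
Qed.

Lemma shift_order_2 : bigO 2 d.
Proof.
  apply (bigO_ext a _ (fun n => (d n - a ^ 2 / 2 * recip n ^ 2) + a ^ 2 / 2 * recip n ^ 2)%C).
  - intros n _. ring.
  - apply bigO_plus; [apply (bigO_weaken 2 4 _ ltac:(lia) Hs)|apply bigO_scal, bigO_recip].
Qed.

Lemma product_expansion :
  bigO 4 (fun n => cprod (fun i => 1 + d n / RtoC (offs n i))%C (n - 1)
                   - (1 + a ^ 2 / 4 * (hratio n * recip n ^ 2)))%C.
Proof.
  apply (bigO_ext a _ (fun n =>
     (cprod (fun i => 1 + d n / RtoC (offs n i))%C (n - 1)
        - (1 + d n * RtoC (harmonic (n - 1) / (2 * INR n))))
     + / 2 * ((d n - a ^ 2 / 2 * recip n ^ 2) * hratio n))%C).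
  - intros n Hn. unfold hratio. pose proof (large_n a n Hn).
    replace (harmonic (n - 1) / (2 * INR n)) with (/ 2 * (harmonic (n - 1) / INR n)) by (field; lra).
    rewrite RtoC_mult, RtoC_inv by lra. field.
  - apply bigO_plus.
    + apply (bigO_le a 4 _ (fun n => d n * d n)%C).
      * intros n Hn. apply (product_bound a); auto.
      * apply (bigO_mult 2 2); exact shift_order_2.
    + apply bigO_scal. apply (bigO_mult 4 0); [exact Hs|exact hratio_bigO].
Qed.

Lemma pair_sum_expansion :
  bigO 4 (fun n => RtoC (pair_sum n / 16)
     - (/ 8 * recip n ^ 2 + / 4 * (hratio n * recip n ^ 2) - / 4 * recip n ^ 3))%C.
Proof.
  set (v := fun n => RtoC (/ (INR n - 1))). set (w := fun n => RtoC (/ (INR n ^ 2 - 1))).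
  assert (Hv : bigO 1 v).
  { apply (bigO_bound a 1 2). intros n Hn. pose proof (large_n a n Hn). unfold v.
    rewrite Cmod_R, Rabs_pos_eq by (left; apply Rinv_0_lt_compat; lra).
    rewrite pow_1. replace (2 * / INR n) with (/ (INR n / 2)) by (field; lra).
    apply Rinv_le_contravar; lra. }
  assert (Hw : bigO 2 w).
  { apply (bigO_bound a 2 2). intros n Hn. pose proof (large_n a n Hn). unfold w.
    rewrite Cmod_R, Rabs_pos_eq by (left; apply Rinv_0_lt_compat; nra).
    replace (2 * (/ INR n) ^ 2) with (/ (INR n ^ 2 / 2)) by (field; lra).
    apply Rinv_le_contravar; nra. }
  apply (bigO_ext a _ (fun n => / 8 * ((1 + (2 * hratio n - 2 * recip n ^ 1)) * (recip n ^ 2 * w n))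
                                 + - / 4 * (recip n ^ 1 * v n * w n))%C).
  - intros n Hn. pose proof (large_n a n Hn) as Hl. unfold v, w, hratio, recip.
    rewrite (pair_sum_eq a n Hn).
    rewrite <- !RtoC_pow.
    replace (/ 8)%C with (RtoC (/ 8)) by (rewrite RtoC_inv by lra; reflexivity).
    replace (/ 4)%C with (RtoC (/ 4)) by (rewrite RtoC_inv by lra; reflexivity).
    repeat rewrite <- RtoC_mult. repeat rewrite <- RtoC_minus.
    repeat rewrite <- RtoC_opp. repeat rewrite <- RtoC_mult. repeat rewrite <- RtoC_plus.
    repeat rewrite <- RtoC_mult. repeat rewrite <- RtoC_plus. repeat rewrite <- RtoC_minus.
    f_equal. field. repeat split; nra.
  - apply bigO_plus; apply bigO_scal.
    + apply (bigO_mult 0 4).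
      * apply bigO_plus; [apply bigO_const|]. apply bigO_minus; apply bigO_scal;
          [exact hratio_bigO|apply bigO_recip_le; lia].
      * apply (bigO_mult 2 2); [apply bigO_recip|exact Hw].
    + apply (bigO_mult 2 2); [|exact Hw]. apply (bigO_mult 1 1); [apply bigO_recip|exact Hv].
Qed.

Lemma kappa_expansion :
  bigO 4 (fun n => kappa a n (d n) (n - 1)
     - (1 - a ^ 2 * (/ 8 * recip n ^ 2 + / 4 * (hratio n * recip n ^ 2) - / 4 * recip n ^ 3)))%C.
Proof.
  apply (bigO_ext a _ (fun n => (kappa a n (d n) (n - 1) - (1 - a ^ 2 / 16 * RtoC (pair_sum n)))
    + - a ^ 2 * (RtoC (pair_sum n / 16)
     - (/ 8 * recip n ^ 2 + / 4 * (hratio n * recip n ^ 2) - / 4 * recip n ^ 3)))%C).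
  - intros n Hn. rewrite RtoC_div by lra. field.
  - apply bigO_plus; [|apply bigO_scal, pair_sum_expansion].
    apply (bigO_le a 4 _ (fun n => RtoC (10 * Cmod a ^ 4) * recip n ^ 4
                                    + RtoC (2 * Cmod a ^ 2) * (RtoC (Cmod (d n)) * recip n ^ 3))%C).
    + intros n Hn. eapply Rle_trans; [apply kappa_bound; auto|].
      unfold recip. rewrite <- !RtoC_pow, <- !RtoC_mult, <- RtoC_plus, Cmod_R.
      eapply Rle_trans; [|apply Rle_abs]. right. ring.
    + apply bigO_plus; apply bigO_scal; [apply bigO_recip|].
      apply (bigO_weaken 4 5); [lia|]. apply (bigO_mult 2 3); [|apply bigO_recip].
      apply (bigO_le a 2 _ d); [|exact shift_order_2].
      intros n _. rewrite Cmod_R, Rabs_pos_eq by apply Cmod_ge_0. lra.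
Qed.

(** Through the shift [a ^ 2 / (2 n ^ 2)] the product of the diagonal entries
    acquires a term [a ^ 2 H / (4 n ^ 3)], with [H] the harmonic number of
    [n - 1]; the continuant contains its opposite. *)
Theorem rel_det_expansion :
  bigO 4 (fun n => rel_det a n (d n) - (1 - a ^ 2 / 8 * recip n ^ 2 + a ^ 2 / 4 * recip n ^ 3))%C.
Proof.
  pose proof product_expansion as HP. pose proof kappa_expansion as HK.
  set (A1 := fun n => (a ^ 2 / 4 * (hratio n * recip n ^ 2))%C) in *.
  set (B := fun n => (a ^ 2 * (/ 8 * recip n ^ 2 + / 4 * (hratio n * recip n ^ 2) - / 4 * recip n ^ 3))%C).
  set (P := fun n => cprod (fun i => 1 + d n / RtoC (offs n i))%C (n - 1)) in *.
  set (k := fun n => kappa a n (d n) (n - 1)) in *.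
  set (e1 := fun n => (P n - (1 + A1 n))%C). set (e2 := fun n => (k n - (1 - B n))%C).
  assert (H1 : bigO 4 e1) by exact HP. assert (H2 : bigO 4 e2) by exact HK.
  assert (Hh2 : bigO 2 (fun n => hratio n * recip n ^ 2)%C).
  { apply (bigO_mult 0 2); [exact hratio_bigO|apply bigO_recip]. }
  assert (HA : bigO 2 A1) by (apply bigO_scal; exact Hh2).
  assert (HB : bigO 2 B).
  { apply bigO_scal, bigO_minus; [apply bigO_plus|]; apply bigO_scal;
      [apply bigO_recip|exact Hh2|apply bigO_recip_le; lia]. }
  assert (HBe : bigO 2 (fun n => e2 n - B n)%C).
  { apply bigO_minus; [apply (bigO_weaken 2 4 _ ltac:(lia) H2)|exact HB]. }
  apply (bigO_ext a _ (fun n => (e1 n + e2 n) + (A1 n * (e2 n - B n) + e1 n * (e2 n - B n)))%C).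
  - intros n _. unfold rel_det. fold (P n) (k n). unfold e1, e2, A1, B. field.
  - apply bigO_plus; [now apply bigO_plus|]. apply bigO_plus.
    + now apply (bigO_mult 2 2).
    + apply (bigO_weaken 4 6); [lia|]. now apply (bigO_mult 4 2).
Qed.

Lemma fwd_ratio_expansion :
  bigO 3 (fun n => fwd a n (d n) (n - 1) / fwd a n (d n) n
                   - a * (/ 4 * recip n + / 4 * recip n ^ 2))%C.
Proof.
  assert (Hd1 : bigO 1 d) by exact (bigO_weaken 1 2 _ ltac:(lia) shift_order_2).
  apply (bigO_ext a _ (fun n =>
      a * (inv_denom d n 1 - (/ (4 * RtoC 1) * recip n + / 4 * recip n ^ 2))
      + a * (fwd a n (d n) (n - 2) / fwd a n (d n) n * inv_denom d n 1))%C).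
  - intros n Hn. rewrite (fwd_ratio_eq a n (d n) Hn Ha (Hd n Hn)). unfold inv_denom, Cdiv.
    generalize (/ denom n (d n) 1)%C, (/ fwd a n (d n) n)%C. intros. field.
  - apply bigO_plus; apply bigO_scal.
    + apply (inv_denom_second a d Hd 1 Hd1); lia.
    + apply (bigO_mult 2 1); [|apply (inv_denom_bigO a d Hd); lia].
      apply (bigO_bound a 2 (Cmod a ^ 2)). intros n Hn.
      rewrite <- Rpow_mult_distr. apply Cmod_div_le; [now apply fwd_n_neq_0; auto|].
      exact (fwd_before_last a n (d n) Hn Ha (Hd n Hn)).
Qed.

End ForwardExpansions.

(** * Calculus on [[0, PI]] *)

Lemma norm_C_R (z : C) : @norm R_AbsRing C_R_NormedModule z = Cmod z.
Proof.
  destruct z as [u v].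
  change (sqrt (Rabs u ^ 2 + Rabs v ^ 2) = sqrt (u ^ 2 + v ^ 2)).
  now rewrite !pow2_abs.
Qed.

Lemma within_lim_unique (x x0 : R) :
  on_0pi x -> is_filter_lim (within on_0pi (locally x)) x0 -> x0 = x.
Proof.
  intros Hx Hl. destruct (Req_dec x0 x) as [|Hne]; [assumption|exfalso].
  assert (Hp : 0 < Rabs (x - x0)) by (apply Rabs_pos_lt; lra).
  destruct (Hl (fun t => Rabs (t - x0) < Rabs (x - x0))) as [d Hd].
  { exists (mkposreal _ Hp). intros t Ht. exact Ht. }
  specialize (Hd x (ball_center x d) Hx). simpl in Hd. lra.
Qed.

Lemma has_deriv_intro (y dy : R -> C) :
  (forall x, on_0pi x -> forall eps, 0 < eps -> exists d, 0 < d /\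
     forall t, on_0pi t -> Rabs (t - x) < d ->
       Cmod (y t - y x - RtoC (t - x) * dy x) <= eps * Rabs (t - x)) ->
  has_deriv y dy.
Proof.
  intros H x Hx. split.
  - apply (is_linear_scal_l (K := R_AbsRing) (V := C_R_NormedModule)).
  - intros x0 H0. apply (within_lim_unique x x0 Hx) in H0. subst x0.
    intros eps. destruct (H x Hx eps (cond_pos eps)) as [d [Hd Hd']].
    exists (mkposreal d Hd). intros t Ht Htd.
    rewrite norm_C_R. specialize (Hd' t Htd Ht).
    eapply Rle_trans; [|exact Hd']. apply Req_le. f_equal.
    change (minus t x) with (t - x).
    rewrite scal_R_Cmult. reflexivity.
Qed.

Lemma has_deriv_elim (y dy : R -> C) :
  has_deriv y dy ->
  forall x, on_0pi x -> forall eps, 0 < eps -> exists d, 0 < d /\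
     forall t, on_0pi t -> Rabs (t - x) < d ->
       Cmod (y t - y x - RtoC (t - x) * dy x) <= eps * Rabs (t - x).
Proof.
  intros H x Hx eps He. destruct (H x Hx) as [_ H1].
  destruct (H1 x (fun P HP => filter_le_within (F := locally x) on_0pi P HP)
              (mkposreal eps He)) as [d Hd].
  exists d. split; [apply cond_pos|]. intros t Ht Htd.
  specialize (Hd t Htd Ht). rewrite norm_C_R in Hd.
  eapply Rle_trans; [|exact Hd]. apply Req_le. f_equal.
  change (minus t x) with (t - x). rewrite scal_R_Cmult. reflexivity.
Qed.

Definition cont (f : R -> C) : Prop :=
  continuous_on (T := R_UniformSpace) (U := C_UniformSpace) on_0pi f.

Lemma cont_intro (f : R -> C) :
  (forall x, on_0pi x -> forall eps, 0 < eps -> exists d, 0 < d /\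
     forall t, on_0pi t -> Rabs (t - x) < d -> Cmod (f t - f x) < eps) -> cont f.
Proof.
  intros H x Hx P [e He]. destruct (H x Hx e (cond_pos e)) as [d [Hd Hd']].
  exists (mkposreal d Hd). intros t Ht Htd. apply He.
  specialize (Hd' t Htd Ht).
  split; eapply Rle_lt_trans; try exact Hd'.
  - apply (re_le_Cmod (f t - f x)).
  - apply (Cmod_Im_le (f t - f x)).
Qed.

Lemma cont_elim (f : R -> C) :
  cont f ->
  forall x, on_0pi x -> forall eps, 0 < eps -> exists d, 0 < d /\
     forall t, on_0pi t -> Rabs (t - x) < d -> Cmod (f t - f x) < eps.
Proof.
  intros H x Hx eps He.
  assert (He2 : 0 < eps / 2) by lra.
  destruct (H x Hx (ball (f x) (mkposreal _ He2))) as [d Hd].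
  { exists (mkposreal _ He2). auto. }
  exists d. split; [apply cond_pos|]. intros t Ht Htd.
  destruct (Hd t Htd Ht) as [H1 H2].
  eapply Rle_lt_trans; [apply Cmod_le_Re_Im|].
  change (Rabs (Re (f t) - Re (f x)) < eps / 2) in H1.
  change (Rabs (Im (f t) - Im (f x)) < eps / 2) in H2.
  change (Re (f t - f x)) with (Re (f t) - Re (f x)).
  change (Im (f t - f x)) with (Im (f t) - Im (f x)). lra.
Qed.

Definition tends (f : R -> C) (x : R) (l : C) : Prop :=
  forall eps, 0 < eps -> exists d, 0 < d /\
    forall t, on_0pi t -> Rabs (t - x) < d -> Cmod (f t - l) < eps.

Lemma tends_plus (f g : R -> C) (x : R) (l m : C) :
  tends f x l -> tends g x m -> tends (fun t => f t + g t)%C x (l + m)%C.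
Proof.
  intros Hf Hg eps He.
  destruct (Hf (eps / 2) ltac:(lra)) as [d1 [Hd1 H1]].
  destruct (Hg (eps / 2) ltac:(lra)) as [d2 [Hd2 H2]].
  exists (Rmin d1 d2). split; [now apply Rmin_pos|]. intros t Ht Htd.
  specialize (H1 t Ht (Rlt_le_trans _ _ _ Htd (Rmin_l _ _))).
  specialize (H2 t Ht (Rlt_le_trans _ _ _ Htd (Rmin_r _ _))).
  replace (f t + g t - (l + m))%C with ((f t - l) + (g t - m))%C by ring.
  eapply Rle_lt_trans; [apply Cmod_triangle|]. lra.
Qed.

Lemma tends_mult (f g : R -> C) (x : R) (l m : C) :
  tends f x l -> tends g x m -> tends (fun t => f t * g t)%C x (l * m)%C.
Proof.
  intros Hf Hg eps He.
  pose proof (Cmod_ge_0 l) as Pl. pose proof (Cmod_ge_0 m) as Pm.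
  set (M := 1 + Cmod l + Cmod m). assert (HM : 1 <= M) by (unfold M; lra).
  assert (He' : 0 < Rmin 1 (eps / (2 * M))).
  { apply Rmin_pos; [lra|]. apply Rdiv_lt_0_compat; lra. }
  destruct (Hf _ He') as [d1 [Hd1 H1]]. destruct (Hg _ He') as [d2 [Hd2 H2]].
  exists (Rmin d1 d2). split; [now apply Rmin_pos|]. intros t Ht Htd.
  specialize (H1 t Ht (Rlt_le_trans _ _ _ Htd (Rmin_l _ _))).
  specialize (H2 t Ht (Rlt_le_trans _ _ _ Htd (Rmin_r _ _))).
  set (e := Rmin 1 (eps / (2 * M))) in *.
  assert (E1 : e <= 1) by apply Rmin_l. assert (E2 : e <= eps / (2 * M)) by apply Rmin_r.
  replace (f t * g t - l * m)%C
    with ((f t - l) * (g t - m) + (f t - l) * m + l * (g t - m))%C by ring.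
  eapply Rle_lt_trans; [apply Cmod_triangle|].
  eapply Rle_lt_trans; [apply Rplus_le_compat_r, Cmod_triangle|]. rewrite !Cmod_mult.
  pose proof (Cmod_ge_0 (f t - l)).
  apply Rle_lt_trans with (e * M); [unfold M; nra|].
  apply Rle_lt_trans with (eps / (2 * M) * M); [apply Rmult_le_compat_r; lra|].
  replace (eps / (2 * M) * M) with (eps / 2) by (field; lra). lra.
Qed.

Lemma tends_const (c : C) (x : R) : tends (fun _ => c) x c.
Proof.
  intros eps He. exists 1. split; [lra|]. intros.
  replace (c - c)%C with (RtoC 0) by ring. now rewrite Cmod_0.
Qed.

Lemma tends_ext (f g : R -> C) (x : R) (l m : C) :
  (forall t, f t = g t) -> l = m -> tends f x l -> tends g x m.
Proof.
  intros H <- Hf eps He. destruct (Hf eps He) as [d [Hd Hd']].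
  exists d. split; [exact Hd|]. intros t. rewrite <- H. apply Hd'.
Qed.

(** Caratheodory's form of the derivative, in which the rules of calculus are
    those of limits. *)
Definition slope_at (y : R -> C) (x : R) (l : C) : Prop :=
  exists q, tends q x l /\ forall t, y t = (y x + RtoC (t - x) * q t)%C.

Lemma has_deriv_slope (y dy : R -> C) (x : R) :
  has_deriv y dy -> on_0pi x -> slope_at y x (dy x).
Proof.
  intros H Hx.
  exists (fun t => if Req_dec_T t x then dy x else ((y t - y x) / RtoC (t - x))%C). split.
  - intros eps He. destruct (has_deriv_elim _ _ H x Hx (eps / 2) ltac:(lra)) as [d [Hd Hd']].
    exists d. split; [exact Hd|]. intros t Ht Htd. destruct Req_dec_T as [_|Hne].
    + replace (dy x - dy x)%C with (RtoC 0) by ring. now rewrite Cmod_0.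
    + assert (Hn : RtoC (t - x) <> RtoC 0) by (apply RtoC_neq_0; lra).
      apply Rle_lt_trans with (eps / 2); [|lra].
      replace ((y t - y x) / RtoC (t - x) - dy x)%C
        with ((y t - y x - RtoC (t - x) * dy x) / RtoC (t - x))%C by (field; exact Hn).
      apply Cmod_div_le; [exact Hn|]. rewrite Cmod_R. now apply Hd'.
  - intros t. destruct Req_dec_T as [->|Hne].
    + rewrite Rminus_diag. ring.
    + field. apply RtoC_neq_0. lra.
Qed.

Lemma slope_has_deriv (y dy : R -> C) :
  (forall x, on_0pi x -> slope_at y x (dy x)) -> has_deriv y dy.
Proof.
  intros H. apply has_deriv_intro. intros x Hx eps He.
  destruct (H x Hx) as [q [Hq Hy]]. destruct (Hq eps He) as [d [Hd Hd']].
  exists d. split; [exact Hd|]. intros t Ht Htd. rewrite (Hy t).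
  replace (y x + RtoC (t - x) * q t - y x - RtoC (t - x) * dy x)%C
    with ((q t - dy x) * RtoC (t - x))%C by ring.
  rewrite Cmod_mult, Cmod_R. apply Rmult_le_compat_r; [apply Rabs_pos|].
  now apply Rlt_le, Hd'.
Qed.

Lemma slope_tends (y : R -> C) (x : R) (l : C) : slope_at y x l -> tends y x (y x).
Proof.
  intros [q [Hq Hy]].
  assert (Hi : tends (fun t => RtoC (t - x)) x 0).
  { intros eps He. exists eps. split; [exact He|]. intros t _ Ht.
    replace (RtoC (t - x) - 0)%C with (RtoC (t - x)) by ring. now rewrite Cmod_R. }
  apply (tends_ext (fun t => y x + RtoC (t - x) * q t)%C _ _ (y x + 0 * l)%C).
  - intros t. now rewrite <- Hy.
  - ring.
  - apply tends_plus; [apply tends_const|now apply tends_mult].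
Qed.

Lemma has_deriv_cont (y dy : R -> C) : has_deriv y dy -> cont y.
Proof.
  intros H. apply cont_intro. intros x Hx.
  exact (slope_tends _ _ _ (has_deriv_slope y dy x H Hx)).
Qed.

Lemma has_deriv_mult (y dy z dz : R -> C) :
  has_deriv y dy -> has_deriv z dz ->
  has_deriv (fun x => y x * z x)%C (fun x => dy x * z x + y x * dz x)%C.
Proof.
  intros Hy Hz. apply slope_has_deriv. intros x Hx.
  pose proof (has_deriv_slope _ _ _ Hz Hx) as Sz.
  destruct (has_deriv_slope _ _ _ Hy Hx) as [p [Hp Ep]]. pose proof Sz as [q [Hq Eq]].
  exists (fun t => p t * z t + y x * q t)%C. split.
  - apply tends_plus; apply tends_mult; auto using tends_const.
    exact (slope_tends _ _ _ Sz).
  - intros t. rewrite (Ep t), (Eq t). ring.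
Qed.

Lemma has_deriv_lin (c : C) (y dy z dz : R -> C) :
  has_deriv y dy -> has_deriv z dz ->
  has_deriv (fun x => y x + c * z x)%C (fun x => dy x + c * dz x)%C.
Proof.
  intros Hy Hz. apply slope_has_deriv. intros x Hx.
  destruct (has_deriv_slope _ _ _ Hy Hx) as [p [Hp Ep]].
  destruct (has_deriv_slope _ _ _ Hz Hx) as [q [Hq Eq]].
  exists (fun t => p t + c * q t)%C. split.
  - apply tends_plus; [exact Hp|]. apply tends_mult; [apply tends_const|exact Hq].
  - intros t. rewrite (Ep t), (Eq t). ring.
Qed.

Lemma cont_ext (f g : R -> C) : (forall x, on_0pi x -> f x = g x) -> cont f -> cont g.
Proof. intros H. apply continuous_on_ext. exact H. Qed.

Lemma has_deriv_ext (y z dy dz : R -> C) :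
  (forall x, on_0pi x -> y x = z x) -> (forall x, on_0pi x -> dy x = dz x) ->
  has_deriv y dy -> has_deriv z dz.
Proof.
  intros H1 H2 H. apply has_deriv_intro. intros x Hx eps He.
  destruct (has_deriv_elim _ _ H x Hx eps He) as [d [Hd Hd']].
  exists d. split; [exact Hd|]. intros t Ht Htd.
  rewrite <- (H1 t Ht), <- (H1 x Hx), <- (H2 x Hx). now apply Hd'.
Qed.

Lemma cont_const (c : C) : cont (fun _ => c).
Proof. apply cont_intro. intros x _. apply tends_const. Qed.

Lemma cont_plus (f g : R -> C) : cont f -> cont g -> cont (fun x => f x + g x)%C.
Proof.
  intros Hf Hg. apply cont_intro. intros x Hx.
  exact (tends_plus f g x _ _ (cont_elim f Hf x Hx) (cont_elim g Hg x Hx)).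
Qed.

Lemma cont_mult (f g : R -> C) : cont f -> cont g -> cont (fun x => f x * g x)%C.
Proof.
  intros Hf Hg. apply cont_intro. intros x Hx.
  exact (tends_mult f g x _ _ (cont_elim f Hf x Hx) (cont_elim g Hg x Hx)).
Qed.

Lemma cont_scal (c : C) (f : R -> C) : cont f -> cont (fun x => c * f x)%C.
Proof. intros H. apply (cont_mult (fun _ => c)); [apply cont_const|exact H]. Qed.

(** * Integrals and the symmetry of the operator *)

Definition clamp (x : R) : R := Rmax 0 (Rmin x PI).

Lemma clamp_on (x : R) : on_0pi (clamp x).
Proof.
  pose proof PI_RGT_0. unfold on_0pi, clamp. split; [apply Rmax_l|].
  apply Rmax_lub; [lra|apply Rmin_r].
Qed.

Lemma clamp_id (x : R) : on_0pi x -> clamp x = x.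
Proof.
  unfold on_0pi, clamp. intros H. rewrite Rmin_left, Rmax_right; lra.
Qed.

Lemma clamp_lip (x t : R) : Rabs (clamp t - clamp x) <= Rabs (t - x).
Proof.
  unfold clamp, Rmax, Rmin.
  repeat destruct Rle_dec; unfold Rabs; repeat destruct Rcase_abs; lra.
Qed.

Lemma cont_clamp (f : R -> C) : cont f ->
  forall x, @continuous R_UniformSpace C_R_NormedModule (fun t => f (clamp t)) x.
Proof.
  intros Hf x P [e He].
  destruct (cont_elim f Hf (clamp x) (clamp_on x) e (cond_pos e)) as [d [Hd Hd']].
  exists (mkposreal d Hd). intros t Ht. apply He.
  specialize (Hd' (clamp t) (clamp_on t) (Rle_lt_trans _ _ _ (clamp_lip x t) Ht)).
  split; eapply Rle_lt_trans; try exact Hd'.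
  - apply (re_le_Cmod (f (clamp t) - f (clamp x))).
  - apply (Cmod_Im_le (f (clamp t) - f (clamp x))).
Qed.

Lemma in_0pi (x : R) : Rmin 0 PI <= x <= Rmax 0 PI -> on_0pi x.
Proof. pose proof PI_RGT_0. rewrite Rmin_left, Rmax_right by lra. auto. Qed.

Lemma in_0pi_strict (x : R) : Rmin 0 PI < x < Rmax 0 PI -> on_0pi x.
Proof. intros H. apply in_0pi. lra. Qed.

Lemma cont_ex_RInt (f : R -> C) :
  cont f -> @ex_RInt C_R_NormedModule f 0 PI.
Proof.
  intros Hf. apply (ex_RInt_ext (fun t => f (clamp t))).
  - intros x Hx. now rewrite clamp_id by now apply in_0pi_strict.
  - apply (ex_RInt_continuous (V := C_R_CompleteNormedModule)).
    intros z _. now apply cont_clamp.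
Qed.

Definition integral (f : R -> C) : C := @RInt C_R_CompleteNormedModule f 0 PI.

Lemma integral_correct (f : R -> C) :
  cont f -> @is_RInt C_R_NormedModule f 0 PI (integral f).
Proof.
  intros Hf. apply (RInt_correct (V := C_R_CompleteNormedModule)). now apply cont_ex_RInt.
Qed.

Lemma integral_unique (f : R -> C) (l : C) :
  @is_RInt C_R_NormedModule f 0 PI l -> integral f = l.
Proof. apply (is_RInt_unique (V := C_R_CompleteNormedModule)). Qed.

Lemma integral_ext (f g : R -> C) :
  (forall x, on_0pi x -> f x = g x) -> integral f = integral g.
Proof.
  intros H. apply (RInt_ext (V := C_R_CompleteNormedModule)).
  intros x Hx. now apply H, in_0pi_strict.
Qed.

Lemma integral_plus (f g : R -> C) : cont f -> cont g ->
  integral (fun x => f x + g x)%C = (integral f + integral g)%C.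
Proof.
  intros Hf Hg. apply integral_unique.
  apply (is_RInt_plus (V := C_R_NormedModule) f g); now apply integral_correct.
Qed.

Lemma integral_Re (f : R -> C) : cont f ->
  is_RInt (fun x => Re (f x)) 0 PI (Re (integral f)).
Proof.
  intros Hf. apply (is_RInt_fct_extend_fst (U := R_NormedModule) (V := R_NormedModule)).
  now apply integral_correct.
Qed.

Lemma integral_Im (f : R -> C) : cont f ->
  is_RInt (fun x => Im (f x)) 0 PI (Im (integral f)).
Proof.
  intros Hf. apply (is_RInt_fct_extend_snd (U := R_NormedModule) (V := R_NormedModule)).
  now apply integral_correct.
Qed.

Lemma integral_scal (c : C) (f : R -> C) : cont f ->
  integral (fun x => c * f x)%C = (c * integral f)%C.
Proof.
  intros Hf. apply integral_unique.
  pose proof (integral_Re f Hf) as H1. pose proof (integral_Im f Hf) as H2.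
  apply (is_RInt_fct_extend_pair (U := R_NormedModule) (V := R_NormedModule)).
  - apply (is_RInt_minus (V := R_NormedModule)
             (fun x => scal (fst c) (Re (f x))) (fun x => scal (snd c) (Im (f x))));
      now apply (is_RInt_scal (V := R_NormedModule)).
  - apply (is_RInt_plus (V := R_NormedModule)
             (fun x => scal (fst c) (Im (f x))) (fun x => scal (snd c) (Re (f x))));
      now apply (is_RInt_scal (V := R_NormedModule)).
Qed.

Lemma integral_bound (f : R -> C) (M : R) : cont f ->
  (forall x, on_0pi x -> Cmod (f x) <= M) -> Cmod (integral f) <= PI * M.
Proof.
  intros Hf HM. pose proof PI_RGT_0.
  rewrite <- norm_C_R. rewrite <- (Rminus_0_r PI) at 1.
  apply (norm_RInt_le_const (V := C_R_NormedModule) f 0 PI); [lra| |].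
  - intros x Hx. rewrite norm_C_R. now apply HM.
  - now apply integral_correct.
Qed.

(** Extending [y] affinely beyond the endpoints turns its one-sided
    derivatives there into two-sided ones. *)
Lemma has_deriv_extension (y dy : R -> C) : has_deriv y dy -> cont dy ->
  forall x, on_0pi x ->
  @is_derive R_AbsRing C_R_NormedModule
    (fun t => y (clamp t) + RtoC (t - clamp t) * dy (clamp t))%C x (dy x).
Proof.
  intros H Hc x Hx. split.
  { apply (is_linear_scal_l (K := R_AbsRing) (V := C_R_NormedModule)). }
  intros x0 H0.
  apply (is_filter_lim_locally_unique (K := R_AbsRing) (V := R_NormedModule)) in H0. subst x0.
  intros eps. assert (He : 0 < eps / 2) by (pose proof (cond_pos eps); lra).
  destruct (has_deriv_elim _ _ H x Hx _ He) as [d1 [Hd1 H1]].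
  destruct (cont_elim _ Hc x Hx _ He) as [d2 [Hd2 H2]].
  exists (mkposreal _ (Rmin_pos _ _ Hd1 Hd2)). intros t Ht.
  change (Rabs (t - x) < Rmin d1 d2) in Ht.
  assert (Hcx : Rabs (clamp t - x) <= Rabs (t - x)).
  { rewrite <- (clamp_id x Hx) at 1. apply clamp_lip. }
  assert (Htc : Rabs (t - clamp t) <= Rabs (t - x)).
  { clear - Hx. destruct Hx. unfold clamp, Rmax, Rmin.
    repeat destruct Rle_dec; unfold Rabs; repeat destruct Rcase_abs; lra. }
  specialize (H1 _ (clamp_on t) (Rle_lt_trans _ _ _ Hcx (Rlt_le_trans _ _ _ Ht (Rmin_l _ _)))).
  specialize (H2 _ (clamp_on t) (Rle_lt_trans _ _ _ Hcx (Rlt_le_trans _ _ _ Ht (Rmin_r _ _)))).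
  rewrite norm_C_R. change (minus t x) with (t - x).
  rewrite scal_R_Cmult. change (norm (t - x)) with (Rabs (t - x)).
  assert (Es : pos eps * Rabs (t - x) = pos eps / 2 * Rabs (t - x) + Rabs (t - x) * (pos eps / 2)) by field.
  eapply Rle_trans; [|apply Req_le; symmetry; exact Es].
  apply Rle_trans with
    (Cmod ((y (clamp t) - y x - RtoC (clamp t - x) * dy x)
           + RtoC (t - clamp t) * (dy (clamp t) - dy x))%C).
  - apply Req_le. f_equal.
    transitivity (y (clamp t) + RtoC (t - clamp t) * dy (clamp t)
      - (y (clamp x) + RtoC (x - clamp x) * dy (clamp x)) - RtoC (t - x) * dy x)%C;
      [reflexivity|].
    rewrite (clamp_id x Hx). rewrite !RtoC_minus.
    match goal with |- ?l = ?r => change (@eq C l r) end. ring.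
  - triangle. rewrite Cmod_mult, Cmod_R.
    apply Rplus_le_compat.
    + eapply Rle_trans; [exact H1|]. apply Rmult_le_compat_l; lra.
    + apply Rmult_le_compat; auto using Rabs_pos, Cmod_ge_0. lra.
Qed.

Lemma integral_deriv (y dy : R -> C) : has_deriv y dy -> cont dy ->
  integral dy = (y PI - y 0)%C.
Proof.
  intros H Hc. pose proof PI_RGT_0.
  rewrite (integral_ext dy (fun t => dy (clamp t)))
    by (intros x Hx; now rewrite clamp_id).
  apply integral_unique.
  set (Y := fun t => (y (clamp t) + RtoC (t - clamp t) * dy (clamp t))%C).
  assert (E : forall x, on_0pi x -> Y x = y x).
  { intros x Hx. unfold Y. rewrite (clamp_id x Hx), Rminus_diag. ring. }
  rewrite <- (E PI), <- (E 0) by (unfold on_0pi; lra).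
  apply (is_RInt_derive (V := C_R_CompleteNormedModule) Y (fun t => dy (clamp t)) 0 PI).
  - intros x Hx. apply in_0pi in Hx. rewrite (clamp_id x Hx).
    now apply has_deriv_extension.
  - intros x _. now apply cont_clamp.
Qed.

(** The boundary terms of the Lagrange identity cancel under either boundary
    condition. *)
Lemma mathieu_symmetric (a : C) (b : bc) (y f z g : R -> C) :
  mathieu a b y f -> mathieu a b z g -> cont f -> cont g ->
  integral (fun x => f x * z x)%C = integral (fun x => y x * g x)%C.
Proof.
  intros (dy & ddy & Hy & Hdy & _ & By & Ey) (dz & ddz & Hz & Hdz & _ & Bz & Ez) Hf Hg.
  pose proof (has_deriv_cont _ _ Hy) as Cy. pose proof (has_deriv_cont _ _ Hz) as Cz.
  pose proof (has_deriv_lin (-1) _ _ _ _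
                (has_deriv_mult _ _ _ _ Hy Hdz) (has_deriv_mult _ _ _ _ Hdy Hz)) as HW.
  assert (HW' : has_deriv (fun x => y x * dz x + -1 * (dy x * z x))%C
                          (fun x => f x * z x + -1 * (y x * g x))%C).
  { refine (has_deriv_ext _ _ _ _ (fun x _ => eq_refl) _ HW).
    intros x Hx. rewrite (Ey x Hx), (Ez x Hx). ring. }
  assert (C1 : cont (fun x => f x * z x)%C) by now apply cont_mult.
  assert (C2 : cont (fun x => y x * g x)%C) by now apply cont_mult.
  assert (C3 : cont (fun x => -1 * (y x * g x))%C) by now apply cont_scal.
  pose proof (integral_deriv _ _ HW' (cont_plus _ _ C1 C3)) as E.
  rewrite (integral_plus _ _ C1 C3), (integral_scal (-1) _ C2) in E.
  apply Ceq_minus.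
  transitivity (integral (fun x => f x * z x) + -1 * integral (fun x => y x * g x))%C; [ring|].
  rewrite E. destruct b; destruct By as [B1 B2]; destruct Bz as [B3 B4];
    rewrite B1, B2, B3, B4; ring.
Qed.

(** * Exponentials *)

(** The exponential [exp (i k x)]. *)
Definition wave (k : Z) (x : R) : C := (cos (IZR k * x), sin (IZR k * x)).

Lemma wave_add (k l : Z) (x : R) : wave (k + l) x = (wave k x * wave l x)%C.
Proof.
  unfold wave, Cmult. simpl. rewrite plus_IZR, Rmult_plus_distr_r, cos_plus, sin_plus.
  f_equal; ring.
Qed.

Lemma wave_translate (k : Z) (x h : R) : wave k (x + h) = (wave k x * wave k h)%C.
Proof.
  unfold wave, Cmult. simpl. rewrite Rmult_plus_distr_l, cos_plus, sin_plus.
  f_equal; ring.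
Qed.

Lemma Cmod_wave (k : Z) (x : R) : Cmod (wave k x) = 1.
Proof.
  unfold Cmod, wave. simpl. pose proof (sin2_cos2 (IZR k * x)) as H. unfold Rsqr in H.
  rewrite !Rmult_1_r, Rplus_comm, H. apply sqrt_1.
Qed.

Lemma wave_zero (x : R) : wave 0 x = RtoC 1.
Proof. unfold wave. rewrite Rmult_0_l, cos_0, sin_0. reflexivity. Qed.

Lemma wave_at_0 (k : Z) : wave k 0 = RtoC 1.
Proof. unfold wave. rewrite Rmult_0_r, cos_0, sin_0. reflexivity. Qed.

Lemma Rabs_sin_le (x : R) : Rabs (sin x) <= Rabs x.
Proof.
  destruct (MVT_abs sin cos 0 x) as [c [Hc _]].
  { intros. apply derivable_pt_lim_sin. }
  rewrite sin_0, !Rminus_0_r in Hc. rewrite Hc.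
  pose proof (COS_bound c). pose proof (Rabs_pos x).
  assert (Rabs (cos c) <= 1) by (apply Rabs_le; lra). nra.
Qed.

Lemma Rabs_cos_minus_1_le (x : R) : Rabs (cos x - 1) <= Rabs x.
Proof.
  destruct (MVT_abs cos (fun t => - sin t) 0 x) as [c [Hc _]].
  { intros. apply derivable_pt_lim_cos. }
  rewrite cos_0, Rminus_0_r in Hc. rewrite Hc, Rabs_Ropp.
  pose proof (SIN_bound c). pose proof (Rabs_pos x).
  assert (Rabs (sin c) <= 1) by (apply Rabs_le; lra). nra.
Qed.

Lemma between_0_abs (c x : R) : Rmin 0 x <= c <= Rmax 0 x -> Rabs c <= Rabs x.
Proof.
  unfold Rmin, Rmax. destruct Rle_dec; intros H; unfold Rabs;
    repeat destruct Rcase_abs; lra.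
Qed.

Lemma wave_taylor_0 (k : Z) (h : R) :
  Cmod (wave k h - 1 - RtoC h * (Ci * RtoC (IZR k))) <= 2 * (IZR k ^ 2 * h ^ 2).
Proof.
  set (x := IZR k * h).
  assert (H1 : Rabs (cos x - 1) <= x ^ 2).
  { destruct (MVT_abs cos (fun t => - sin t) 0 x) as [c [Hc Hc']].
    { intros. apply derivable_pt_lim_cos. }
    rewrite cos_0, Rminus_0_r in Hc. rewrite Hc, Rabs_Ropp.
    pose proof (Rabs_sin_le c). pose proof (Rabs_pos x).
    apply between_0_abs in Hc'.
    rewrite <- (pow2_abs x). simpl. rewrite Rmult_1_r.
    apply Rmult_le_compat_r; lra. }
  assert (H2 : Rabs (sin x - x) <= x ^ 2).
  { destruct (MVT_abs (fun t => sin t - t) (fun t => cos t - 1) 0 x) as [c [Hc Hc']].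
    { intros. apply derivable_pt_lim_minus; [apply derivable_pt_lim_sin|apply derivable_pt_lim_id]. }
    rewrite sin_0 in Hc. rewrite !Rminus_0_r in Hc. rewrite Hc.
    pose proof (Rabs_cos_minus_1_le c). pose proof (Rabs_pos x).
    apply between_0_abs in Hc'.
    rewrite <- (pow2_abs x). simpl. rewrite Rmult_1_r.
    apply Rmult_le_compat_r; lra. }
  eapply Rle_trans; [apply Cmod_le_Re_Im|].
  replace (Re (wave k h - 1 - RtoC h * (Ci * RtoC (IZR k)))) with (cos x - 1)
    by (unfold wave, Re, Cminus, Cplus, Copp, Cmult, Ci, RtoC, x; simpl; ring).
  replace (Im (wave k h - 1 - RtoC h * (Ci * RtoC (IZR k)))) with (sin x - x)
    by (unfold wave, Im, Cminus, Cplus, Copp, Cmult, Ci, RtoC, x; simpl; ring).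
  replace (IZR k ^ 2 * h ^ 2) with (x ^ 2) by (unfold x; ring). lra.
Qed.

Lemma wave_taylor (k : Z) (x t : R) :
  Cmod (wave k t - wave k x - RtoC (t - x) * (Ci * RtoC (IZR k) * wave k x))
  <= 2 * (IZR k ^ 2 * (t - x) ^ 2).
Proof.
  replace t with (x + (t - x)) at 1 by ring. rewrite wave_translate.
  replace (wave k x * wave k (t - x) - wave k x - RtoC (t - x) * (Ci * RtoC (IZR k) * wave k x))%C
    with (wave k x * (wave k (t - x) - 1 - RtoC (t - x) * (Ci * RtoC (IZR k))))%C by ring.
  rewrite Cmod_mult, Cmod_wave, Rmult_1_l. apply wave_taylor_0.
Qed.

(** A quadratic remainder bound is the form in which derivatives pass to
    series. *)
Lemma has_deriv_quadratic (y dy : R -> C) (M : R) :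
  (forall x t, Cmod (y t - y x - RtoC (t - x) * dy x) <= M * (t - x) ^ 2) ->
  has_deriv y dy.
Proof.
  intros H. apply has_deriv_intro. intros x Hx eps He.
  pose proof (Rabs_pos M) as HM.
  exists (eps / (1 + Rabs M)). split; [apply Rdiv_lt_0_compat; lra|].
  intros t Ht Htd. eapply Rle_trans; [apply H|].
  rewrite <- (pow2_abs (t - x)). set (h := Rabs (t - x)) in *.
  assert (Hh : 0 <= h) by apply Rabs_pos.
  replace (M * h ^ 2) with (M * h * h) by ring.
  apply Rmult_le_compat_r; [exact Hh|].
  apply Rle_trans with ((1 + Rabs M) * h).
  - apply Rmult_le_compat_r; [exact Hh|]. pose proof (Rle_abs M). lra.
  - replace eps with ((1 + Rabs M) * (eps / (1 + Rabs M))) by (field; lra).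
    apply Rmult_le_compat_l; lra.
Qed.

Lemma has_deriv_wave (k : Z) :
  has_deriv (wave k) (fun x => Ci * RtoC (IZR k) * wave k x)%C.
Proof.
  apply (has_deriv_quadratic _ _ (2 * IZR k ^ 2)). intros x t.
  eapply Rle_trans; [apply wave_taylor|]. lra.
Qed.

Lemma cont_wave (k : Z) : cont (wave k).
Proof. exact (has_deriv_cont _ _ (has_deriv_wave k)). Qed.

Lemma has_deriv_scal (c : C) (y dy : R -> C) :
  has_deriv y dy -> has_deriv (fun x => c * y x)%C (fun x => c * dy x)%C.
Proof.
  intros H.
  assert (H0 : has_deriv (fun _ => RtoC 0) (fun _ => RtoC 0)).
  { apply (has_deriv_quadratic _ _ 0). intros x t.
    replace (0 - 0 - RtoC (t - x) * 0)%C with (RtoC 0) by ring. rewrite Cmod_0. lra. }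
  apply (has_deriv_ext _ _ _ _ (fun x _ => Cplus_0_l _) (fun x _ => Cplus_0_l _)
           (has_deriv_lin c _ _ _ _ H0 H)).
Qed.

Lemma wave_double_PI (j : Z) : wave (2 * j) PI = RtoC 1.
Proof.
  assert (H : forall m : nat, wave (2 * Z.of_nat m) PI = RtoC 1).
  { intros m. unfold wave. rewrite mult_IZR, <- INR_IZR_INZ.
    replace (2 * INR m * PI) with (0 + 2 * INR m * PI) by ring.
    now rewrite cos_period, sin_period, cos_0, sin_0. }
  destruct (Z_le_dec 0 j) as [Hj|Hj].
  - rewrite <- (Z2Nat.id j Hj). apply H.
  - pose proof (wave_add (2 * j) (2 * Z.of_nat (Z.to_nat (- j))) PI) as E.
    rewrite H, Cmult_1_r in E. rewrite <- E.
    replace (2 * j + 2 * Z.of_nat (Z.to_nat (- j)))%Z with 0%Z by lia. apply wave_zero.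
Qed.

(** Either boundary condition multiplies [y] and its derivative by a sign from
    [0] to [PI]. *)
Definition bc_sign (b : bc) : C := match b with periodic => RtoC 1 | antiperiodic => RtoC (-1) end.

Lemma wave_PI (n : nat) (j : Z) :
  wave (Z.of_nat n - 2 * j) PI = bc_sign (bc_of_parity n).
Proof.
  assert (H : wave (Z.of_nat n) PI = bc_sign (bc_of_parity n)).
  { unfold bc_of_parity. destruct (Nat.even n) eqn:En.
    - apply Nat.even_spec in En. destruct En as [m ->].
      rewrite Nat2Z.inj_mul. apply wave_double_PI.
    - assert (Ho : Nat.odd n = true) by (unfold Nat.odd; now rewrite En).
      apply Nat.odd_spec in Ho. destruct Ho as [m ->].
      rewrite Nat2Z.inj_add, Nat2Z.inj_mul, wave_add.
      change (Z.of_nat 2) with 2%Z. rewrite wave_double_PI, Cmult_1_l.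
      unfold wave. change (Z.of_nat 1) with 1%Z. rewrite Rmult_1_l, cos_PI, sin_PI. reflexivity. }
  replace (Z.of_nat n - 2 * j)%Z with (Z.of_nat n + 2 * (- j))%Z by ring.
  now rewrite wave_add, wave_double_PI, Cmult_1_r.
Qed.

Lemma bc_holds_sign (b : bc) (y dy : R -> C) :
  bc_holds b y dy <-> (y PI = bc_sign b * y 0 /\ dy PI = bc_sign b * dy 0)%C.
Proof.
  destruct b; simpl.
  - split; intros [-> ->]; split; ring.
  - split; [intros [-> ->]|intros [-> ->]]; split; ring.
Qed.

Lemma two_cos (x : R) : RtoC (2 * cos (2 * x)) = (wave 2 x + wave (-2) x)%C.
Proof.
  unfold wave, Cplus, RtoC. simpl.
  replace (-2 * x) with (- (2 * x)) by ring. rewrite cos_neg, sin_neg. f_equal; ring.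
Qed.

Lemma wave_mathieu (a : C) (n : nat) (j : Z) (k := (2 * j - Z.of_nat n)%Z) :
  mathieu a (bc_of_parity n) (wave k)
    (fun x => RtoC (IZR k ^ 2) * wave k x + a * (wave (k - 2) x + wave (k + 2) x))%C.
Proof.
  exists (fun x => Ci * RtoC (IZR k) * wave k x)%C.
  exists (fun x => Ci * RtoC (IZR k) * (Ci * RtoC (IZR k) * wave k x))%C.
  split; [apply has_deriv_wave|]. split; [apply has_deriv_scal, has_deriv_wave|].
  split; [apply cont_scal, cont_scal, cont_wave|]. split.
  - apply bc_holds_sign. rewrite wave_at_0.
    replace k with (Z.of_nat n - 2 * (Z.of_nat n - j))%Z by (unfold k; ring).
    rewrite wave_PI. split; ring.
  - intros x _. replace (k - 2)%Z with (-2 + k)%Z by ring. replace (k + 2)%Z with (2 + k)%Z by ring.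
    rewrite !wave_add.
    replace (2 * a * RtoC (cos (2 * x)))%C with (a * RtoC (2 * cos (2 * x)))%C
      by (rewrite RtoC_mult; ring).
    rewrite two_cos, RtoC_pow.
    replace (Ci * RtoC (IZR k) * (Ci * RtoC (IZR k) * wave k x))%C
      with ((Ci * Ci) * (RtoC (IZR k) ^ 2 * wave k x))%C by ring.
    replace (Ci * Ci)%C with (RtoC (-1)) by (unfold Ci, Cmult, RtoC; simpl; f_equal; ring).
    ring.
Qed.

(** * Uniqueness of Fourier coefficients *)

(** A trigonometric polynomial in [exp (2 i x)] which, for small [r], exceeds
    [1] near [x0] and is at most [1] in absolute value elsewhere in the interval;
    its powers concentrate at [x0]. *)
Definition kernel (x0 r x : R) : R := 1 + cos (2 * (x - x0)) - cos (2 * r).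

Lemma cos_double_abs (t : R) : cos (2 * Rabs t) = cos (2 * t).
Proof.
  unfold Rabs. destruct Rcase_abs; [|reflexivity].
  replace (2 * - t) with (- (2 * t)) by ring. apply cos_neg.
Qed.

Lemma cos_le_far (t r : R) : 0 < r -> 2 * r <= PI -> r <= Rabs t <= PI - r ->
  cos (2 * t) <= cos (2 * r).
Proof.
  intros Hr Hr2 Ht. rewrite <- (cos_double_abs t).
  set (s := Rabs t) in *.
  destruct (Rle_dec (2 * s) PI) as [H1|H1].
  - apply cos_decr_1; lra.
  - replace (cos (2 * s)) with (cos (2 * PI - 2 * s)).
    + apply cos_decr_1; lra.
    + replace (2 * PI - 2 * s) with (- (2 * s) + 2 * INR 1 * PI) by (simpl; ring).
      now rewrite cos_period, cos_neg.
Qed.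

(** Where the kernel exceeds [1] the function is positive, and the integral over
    a smaller neighbourhood of [x0] tends to infinity with [m], while the rest
    is bounded below. *)
Lemma kernel_concentrates (f : R -> R) (x0 : R) :
  (forall x, continuous f x) -> 0 < x0 < PI -> 0 < f x0 ->
  ~ (forall r m, RInt (fun x => f x * kernel x0 r x ^ m) 0 PI = 0).
Proof.
  intros Hf Hx0 Hpos Hint.
  destruct (proj1 (filterlim_locally f (f x0)) (Hf x0) (mkposreal (f x0 / 2) ltac:(lra))) as [d Hd].
  simpl in Hd.
  set (r := Rmin (d / 2) (Rmin (x0 / 2) ((PI - x0) / 2))).
  assert (Hdp := cond_pos d).
  assert (Hr : 0 < r) by (unfold r; repeat apply Rmin_pos; lra).
  assert (Hr1 : r <= d / 2) by (unfold r; apply Rmin_l).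
  assert (Hr2 : r <= x0 / 2).
  { unfold r. eapply Rle_trans; [apply Rmin_r|apply Rmin_l]. }
  assert (Hr3 : r <= (PI - x0) / 2).
  { unfold r. eapply Rle_trans; [apply Rmin_r|apply Rmin_r]. }
  assert (Hnear : forall x, Rabs (x - x0) <= r -> f x0 / 2 <= f x).
  { intros x Hx. assert (Hb : Rabs (x - x0) < d) by lra.
    specialize (Hd x Hb). change (Rabs (f x - f x0) < f x0 / 2) in Hd.
    apply Rabs_def2 in Hd. lra. }
  destruct (continuity_ab_maj (fun x => Rabs (f x)) 0 PI) as [xM [HM _]]; [lra| |].
  { intros x _. apply continuity_pt_filterlim.
    apply (continuous_comp f Rabs); [apply Hf|apply continuous_Rabs]. }
  set (M := Rabs (f xM)) in *. assert (HM0 : 0 <= M) by apply Rabs_pos.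
  set (rho := cos r - cos (2 * r)).
  assert (Hrho : 0 < rho).
  { unfold rho. assert (cos (2 * r) < cos r) by (apply cos_decreasing_1; lra). lra. }
  assert (Hin : forall x, Rabs (x - x0) <= r -> 1 <= kernel x0 r x).
  { intros x Hx. unfold kernel. rewrite <- (cos_double_abs (x - x0)). pose proof (Rabs_pos (x - x0)).
    assert (cos (2 * r) <= cos (2 * Rabs (x - x0))) by (apply cos_decr_1; lra). lra. }
  assert (Hin2 : forall x, Rabs (x - x0) <= r / 2 -> 1 + rho <= kernel x0 r x).
  { intros x Hx. unfold kernel, rho. rewrite <- (cos_double_abs (x - x0)). pose proof (Rabs_pos (x - x0)).
    assert (cos r <= cos (2 * Rabs (x - x0))) by (apply cos_decr_1; lra). lra. }
  assert (Hout : forall x, 0 <= x <= PI -> r <= Rabs (x - x0) -> Rabs (kernel x0 r x) <= 1).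
  { intros x Hx Hxr. unfold kernel.
    assert (cos (2 * (x - x0)) <= cos (2 * r)).
    { apply cos_le_far; [lra|lra|]. split; [exact Hxr|]. apply Rabs_le. lra. }
    pose proof (COS_bound (2 * (x - x0))). pose proof (COS_bound (2 * r)).
    apply Rabs_le. lra. }
  (* everywhere the integrand is at least [- M]; close to [x0] it grows like [(1 + rho) ^ m] *)
  assert (Hlow : forall m x, 0 <= x <= PI -> - M <= f x * kernel x0 r x ^ m).
  { intros m x Hx. destruct (Rle_dec (Rabs (x - x0)) r) as [Hc|Hc].
    - specialize (Hnear x Hc). specialize (Hin x Hc).
      assert (0 <= f x * kernel x0 r x ^ m).
      { apply Rmult_le_pos; [lra|]. apply pow_le. lra. } lra.
    - assert (Hk := Hout x Hx ltac:(lra)).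
      assert (Rabs (f x * kernel x0 r x ^ m) <= M).
      { rewrite Rabs_mult, <- RPow_abs.
        replace M with (M * 1) by ring.
        apply Rmult_le_compat; [apply Rabs_pos|apply pow_le, Rabs_pos|now apply HM|].
        rewrite <- (pow1 m). apply pow_incr. split; [apply Rabs_pos|exact Hk]. }
      pose proof (Rle_abs (- (f x * kernel x0 r x ^ m))). rewrite Rabs_Ropp in *. lra. }
  assert (Hhigh : forall m x, x0 - r / 2 <= x <= x0 + r / 2 ->
            f x0 / 2 * (1 + INR m * rho) <= f x * kernel x0 r x ^ m).
  { intros m x Hx. assert (Ha : Rabs (x - x0) <= r / 2) by (apply Rabs_le; lra).
    apply Rmult_le_compat; [lra| |apply Hnear; lra|].
    - pose proof (pos_INR m). nra.
    - eapply Rle_trans; [apply poly, Hrho|]. apply pow_incr. split; [lra|now apply Hin2]. }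
  assert (Hex : forall m u v, ex_RInt (fun x => f x * kernel x0 r x ^ m) u v).
  { intros m u v. apply (ex_RInt_continuous (V := R_CompleteNormedModule)).
    intros z _. apply (continuous_mult (K := R_AbsRing) f); [apply Hf|].
    apply continuity_pt_filterlim.
    assert (D : derivable (fun x => kernel x0 r x ^ m)) by (unfold kernel; reg).
    apply derivable_continuous_pt, D. }
  set (u := x0 - r / 2) in *. set (v := x0 + r / 2) in *.
  assert (Hbad : forall m, f x0 / 2 * (1 + INR m * rho) * r <= PI * M).
  { intros m. pose proof (Hint r m) as H0.
    rewrite <- (RInt_Chasles _ 0 u PI (Hex m 0 u) (Hex m u PI)) in H0.
    rewrite <- (RInt_Chasles _ u v PI (Hex m u v) (Hex m v PI)) in H0.
    unfold plus in H0; simpl in H0.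
    assert (L : forall p q c, p <= q ->
                 (forall x, p <= x <= q -> c <= f x * kernel x0 r x ^ m) ->
                 (q - p) * c <= RInt (fun x => f x * kernel x0 r x ^ m) p q).
    { intros p q c Hpq Hc. pose proof (RInt_const (V := R_CompleteNormedModule) p q c) as Ec.
      change (RInt (fun _ => c) p q = (q - p) * c) in Ec. rewrite <- Ec.
      apply RInt_le; [exact Hpq|apply ex_RInt_const|apply Hex|].
      intros x Hx. apply Hc. lra. }
    pose proof (L 0 u (- M) ltac:(unfold u; lra)
                  (fun x Hx => Hlow m x ltac:(unfold u in Hx; lra))) as L1.
    pose proof (L v PI (- M) ltac:(unfold v; lra)
                  (fun x Hx => Hlow m x ltac:(unfold v in Hx; lra))) as L3.
    pose proof (L u v _ ltac:(unfold u, v; lra) (fun x Hx => Hhigh m x Hx)) as L2.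
    replace (v - u) with r in L2 by (unfold u, v; lra).
    assert (0 <= (v - u) * M) by (apply Rmult_le_pos; unfold u, v; lra). nra. }
  (* [Hbad] fails for large [m] *)
  destruct (INR_unbounded (PI * M / (f x0 / 2 * rho * r))) as [m Hm].
  assert (Hq : 0 < f x0 / 2 * rho * r).
  { apply Rmult_lt_0_compat; [apply Rmult_lt_0_compat; lra|lra]. }
  apply (Rmult_lt_compat_r _ _ _ Hq) in Hm.
  replace (PI * M / (f x0 / 2 * rho * r) * (f x0 / 2 * rho * r)) with (PI * M) in Hm
    by (field; repeat split; lra).
  specialize (Hbad m). nra.
Qed.

Lemma kernel_wave (x0 r x : R) (j : Z) :
  (RtoC (kernel x0 r x) * wave (2 * j) x =
   RtoC (1 - cos (2 * r)) * wave (2 * j) x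
   + (wave (-2) x0 / 2 * wave (2 * (j + 1)) x + wave 2 x0 / 2 * wave (2 * (j - 1)) x))%C.
Proof.
  assert (H : RtoC (kernel x0 r x) =
    (RtoC (1 - cos (2 * r)) + (wave (-2) x0 / 2 * wave 2 x + wave 2 x0 / 2 * wave (-2) x))%C).
  { assert (Hn : forall k, wave k (- x0) = wave (- k) x0).
    { intros k. unfold wave. rewrite opp_IZR. f_equal; f_equal; ring. }
    assert (H2 : RtoC (2 * cos (2 * (x - x0)))
                 = (wave 2 x * wave (-2) x0 + wave (-2) x * wave 2 x0)%C).
    { rewrite two_cos. replace (x - x0) with (x + - x0) by ring.
      now rewrite !wave_translate, !Hn. }
    unfold kernel.
    transitivity (RtoC (1 - cos (2 * r)) + RtoC (2 * cos (2 * (x - x0))) / 2)%C.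
    - rewrite <- RtoC_div by lra. rewrite <- RtoC_plus. f_equal. field.
    - rewrite H2. field. }
  rewrite H.
  replace (2 * (j + 1))%Z with (2 + 2 * j)%Z by ring.
  replace (2 * (j - 1))%Z with (-2 + 2 * j)%Z by ring.
  rewrite !wave_add. ring.
Qed.

(** Multiplication by the kernel maps trigonometric polynomials to trigonometric
    polynomials. *)
Lemma kernel_moments (g : R -> C) (x0 r : R) : cont g ->
  (forall j, integral (fun x => g x * wave (2 * j) x)%C = RtoC 0) ->
  forall m j, integral (fun x => g x * (RtoC (kernel x0 r x ^ m) * wave (2 * j) x))%C = RtoC 0.
Proof.
  intros Hg H0 m.
  assert (Hck : forall m, cont (fun x => RtoC (kernel x0 r x ^ m))).
  { intros k. induction k as [|k IH]; [exact (cont_const (RtoC 1))|].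
    apply (cont_ext (fun x => RtoC (kernel x0 r x) * RtoC (kernel x0 r x ^ k))%C).
    { intros x _. now rewrite <- RtoC_mult. }
    apply cont_mult; [|exact IH].
    apply (cont_ext (fun x => RtoC (1 - cos (2 * r)) * wave (2 * 0) x
      + (wave (-2) x0 / 2 * wave (2 * (0 + 1)) x + wave 2 x0 / 2 * wave (2 * (0 - 1)) x))%C).
    { intros x _. rewrite <- kernel_wave. simpl (2 * 0)%Z. rewrite wave_zero. ring. }
    apply cont_plus; [|apply cont_plus]; apply cont_scal, cont_wave. }
  induction m as [|m IH]; intros j.
  - rewrite <- (H0 j). apply integral_ext. intros x _. simpl. ring.
  - set (F := fun i x => (g x * (RtoC (kernel x0 r x ^ m) * wave (2 * i) x))%C).
    assert (CF : forall i, cont (F i)).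
    { intros i. apply cont_mult; [exact Hg|]. apply cont_mult; [apply Hck|apply cont_wave]. }
    rewrite (integral_ext _ (fun x => RtoC (1 - cos (2 * r)) * F j x
       + (wave (-2) x0 / 2 * F (j + 1)%Z x + wave 2 x0 / 2 * F (j - 1)%Z x))%C).
    + assert (CS : forall c i, cont (fun x => c * F i x)%C) by (intros; apply cont_scal, CF).
      rewrite (integral_plus (fun x => RtoC (1 - cos (2 * r)) * F j x)%C _ (CS _ _)
                 (cont_plus _ _ (CS _ _) (CS _ _))).
      rewrite (integral_plus _ _ (CS _ _) (CS _ _)), !integral_scal by apply CF.
      unfold F. rewrite !IH. ring.
    + intros x _. unfold F. simpl (_ ^ S m). rewrite RtoC_mult.
      transitivity (g x * RtoC (kernel x0 r x ^ m) * (RtoC (kernel x0 r x) * wave (2 * j) x))%C;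
        [ring|]. rewrite kernel_wave. ring.
Qed.

(** [kernel_concentrates] applies to the real part of [c g] for [c] among [1],
    [-1], [i], [-i] at interior points; the endpoints follow by continuity. *)
Lemma fourier_uniqueness (g : R -> C) : cont g ->
  (forall j, integral (fun x => g x * wave (2 * j) x)%C = RtoC 0) ->
  forall x, on_0pi x -> g x = RtoC 0.
Proof.
  intros Hg H0.
  assert (Hre : forall (c : C) x0, 0 < x0 < PI -> ~ 0 < Re (c * g x0)).
  { intros c x0 Hx0 Hpos.
    set (G := fun x => (c * g x)%C). assert (HG : cont G) by now apply cont_scal.
    apply (kernel_concentrates (fun x => Re (G (clamp x))) x0); [|exact Hx0| |].
    - intros x. apply (continuous_comp (fun t => G (clamp t)) (fun z : C => fst z)
                         (U := R_UniformSpace) (V := C_UniformSpace) (W := R_UniformSpace)).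
      + apply (cont_clamp G HG x).
      + apply continuous_fst.
    - rewrite clamp_id by (unfold on_0pi; lra). exact Hpos.
    - intros r m.
      assert (HK : cont (fun x => RtoC (kernel x0 r x ^ m))).
      { apply cont_intro. intros x Hx eps He.
        assert (D : derivable (fun x => kernel x0 r x ^ m)) by (unfold kernel; reg).
        destruct (derivable_continuous_pt _ _ (D x) eps He) as [d [Hd Hd']].
        exists d. split; [exact Hd|]. intros t _ Htd. rewrite <- RtoC_minus, Cmod_R.
        destruct (Req_dec x t) as [->|Hne]; [rewrite Rminus_diag, Rabs_R0; exact He|].
        apply (Hd' t). split; [split; [exact I|exact Hne]|exact Htd]. }
      pose proof (kernel_moments g x0 r Hg H0 m 0) as Hm.
      assert (HGK : cont (fun x => G x * RtoC (kernel x0 r x ^ m))%C) by now apply cont_mult.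
      assert (E : integral (fun x => G x * RtoC (kernel x0 r x ^ m))%C = RtoC 0).
      { rewrite (integral_ext _ (fun x => c * (g x * (RtoC (kernel x0 r x ^ m) * wave (2 * 0) x)))%C).
        - rewrite integral_scal, Hm; [ring|].
          apply cont_mult; [exact Hg|]. apply cont_mult; [exact HK|apply cont_wave].
        - intros x _. simpl (2 * 0)%Z. rewrite wave_zero. unfold G. ring. }
      pose proof (is_RInt_unique _ _ _ _ (integral_Re _ HGK)) as Hi.
      rewrite E in Hi. change (Re (RtoC 0)) with 0 in Hi. rewrite <- Hi at 2.
      apply RInt_ext. intros x Hx. rewrite clamp_id by now apply in_0pi_strict.
      symmetry. apply re_scal_r. }
  assert (Hint : forall x, 0 < x < PI -> g x = RtoC 0).
  { intros x Hx.
    pose proof (Hre (RtoC 1) x Hx) as A1. pose proof (Hre (RtoC (-1)) x Hx) as A2.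
    pose proof (Hre Ci x Hx) as A3. pose proof (Hre (- Ci)%C x Hx) as A4.
    destruct (g x) as [u v]. unfold Re, Cmult, Copp, Ci, RtoC in *. simpl in *.
    f_equal; lra. }
  intros x Hx. apply Cmod_le_0.
  apply Rnot_lt_le. intros Hlt.
  destruct (cont_elim g Hg x Hx _ Hlt) as [d [Hd Hd']].
  pose proof PI_RGT_0. destruct Hx as [Hx1 Hx2].
  assert (exists t, 0 < t < PI /\ Rabs (t - x) < d) as [t [Ht Htd]].
  { set (e := Rmin (d / 2) (PI / 4)).
    assert (0 < e) by (unfold e; apply Rmin_pos; lra).
    assert (e <= d / 2) by (unfold e; apply Rmin_l).
    assert (e <= PI / 4) by (unfold e; apply Rmin_r).
    destruct (Rle_dec x (PI / 2)).
    - exists (x + e). split; [lra|]. replace (x + e - x) with e by ring. rewrite Rabs_pos_eq; lra.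
    - exists (x - e). split; [lra|]. replace (x - e - x) with (- e) by ring.
      rewrite Rabs_Ropp, Rabs_pos_eq; lra. }
  specialize (Hd' t ltac:(unfold on_0pi; lra) Htd). rewrite (Hint t Ht) in Hd'.
  replace (0 - g x)%C with (- g x)%C in Hd' by ring. rewrite Cmod_opp in Hd'. lra.
Qed.

(** * Series over the integers *)

(** Componentwise, from the real [Series], which is total. *)
Definition Cseries (v : nat -> C) : C :=
  (Series (fun i => Re (v i)), Series (fun i => Im (v i))).

Definition zsum (u : Z -> C) : C :=
  (Cseries (fun i => u (Z.of_nat i)) + Cseries (fun i => u (-1 - Z.of_nat i)%Z))%C.

(** The only mode of convergence used for [zsum]; it survives shifts. *)
Definition geometric (u : Z -> C) (M : R) : Prop :=
  forall j, Cmod (u j) <= M * (/ 2) ^ Z.abs_nat j.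

Definition summable (v : nat -> C) : Prop := ex_series (fun i => Cmod (v i)).

Lemma summable_Re (v : nat -> C) : summable v -> ex_series (fun i => Re (v i)).
Proof.
  intros H. apply (ex_series_le (V := R_CompleteNormedModule) _ (fun i => Cmod (v i)));
    [|exact H]. intros i. apply re_le_Cmod.
Qed.

Lemma summable_Im (v : nat -> C) : summable v -> ex_series (fun i => Im (v i)).
Proof.
  intros H. apply (ex_series_le (V := R_CompleteNormedModule) _ (fun i => Cmod (v i)));
    [|exact H]. intros i. apply Cmod_Im_le.
Qed.

Lemma Series_dominated (u : nat -> R) (b : nat -> R) :
  (forall i, Rabs (u i) <= b i) -> ex_series b -> Rabs (Series u) <= Series b.
Proof.
  intros H Hb. eapply Rle_trans; [apply Series_Rabs|].
  - apply (ex_series_le (V := R_CompleteNormedModule) _ b); [|exact Hb].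
    intros i. change (Rabs (Rabs (u i)) <= b i). now rewrite Rabs_Rabsolu.
  - apply Series_le; [|exact Hb]. intros i. split; [apply Rabs_pos|apply H].
Qed.

Lemma Cseries_bound (v : nat -> C) (b : nat -> R) :
  (forall i, Cmod (v i) <= b i) -> ex_series b -> Cmod (Cseries v) <= 2 * Series b.
Proof.
  intros H Hb. eapply Rle_trans; [apply Cmod_le_Re_Im|].
  assert (Rabs (Series (fun i => Re (v i))) <= Series b).
  { apply Series_dominated; [|exact Hb]. intros i.
    eapply Rle_trans; [apply re_le_Cmod|apply H]. }
  assert (Rabs (Series (fun i => Im (v i))) <= Series b).
  { apply Series_dominated; [|exact Hb]. intros i.
    eapply Rle_trans; [apply Cmod_Im_le|apply H]. }
  simpl in *. lra.
Qed.

Lemma Cseries_ext (u v : nat -> C) : (forall i, u i = v i) -> Cseries u = Cseries v.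
Proof.
  intros H. unfold Cseries. f_equal; apply Series_ext; intros i; now rewrite H.
Qed.

Lemma Cseries_lin (c : C) (u v : nat -> C) : summable u -> summable v ->
  Cseries (fun i => u i + c * v i)%C = (Cseries u + c * Cseries v)%C.
Proof.
  intros Hu Hv.
  pose proof (summable_Re u Hu) as U1. pose proof (summable_Im u Hu) as U2.
  pose proof (summable_Re v Hv) as V1. pose proof (summable_Im v Hv) as V2.
  assert (S : forall (k : R) (w : nat -> R), ex_series w -> ex_series (fun i => k * w i)).
  { intros k w Hw. apply (ex_series_scal_l (K := R_AbsRing) k w Hw). }
  unfold Cseries, Cplus, Cmult. simpl. f_equal.
  - rewrite <- !Series_scal_l. rewrite <- Series_minus by (apply S; assumption).
    rewrite <- Series_plus; [|assumption|].
    + apply Series_ext. intros i. reflexivity.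
    + apply (ex_series_minus (V := R_NormedModule)); apply S; assumption.
  - rewrite <- !Series_scal_l. rewrite <- Series_plus by (apply S; assumption).
    rewrite <- Series_plus; [|assumption|].
    + apply Series_ext. intros i. reflexivity.
    + apply (ex_series_plus (V := R_NormedModule)); apply S; assumption.
Qed.

Lemma Cseries_incr (v : nat -> C) : summable v ->
  Cseries v = (v O + Cseries (fun i => v (S i)))%C.
Proof.
  intros H. unfold Cseries.
  rewrite (Series_incr_1 (fun i => Re (v i))) by now apply summable_Re.
  rewrite (Series_incr_1 (fun i => Im (v i))) by now apply summable_Im.
  destruct (v O). reflexivity.
Qed.

Lemma ex_series_half (M : R) : ex_series (fun i => M * (/ 2) ^ i).
Proof.
  apply (ex_series_scal_l (K := R_AbsRing) M (fun i => (/ 2) ^ i)). apply ex_series_geom.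
  rewrite Rabs_pos_eq; lra.
Qed.

Lemma Series_half (M : R) : Series (fun i => M * (/ 2) ^ i) = 2 * M.
Proof.
  rewrite Series_scal_l, Series_geom by (rewrite Rabs_pos_eq; lra). field.
Qed.

Lemma geometric_pos (u : Z -> C) (M : R) : geometric u M ->
  forall i, Cmod (u (Z.of_nat i)) <= M * (/ 2) ^ i.
Proof. intros H i. rewrite <- (Zabs2Nat.id i) at 2. apply H. Qed.

Lemma geometric_neg (u : Z -> C) (M : R) : geometric u M ->
  forall i, Cmod (u (-1 - Z.of_nat i)%Z) <= M / 2 * (/ 2) ^ i.
Proof.
  intros H i. replace (M / 2 * (/ 2) ^ i) with (M * (/ 2) ^ S i) by (simpl; field).
  replace (S i) with (Z.abs_nat (-1 - Z.of_nat i)) by lia. apply H.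
Qed.

Lemma summable_dominated (v : nat -> C) (b : nat -> R) :
  (forall i, Cmod (v i) <= b i) -> ex_series b -> summable v.
Proof.
  intros H Hb. apply (ex_series_le (V := R_CompleteNormedModule) _ b); [|exact Hb].
  intros i. change (Rabs (Cmod (v i)) <= b i). rewrite Rabs_pos_eq by apply Cmod_ge_0. apply H.
Qed.

Lemma geometric_summable_pos (u : Z -> C) (M : R) : geometric u M ->
  summable (fun i => u (Z.of_nat i)).
Proof.
  intros H. exact (summable_dominated _ _ (geometric_pos u M H) (ex_series_half M)).
Qed.

Lemma geometric_summable_neg (u : Z -> C) (M : R) : geometric u M ->
  summable (fun i => u (-1 - Z.of_nat i)%Z).
Proof.
  intros H. exact (summable_dominated _ _ (geometric_neg u M H) (ex_series_half (M / 2))).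
Qed.

Lemma zsum_bound (u : Z -> C) (M : R) : geometric u M -> Cmod (zsum u) <= 6 * M.
Proof.
  intros H. unfold zsum. triangle.
  pose proof (Cseries_bound _ _ (geometric_pos u M H) (ex_series_half M)) as H1.
  pose proof (Cseries_bound _ _ (geometric_neg u M H) (ex_series_half (M / 2))) as H2.
  rewrite Series_half in H1, H2. lra.
Qed.

Lemma zsum_ext (u v : Z -> C) : (forall j, u j = v j) -> zsum u = zsum v.
Proof. intros H. unfold zsum. f_equal; apply Cseries_ext; intros i; apply H. Qed.

Lemma zsum_lin (c : C) (u v : Z -> C) (M N : R) : geometric u M -> geometric v N ->
  zsum (fun j => u j + c * v j)%C = (zsum u + c * zsum v)%C.
Proof.
  intros Hu Hv. unfold zsum.
  rewrite (Cseries_lin c (fun i => u (Z.of_nat i)) (fun i => v (Z.of_nat i)))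
    by eauto using geometric_summable_pos.
  rewrite (Cseries_lin c (fun i => u (-1 - Z.of_nat i)%Z) (fun i => v (-1 - Z.of_nat i)%Z))
    by eauto using geometric_summable_neg.
  ring.
Qed.

Lemma zsum_shift (u : Z -> C) (M : R) : geometric u M ->
  zsum (fun j => u (j + 1)%Z) = zsum u.
Proof.
  intros H. unfold zsum.
  rewrite (Cseries_incr (fun i => u (Z.of_nat i))) by (eapply geometric_summable_pos; eauto).
  rewrite (Cseries_incr (fun i => u (-1 - Z.of_nat i + 1)%Z)).
  - rewrite (Cseries_ext (fun i => u (Z.of_nat i + 1)%Z) (fun i => u (Z.of_nat (S i)))).
    2:{ intros i. f_equal. lia. }
    rewrite (Cseries_ext (fun i => u (-1 - Z.of_nat (S i) + 1)%Z) (fun i => u (-1 - Z.of_nat i)%Z)).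
    2:{ intros i. f_equal. lia. }
    simpl Z.of_nat. simpl (-1 - 0 + 1)%Z. ring.
  - apply (summable_dominated _ (fun i => M * (/ 2) ^ i)); [|apply ex_series_half].
    intros i. pose proof (H (-1 - Z.of_nat i + 1)%Z) as Hi.
    replace (Z.abs_nat (-1 - Z.of_nat i + 1)) with i in Hi by lia. exact Hi.
Qed.

Lemma geometric_shift (u : Z -> C) (M : R) : geometric u M ->
  geometric (fun j => u (j + 1)%Z) (2 * M).
Proof.
  intros H j. eapply Rle_trans; [apply H|].
  assert (HM : 0 <= M).
  { pose proof (H 0%Z) as H0. simpl in H0. pose proof (Cmod_ge_0 (u 0%Z)). lra. }
  replace (2 * M * (/ 2) ^ Z.abs_nat j) with (M * (2 * (/ 2) ^ Z.abs_nat j)) by ring.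
  apply Rmult_le_compat_l; [exact HM|].
  pose proof (half_pow_pos (Z.abs_nat j)) as Hp.
  destruct (Z_le_dec 0 j) as [Hj|Hj].
  - replace (Z.abs_nat (j + 1)) with (S (Z.abs_nat j)) by lia. simpl. lra.
  - replace (Z.abs_nat j) with (S (Z.abs_nat (j + 1))) by lia. simpl. lra.
Qed.

Lemma geometric_mult (u v : Z -> C) (M K : R) :
  geometric u M -> (forall j, Cmod (v j) <= K) -> geometric (fun j => u j * v j)%C (M * K).
Proof.
  intros H Hv j. rewrite Cmod_mult.
  replace (M * K * (/ 2) ^ Z.abs_nat j) with (M * (/ 2) ^ Z.abs_nat j * K) by ring.
  apply Rmult_le_compat; auto using Cmod_ge_0.
Qed.

Lemma geometric_plus (u v : Z -> C) (M N : R) :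
  geometric u M -> geometric v N -> geometric (fun j => u j + v j)%C (M + N).
Proof.
  intros Hu Hv j. triangle.
  specialize (Hu j). specialize (Hv j). lra.
Qed.

Lemma geometric_scal (c : C) (u : Z -> C) (M : R) :
  geometric u M -> geometric (fun j => c * u j)%C (M * Cmod c).
Proof.
  intros H j. rewrite Cmult_comm. apply (geometric_mult u (fun _ => c) _ _ H).
  intros _. apply Rle_refl.
Qed.

Lemma geometric_0 : geometric (fun _ => RtoC 0) 0.
Proof. intros j. rewrite Cmod_0. lra. Qed.

Lemma zsum_0 : zsum (fun _ => RtoC 0) = RtoC 0.
Proof.
  apply Cmod_le_0. eapply Rle_trans; [apply (zsum_bound _ _ geometric_0)|lra].
Qed.

Lemma zsum_scal (c : C) (u : Z -> C) (M : R) : geometric u M ->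
  zsum (fun j => c * u j)%C = (c * zsum u)%C.
Proof.
  intros H. rewrite (zsum_ext _ (fun j => RtoC 0 + c * u j)%C) by (intros j; ring).
  rewrite (zsum_lin _ _ _ _ _ geometric_0 H), zsum_0. ring.
Qed.

Lemma zsum_single_0 (c : C) : zsum (fun j => if Z.eq_dec j 0 then c else RtoC 0) = c.
Proof.
  assert (Z0 : forall v, (forall i, v i = RtoC 0) -> Cseries v = RtoC 0).
  { assert (S0 : forall w, (forall i, w i = 0) -> Series w = 0).
    { intros w Hw. rewrite (Series_ext w (fun i => 0 * w i)) by (intros i; rewrite Hw; ring).
      rewrite Series_scal_l. ring. }
    intros v Hv. unfold Cseries. rewrite !S0; [reflexivity| |]; intros i; now rewrite Hv. }
  unfold zsum. rewrite Cseries_incr.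
  - rewrite !Z0.
    + destruct (Z.eq_dec (Z.of_nat 0) 0); [ring|easy].
    + intros i. destruct (Z.eq_dec (-1 - Z.of_nat i) 0); [lia|reflexivity].
    + intros i. destruct (Z.eq_dec (Z.of_nat (S i)) 0); [lia|reflexivity].
  - apply (summable_dominated _ (fun i => Cmod c * (/ 2) ^ i)); [|apply ex_series_half].
    intros i. destruct Z.eq_dec.
    + replace i with O by lia. simpl. lra.
    + rewrite Cmod_0. apply Rmult_le_pos; [apply Cmod_ge_0|left; apply half_pow_pos].
Qed.

Lemma geometric_shift_nat (u : Z -> C) (M : R) (n : nat) : geometric u M ->
  geometric (fun j => u (j + Z.of_nat n)%Z) (2 ^ n * M)
  /\ zsum (fun j => u (j + Z.of_nat n)%Z) = zsum u.
Proof.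
  intros H. induction n as [|n [IH1 IH2]].
  - split.
    + intros j. simpl. rewrite Z.add_0_r, Rmult_1_l. apply H.
    + apply zsum_ext. intros j. f_equal. simpl. ring.
  - assert (E : forall j, u (j + Z.of_nat (S n))%Z = u (j + 1 + Z.of_nat n)%Z).
    { intros j. f_equal. lia. }
    split.
    + intros j. rewrite E. replace (2 ^ S n * M) with (2 * (2 ^ n * M)) by (simpl; ring).
      apply (geometric_shift _ _ IH1).
    + rewrite (zsum_ext _ _ E). rewrite <- IH2. apply (zsum_shift _ _ IH1).
Qed.

(** * The eigenfunctions *)

Definition freq (n : nat) (j : Z) : Z := (Z.of_nat n - 2 * j)%Z.

Definition synth (n : nat) (x : Z -> C) (t : R) : C :=
  zsum (fun j => x j * wave (freq n j) t)%C.

Lemma geometric_wave (n : nat) (x : Z -> C) (M t : R) :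
  geometric x M -> geometric (fun j => x j * wave (freq n j) t)%C M.
Proof. intros H j. rewrite Cmod_mult, Cmod_wave, Rmult_1_r. apply H. Qed.

Definition dcoef (n : nat) (x : Z -> C) (j : Z) : C :=
  (x j * (Ci * RtoC (IZR (freq n j))))%C.

Lemma Cmod_dcoef (n : nat) (x : Z -> C) (j : Z) :
  Cmod (dcoef n x j) = Cmod (x j) * Rabs (IZR (freq n j)).
Proof. unfold dcoef. now rewrite !Cmod_mult, Cmod_Ci, Cmod_R, Rmult_1_l. Qed.

(** Room for [p] differentiations, each of which costs a factor [freq n j]. *)
Definition decays (n p : nat) (x : Z -> C) : Prop :=
  exists M, forall j, Cmod (x j) * (1 + Rabs (IZR (freq n j))) ^ p <= M * (/ 2) ^ Z.abs_nat j.

Lemma decays_dcoef (n p : nat) (x : Z -> C) : decays n (S p) x -> decays n p (dcoef n x).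
Proof.
  intros [M H]. exists M. intros j. eapply Rle_trans; [|apply H].
  rewrite Cmod_dcoef. simpl. rewrite Rmult_assoc.
  apply Rmult_le_compat_l; [apply Cmod_ge_0|].
  pose proof (Rabs_pos (IZR (freq n j))). apply Rmult_le_compat_r; [apply pow_le|]; lra.
Qed.

Lemma decays_geometric (n p : nat) (x : Z -> C) : decays n p x -> exists M, geometric x M.
Proof.
  intros [M H]. exists M. intros j. eapply Rle_trans; [|apply H].
  rewrite <- (Rmult_1_r (Cmod (x j))) at 1. apply Rmult_le_compat_l; [apply Cmod_ge_0|].
  apply pow_R1_Rle. pose proof (Rabs_pos (IZR (freq n j))). lra.
Qed.

(** The quadratic Taylor remainders of the exponentials are summable. *)
Lemma synth_deriv (n : nat) (x : Z -> C) : decays n 2 x ->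
  has_deriv (synth n x) (synth n (dcoef n x)).
Proof.
  intros H. destruct (decays_geometric _ _ _ H) as [M0 H0].
  destruct (decays_geometric _ _ _ (decays_dcoef _ _ _ H)) as [M1 H1].
  destruct H as [M HM].
  apply (has_deriv_quadratic _ _ (6 * (2 * M))). intros s t.
  replace (synth n x t - synth n x s - RtoC (t - s) * synth n (dcoef n x) s)%C
    with (synth n x t + (-1) * (synth n x s + RtoC (t - s) * synth n (dcoef n x) s))%C by ring.
  unfold synth.
  assert (G1 : geometric (fun j => x j * wave (freq n j) t)%C M0) by now apply geometric_wave.
  assert (G2 : geometric (fun j => x j * wave (freq n j) s)%C M0) by now apply geometric_wave.
  assert (G3 : geometric (fun j => dcoef n x j * wave (freq n j) s)%C M1) by now apply geometric_wave.
  rewrite <- (zsum_lin _ _ _ _ _ G2 G3).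
  assert (G4 : geometric (fun j => x j * wave (freq n j) s
                 + RtoC (t - s) * (dcoef n x j * wave (freq n j) s))%C
                 (M0 + M1 * Cmod (RtoC (t - s)))).
  { apply geometric_plus; [exact G2|exact (geometric_scal _ _ _ G3)]. }
  rewrite <- (zsum_lin _ _ _ _ _ G1 G4).
  replace (6 * (2 * M) * (t - s) ^ 2) with (6 * (2 * M * (t - s) ^ 2)) by ring.
  apply zsum_bound. intros j.
  replace (x j * wave (freq n j) t + -1 * (x j * wave (freq n j) s
             + RtoC (t - s) * (dcoef n x j * wave (freq n j) s)))%C
    with (x j * (wave (freq n j) t - wave (freq n j) s
            - RtoC (t - s) * (Ci * RtoC (IZR (freq n j)) * wave (freq n j) s)))%C
    by (unfold dcoef; ring).
  rewrite Cmod_mult. pose proof (wave_taylor (freq n j) s t) as T.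
  specialize (HM j). set (k := IZR (freq n j)) in *.
  pose proof (Cmod_ge_0 (x j)) as P. pose proof (Rabs_pos k) as Pk.
  apply Rle_trans with (Cmod (x j) * (2 * (k ^ 2 * (t - s) ^ 2))).
  { now apply Rmult_le_compat_l. }
  pose proof (pow2_ge_0 (t - s)) as P2.
  replace (Cmod (x j) * (2 * (k ^ 2 * (t - s) ^ 2)))
    with (2 * (t - s) ^ 2 * (Cmod (x j) * k ^ 2)) by ring.
  replace (2 * M * (t - s) ^ 2 * (/ 2) ^ Z.abs_nat j)
    with (2 * (t - s) ^ 2 * (M * (/ 2) ^ Z.abs_nat j)) by ring.
  apply Rmult_le_compat_l; [lra|]. eapply Rle_trans; [|exact HM].
  apply Rmult_le_compat_l; [exact P|]. rewrite <- (pow2_abs k). apply pow_incr. lra.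
Qed.

Lemma synth_bc (n : nat) (x : Z -> C) (M : R) : geometric x M ->
  synth n x PI = (bc_sign (bc_of_parity n) * synth n x 0)%C.
Proof.
  intros H. unfold synth. rewrite <- (zsum_scal _ _ _ (geometric_wave n x M 0 H)).
  apply zsum_ext. intros j. unfold freq. rewrite wave_PI, wave_at_0. ring.
Qed.

(** The recurrence is the equality of the coefficients on both sides. *)
Lemma synth_mathieu (a delta : C) (n : nat) (x : Z -> C) :
  decays n 4 x -> (forall j, recurrence a n delta x j) ->
  mathieu a (bc_of_parity n) (synth n x)
    (fun t => (RtoC (INR n ^ 2) + delta) * synth n x t)%C.
Proof.
  intros D4 Hr.
  pose proof (decays_dcoef _ _ _ D4) as D3. pose proof (decays_dcoef _ _ _ D3) as D2.
  destruct (decays_geometric _ _ _ D4) as [M0 G0].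
  destruct (decays_geometric _ _ _ D3) as [M1 G1].
  destruct (decays_geometric _ _ _ D2) as [M2 G2].
  assert (W : forall p y, decays n (S p) y -> decays n p y).
  { intros p y [M H]. exists M. intros j. eapply Rle_trans; [|apply H].
    apply Rmult_le_compat_l; [apply Cmod_ge_0|]. simpl.
    pose proof (Rabs_pos (IZR (freq n j))) as Pk.
    rewrite <- (Rmult_1_l ((1 + Rabs (IZR (freq n j))) ^ p)) at 1.
    apply Rmult_le_compat_r; [apply pow_le|]; lra. }
  exists (synth n (dcoef n x)), (synth n (dcoef n (dcoef n x))).
  split; [apply synth_deriv; auto|]. split; [apply synth_deriv; auto|].
  split; [exact (has_deriv_cont _ _ (synth_deriv _ _ D2))|]. split.
  { apply bc_holds_sign. split; eapply synth_bc; eauto. }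
  intros t _.
  set (E := fun j => wave (freq n j) t).
  set (u := fun j => (x j * E j)%C).
  assert (Gu : geometric u M0) by now apply geometric_wave.
  (* multiplication by [2 cos (2 t)] shifts the index by one in both directions *)
  assert (HE1 : forall j, (wave 2 t * E (j + 1)%Z = E j)%C).
  { intros j. unfold E. rewrite <- wave_add. f_equal. unfold freq. ring. }
  assert (HE2 : forall j, (wave (-2) t * E j = E (j + 1)%Z)%C).
  { intros j. unfold E. rewrite <- wave_add. f_equal. unfold freq. ring. }
  set (v := fun j => (x (j - 1)%Z * E j)%C).
  set (w := fun j => (x (j + 1)%Z * E j)%C).
  assert (Ev : forall j, (v (j + 1)%Z = wave (-2) t * u j)%C).
  { intros j. unfold v, u. rewrite <- HE2. replace (j + 1 - 1)%Z with j by ring. ring. }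
  assert (Ew : forall j, (w j = wave 2 t * u (j + 1)%Z)%C).
  { intros j. unfold w, u. rewrite <- HE1. ring. }
  assert (Gw : geometric w (2 * M0)).
  { intros j. rewrite Ew, Cmod_mult, Cmod_wave, Rmult_1_l. apply (geometric_shift _ _ Gu). }
  assert (Gv : geometric v (2 * M0)).
  { intros j. replace j with ((j - 1) + 1)%Z at 1 by ring.
    rewrite Ev, Cmod_mult, Cmod_wave, Rmult_1_l.
    eapply Rle_trans; [apply Gu|].
    assert (HM : 0 <= M0).
    { pose proof (G0 0%Z) as H0. simpl in H0. pose proof (Cmod_ge_0 (x 0%Z)). lra. }
    replace (2 * M0 * (/ 2) ^ Z.abs_nat j) with (M0 * (2 * (/ 2) ^ Z.abs_nat j)) by ring.
    apply Rmult_le_compat_l; [exact HM|].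
    pose proof (half_pow_pos (Z.abs_nat j)) as Hp.
    destruct (Z_le_dec j 0) as [Hj|Hj].
    - replace (Z.abs_nat (j - 1)) with (S (Z.abs_nat j)) by lia. simpl. lra.
    - replace (Z.abs_nat j) with (S (Z.abs_nat (j - 1))) by lia. simpl. lra. }
  assert (Sw : zsum w = (wave 2 t * zsum u)%C).
  { rewrite (zsum_ext _ _ Ew), (zsum_scal _ _ _ (geometric_shift _ _ Gu)).
    now rewrite (zsum_shift _ _ Gu). }
  assert (Sv : zsum v = (wave (-2) t * zsum u)%C).
  { rewrite <- (zsum_shift _ _ Gv), (zsum_ext _ _ Ev). exact (zsum_scal _ _ _ Gu). }
  replace (2 * a * RtoC (cos (2 * t)))%C with (a * RtoC (2 * cos (2 * t)))%C
    by (rewrite RtoC_mult; ring).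
  rewrite two_cos. change (synth n x t) with (zsum u).
  replace (a * (wave 2 t + wave (-2) t) * zsum u)%C
    with (a * zsum w + a * zsum v)%C by (rewrite Sw, Sv; ring).
  set (z := fun j => (dcoef n (dcoef n x) j * E j)%C).
  assert (Gz2 : geometric z M2) by now apply geometric_wave.
  change (synth n (dcoef n (dcoef n x)) t) with (zsum z).
  rewrite (zsum_ext z (fun j => (a * v j + a * w j) + (- (RtoC (INR n ^ 2) + delta)) * u j)%C).
  - pose proof (geometric_scal a _ _ Gv) as Gav. pose proof (geometric_scal a _ _ Gw) as Gaw.
    rewrite (zsum_lin _ _ _ _ _ (geometric_plus _ _ _ _ Gav Gaw) Gu), (zsum_lin a _ _ _ _ Gav Gw).
    rewrite (zsum_scal a _ _ Gv). ring.
  - intros j. specialize (Hr j). unfold recurrence, denom in Hr.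
    unfold z, v, w, u, dcoef.
    transitivity (- (RtoC (IZR (freq n j) ^ 2)) * x j * E j)%C.
    + replace (x j * (Ci * RtoC (IZR (freq n j))) * (Ci * RtoC (IZR (freq n j))) * E j)%C
        with ((Ci * Ci) * (RtoC (IZR (freq n j)) ^ 2 * x j * E j))%C by ring.
      replace (Ci * Ci)%C with (RtoC (-1)) by (unfold Ci, Cmult, RtoC; simpl; f_equal; ring).
      rewrite RtoC_pow. ring.
    + replace (RtoC (IZR (freq n j) ^ 2)) with (RtoC (INR n ^ 2) - RtoC (offset n j))%C.
      2:{ rewrite <- RtoC_minus. f_equal. unfold offset, freq.
          rewrite minus_IZR, mult_IZR, <- INR_IZR_INZ. ring. }
      transitivity ((a * (x (j - 1)%Z + x (j + 1)%Z)
                     - (RtoC (INR n ^ 2) + delta) * x j) * E j)%C; [|ring].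
      rewrite <- Hr. ring.
Qed.

Lemma weight_decays (a : C) (n : nat) (x : Z -> C) : large a n ->
  (forall j, Cmod (x j) <= weight a n j) -> decays n 4 x.
Proof.
  intros Hn Hx. pose proof (decay_bounds a n Hn) as Hq.
  set (s := / 100). assert (Hs : 0 < s < 1) by (unfold s; lra).
  (* the factor [100 ^ n] moves the profile centred at [n] to [0] *)
  exists ((1 + 100 ^ n) * (INR n + 2) ^ 4). intros j. set (m := Z.abs_nat j).
  assert (Hpow : forall k l, (k <= l)%nat -> s ^ l <= s ^ k).
  { intros k l Hkl. replace l with (k + (l - k))%nat by lia. rewrite pow_add.
    rewrite <- (Rmult_1_r (s ^ k)) at 2. apply Rmult_le_compat_l; [apply pow_le; lra|].
    rewrite <- (pow1 (l - k)). apply pow_incr. lra. }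
  assert (H1 : Cmod (x j) <= (1 + 100 ^ n) * s ^ m).
  { eapply Rle_trans; [apply Hx|]. unfold weight. rewrite Rmult_plus_distr_r, Rmult_1_l.
    apply Rplus_le_compat.
    - apply pow_incr. unfold s. lra.
    - apply Rle_trans with (s ^ Z.abs_nat (Z.of_nat n - j)); [apply pow_incr; unfold s; lra|].
      apply Rle_trans with (100 ^ n * s ^ (n + Z.abs_nat (Z.of_nat n - j))).
      + rewrite pow_add, <- Rmult_assoc, <- Rpow_mult_distr.
        unfold s. rewrite Rinv_r, pow1 by lra. lra.
      + apply Rmult_le_compat_l; [apply pow_le; lra|]. apply Hpow. unfold m. lia. }
  assert (H2 : 1 + Rabs (IZR (freq n j)) <= (INR n + 2) * 2 ^ m).
  { assert (Hm : INR m + 1 <= 2 ^ m).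
    { clearbody m. clear. induction m as [|m IH]; [simpl; lra|].
      rewrite S_INR. simpl. pose proof (pow_R1_Rle 2 m ltac:(lra)). lra. }
    assert (Ha : Rabs (IZR (freq n j)) <= INR n + 2 * INR m).
    { unfold freq. rewrite minus_IZR, mult_IZR, <- INR_IZR_INZ.
      unfold m. rewrite (INR_IZR_INZ (Z.abs_nat j)), Zabs2Nat.id_abs, abs_IZR.
      pose proof (pos_INR n). unfold Rabs; repeat destruct Rcase_abs; lra. }
    pose proof (pos_INR n). pose proof (pos_INR m).
    apply Rle_trans with ((INR n + 2) * (INR m + 1)); [nra|].
    apply Rmult_le_compat_l; lra. }
  pose proof (Rabs_pos (IZR (freq n j))) as Pk.
  apply Rle_trans with ((1 + 100 ^ n) * s ^ m * ((INR n + 2) * 2 ^ m) ^ 4).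
  { apply Rmult_le_compat; [apply Cmod_ge_0|apply pow_le; lra|exact H1|].
    apply pow_incr. lra. }
  rewrite Rpow_mult_distr.
  replace ((2 ^ m) ^ 4) with (16 ^ m).
  2:{ rewrite <- pow_mult, Nat.mul_comm, pow_mult. f_equal. ring. }
  replace ((1 + 100 ^ n) * s ^ m * ((INR n + 2) ^ 4 * 16 ^ m))
    with ((1 + 100 ^ n) * (INR n + 2) ^ 4 * (s * 16) ^ m) by (rewrite Rpow_mult_distr; ring).
  apply Rmult_le_compat_l.
  - pose proof (pos_INR n). pose proof (pow_le 100 n ltac:(lra)).
    apply Rmult_le_pos; [lra|apply pow_le; lra].
  - apply pow_incr. unfold s. lra.
Qed.

Lemma zsum_single (n : nat) (c : C) :
  zsum (fun j => if Z.eq_dec j (Z.of_nat n) then c else RtoC 0) = c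
  /\ geometric (fun j => if Z.eq_dec j (Z.of_nat n) then c else RtoC 0) (Cmod c * 2 ^ n).
Proof.
  set (u := fun j => if Z.eq_dec j (Z.of_nat n) then c else RtoC 0).
  assert (G : geometric u (Cmod c * 2 ^ n)).
  { intros j. unfold u. destruct Z.eq_dec as [->|_].
    - rewrite Zabs2Nat.id, Rmult_assoc, <- Rpow_mult_distr.
      rewrite Rinv_r, pow1 by lra. lra.
    - rewrite Cmod_0. apply Rmult_le_pos; [|left; apply half_pow_pos].
      apply Rmult_le_pos; [apply Cmod_ge_0|apply pow_le; lra]. }
  split; [|exact G].
  destruct (geometric_shift_nat u _ n G) as [_ <-].
  etransitivity; [|apply zsum_single_0]. apply zsum_ext. intros j. unfold u.
  destruct (Z.eq_dec (j + Z.of_nat n) (Z.of_nat n)), (Z.eq_dec j 0); auto; lia.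
Qed.

Lemma small_pow (q : R) (m : nat) : 0 <= q <= / 200 -> (1 <= m)%nat ->
  2 * q ^ m <= / 50 * (/ 2) ^ m.
Proof.
  intros Hq Hm. destruct m as [|m]; [lia|]. simpl.
  assert (q ^ m <= (/ 2) ^ m) by (apply pow_incr; lra).
  pose proof (pow_le q m ltac:(lra)). nra.
Qed.

(** The non-resonant entries have a small sum, so an eigenfunction is close to
    one of the unperturbed operator. *)
Lemma synth_close (a eps delta : C) (n : nat) (x : Z -> C) : large a n ->
  mode a n eps delta x -> (forall j, Cmod (x j) <= weight a n j) ->
  forall t, Cmod (synth n x t - (wave (Z.of_nat n) t + eps * wave (- Z.of_nat n) t)) <= / 4.
Proof.
  intros Hn [H0 H1 _] Hw t. pose proof (decay_bounds a n Hn) as Hq.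
  set (E := fun j => wave (freq n j) t).
  set (s0 := fun j => if Z.eq_dec j (Z.of_nat 0) then E 0%Z else RtoC 0).
  set (sn := fun j => if Z.eq_dec j (Z.of_nat n) then (eps * E (Z.of_nat n))%C else RtoC 0).
  (* the non-resonant entries closer to [0] and those closer to [n] *)
  set (r1 := fun j => if resonant_dec n j then RtoC 0
                      else if Z_le_dec (2 * j) (Z.of_nat n) then (x j * E j)%C else RtoC 0).
  set (r2 := fun j => if resonant_dec n j then RtoC 0
                      else if Z_le_dec (2 * j) (Z.of_nat n) then RtoC 0 else (x j * E j)%C).
  assert (HE : forall j, Cmod (E j) = 1) by (intros j; apply Cmod_wave).
  assert (G1 : geometric r1 (/ 50)).
  { intros j. pose proof (half_pow_pos (Z.abs_nat j)).
    unfold r1. destruct resonant_dec as [|Hj]; [rewrite Cmod_0; lra|].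
    destruct Z_le_dec; [|rewrite Cmod_0; lra].
    rewrite Cmod_mult, HE, Rmult_1_r. eapply Rle_trans; [apply Hw|].
    unfold resonant in Hj.
    eapply Rle_trans; [apply (weight_near a n Hn j (Z.abs_nat j)); lia|].
    apply small_pow; [exact Hq|lia]. }
  assert (G2' : geometric (fun j => r2 (j + Z.of_nat n)%Z) (/ 50)).
  { intros j. pose proof (half_pow_pos (Z.abs_nat j)).
    unfold r2. destruct resonant_dec as [|Hj]; [rewrite Cmod_0; lra|].
    destruct Z_le_dec; [rewrite Cmod_0; lra|].
    rewrite Cmod_mult, HE, Rmult_1_r. eapply Rle_trans; [apply Hw|].
    unfold resonant in Hj.
    eapply Rle_trans; [apply (weight_near a n Hn _ (Z.abs_nat j)); lia|].
    apply small_pow; [exact Hq|lia]. }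
  assert (G2 : geometric r2 (/ 50 * 2 ^ n)).
  { intros j. replace j with ((j - Z.of_nat n) + Z.of_nat n)%Z at 1 by ring.
    eapply Rle_trans; [apply G2'|]. rewrite Rmult_assoc. apply Rmult_le_compat_l; [lra|].
    apply Rmult_le_reg_l with ((/ 2) ^ n); [apply half_pow_pos|].
    rewrite <- pow_add, <- Rmult_assoc, <- Rpow_mult_distr.
    replace (/ 2 * 2) with 1 by field. rewrite pow1, Rmult_1_l.
    replace (n + Z.abs_nat (j - Z.of_nat n))%nat
      with (Z.abs_nat j + (n + Z.abs_nat (j - Z.of_nat n) - Z.abs_nat j))%nat by lia.
    rewrite pow_add. rewrite <- (Rmult_1_r ((/ 2) ^ Z.abs_nat j)) at 2.
    apply Rmult_le_compat_l; [left; apply half_pow_pos|].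
    rewrite <- (pow1 (n + Z.abs_nat (j - Z.of_nat n) - Z.abs_nat j)). apply pow_incr. lra. }
  destruct (zsum_single 0 (E 0%Z)) as [S0 GS0]. fold s0 in S0, GS0.
  destruct (zsum_single n (eps * E (Z.of_nat n))%C) as [Sn GSn]. fold sn in Sn, GSn.
  assert (Es : synth n x t = (zsum s0 + 1 * zsum sn + 1 * (zsum r1 + 1 * zsum r2))%C).
  { assert (L : forall u v M N, geometric u M -> geometric v N ->
       geometric (fun j => u j + 1 * v j)%C (M + N)).
    { intros u v M N Hu Hv j.
      replace (u j + 1 * v j)%C with (u j + v j)%C by ring.
      apply (geometric_plus u v M N Hu Hv). }
    rewrite <- (zsum_lin _ _ _ _ _ GS0 GSn), <- (zsum_lin _ _ _ _ _ G1 G2).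
    rewrite <- (zsum_lin _ _ _ _ _ (L _ _ _ _ GS0 GSn) (L _ _ _ _ G1 G2)).
    apply zsum_ext. intros j. fold (E j). unfold s0, sn, r1, r2.
    pose proof (nat_large a n Hn).
    destruct (resonant_dec n j) as [[-> | ->]|Hj].
    - rewrite H0. destruct (Z.eq_dec 0 (Z.of_nat 0)); [|easy].
      destruct (Z.eq_dec 0 (Z.of_nat n)); [lia|]. ring.
    - rewrite H1. destruct (Z.eq_dec (Z.of_nat n) (Z.of_nat 0)); [lia|].
      destruct (Z.eq_dec (Z.of_nat n) (Z.of_nat n)); [ring|easy].
    - unfold resonant in Hj. destruct (Z.eq_dec j (Z.of_nat 0)); [simpl in *; lia|].
      destruct (Z.eq_dec j (Z.of_nat n)); [lia|]. destruct Z_le_dec; ring. }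
  rewrite Es, S0, Sn. unfold E.
  replace (freq n 0) with (Z.of_nat n) by (unfold freq; ring).
  replace (freq n (Z.of_nat n)) with (- Z.of_nat n)%Z by (unfold freq; ring).
  match goal with |- Cmod ?z <= _ => replace z with (zsum r1 + zsum r2)%C by ring end.
  triangle.
  pose proof (zsum_bound _ _ G1) as B1. pose proof (zsum_bound _ _ G2') as B2.
  destruct (geometric_shift_nat r2 _ n G2) as [_ E2]. rewrite E2 in B2. lra.
Qed.

Lemma integral_wave (m : Z) : m <> 0%Z -> integral (wave (2 * m)) = RtoC 0.
Proof.
  intros Hm.
  pose proof (integral_deriv _ _ (has_deriv_wave (2 * m)) (cont_scal _ _ (cont_wave (2 * m)))) as E.
  rewrite integral_scal in E by apply cont_wave.
  rewrite wave_double_PI, wave_at_0 in E.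
  assert (Hk : (Ci * RtoC (IZR (2 * m)))%C <> RtoC 0).
  { apply Cmult_neq_0; [apply Ci_nz|]. apply RtoC_neq_0, IZR_neq. lia. }
  replace (integral (wave (2 * m)))
    with (/ (Ci * RtoC (IZR (2 * m))) * (Ci * RtoC (IZR (2 * m)) * integral (wave (2 * m))))%C.
  - rewrite E. ring.
  - rewrite Cmult_assoc, Cinv_l by exact Hk. ring.
Qed.

(** The square of [exp (i n x) + eps exp (- i n x)] has integral [2 eps PI], and
    by [synth_close] the error is smaller. *)
Lemma synth_square_integral (a eps delta : C) (n : nat) (x : Z -> C) : large a n ->
  Cmod eps = 1 -> (eps * eps = 1)%C ->
  mode a n eps delta x -> (forall j, Cmod (x j) <= weight a n j) -> cont (synth n x) ->
  integral (fun t => synth n x t * synth n x t)%C <> RtoC 0.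
Proof.
  intros Hn He He2 Hm Hw Hc H0. pose proof (nat_large a n Hn) as Hnat. pose proof PI_RGT_0 as HPI.
  set (N := Z.of_nat n).
  set (g := fun t => (wave N t + eps * wave (- N) t)%C).
  assert (Hg : cont g) by (apply cont_plus; [|apply cont_scal]; apply cont_wave).
  set (e := fun t => (synth n x t - g t)%C).
  assert (Hce : cont e).
  { apply (cont_ext (fun t => synth n x t + (-1) * g t)%C).
    - intros t _. unfold e. ring.
    - apply cont_plus; [exact Hc|]. now apply cont_scal. }
  assert (Hgg : integral (fun t => g t * g t)%C = (2 * eps * RtoC PI)%C).
  { assert (Hc1 : integral (fun _ => RtoC 1) = RtoC PI).
    { assert (D : has_deriv (fun t => RtoC t) (fun _ => RtoC 1)).
      { apply (has_deriv_quadratic _ _ 0). intros s t.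
        rewrite <- RtoC_minus. replace (RtoC (t - s) - RtoC (t - s) * 1)%C with (RtoC 0) by ring.
        rewrite Cmod_0. lra. }
      rewrite (integral_deriv _ _ D (cont_const 1)). ring. }
    assert (CW : forall k c, cont (fun t => c * wave k t)%C)
      by (intros; apply cont_scal, cont_wave).
    rewrite (integral_ext _ (fun t => 2 * eps * 1 + (1 * wave (2 * N) t + 1 * wave (2 * - N) t))%C).
    - rewrite (integral_plus (fun _ => (2 * eps * 1)%C) _ (cont_const _)
                 (cont_plus _ _ (CW _ _) (CW _ _))).
      rewrite (integral_plus _ _ (CW _ _) (CW _ _)).
      rewrite (integral_scal (2 * eps) (fun _ => RtoC 1) (cont_const 1)), Hc1.
      rewrite !integral_scal by apply cont_wave.
      rewrite !integral_wave by (unfold N; lia). ring.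
    - intros t _. unfold g.
      replace (2 * N)%Z with (N + N)%Z by ring. replace (2 * - N)%Z with (- N + - N)%Z by ring.
      rewrite !wave_add.
      assert (Hinv : (wave N t * wave (- N) t = 1)%C).
      { rewrite <- wave_add, Z.add_opp_diag_r. apply wave_zero. }
      transitivity (wave N t * wave N t + 2 * eps * (wave N t * wave (- N) t)
        + (eps * eps) * (wave (- N) t * wave (- N) t))%C; [ring|].
      rewrite Hinv, He2. ring. }
  set (d := fun t => (e t * (e t + 2 * g t))%C).
  assert (Hcd : cont d).
  { apply cont_mult; [exact Hce|]. apply cont_plus; [exact Hce|]. now apply cont_scal. }
  assert (Hd : Cmod (integral d) <= PI * (17 / 16)).
  { apply integral_bound; [exact Hcd|]. intros t _. unfold d. rewrite Cmod_mult.
    assert (Be : Cmod (e t) <= / 4) by (apply (synth_close a eps delta n x Hn Hm Hw t)).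
    assert (Bg : Cmod (g t) <= 2).
    { unfold g. triangle.
      rewrite Cmod_mult, !Cmod_wave, He. lra. }
    pose proof (Cmod_triangle (e t) (2 * g t)) as T. rewrite Cmod_mult in T.
    rewrite Cmod_R, Rabs_pos_eq in T by lra.
    pose proof (Cmod_ge_0 (e t)). pose proof (Cmod_ge_0 (e t + 2 * g t)).
    replace (17 / 16) with (/ 4 * (17 / 4)) by field. apply Rmult_le_compat; lra. }
  assert (Ed : integral d = (- (2 * eps * RtoC PI))%C).
  { assert (Es : integral (fun t => g t * g t + d t)%C = RtoC 0).
    { rewrite <- H0. apply integral_ext. intros t _. unfold d, e. ring. }
    rewrite (integral_plus (fun t => g t * g t)%C d (cont_mult _ _ Hg Hg) Hcd), Hgg in Es.
    transitivity ((2 * eps * RtoC PI + integral d) - 2 * eps * RtoC PI)%C; [ring|].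
    rewrite Es. ring. }
  rewrite Ed, Cmod_opp, !Cmod_mult, He, !Cmod_R, (Rabs_pos_eq 2), (Rabs_pos_eq PI) in Hd; lra.
Qed.

(** * Fourier coefficients of eigenfunctions *)

Definition coef (n : nat) (y : R -> C) (j : Z) : C :=
  integral (fun t => y t * wave (2 * j - Z.of_nat n) t)%C.

Lemma mathieu_ext (a : C) (b : bc) (y f g : R -> C) :
  (forall t, on_0pi t -> f t = g t) -> mathieu a b y f -> mathieu a b y g.
Proof.
  intros H (dy & ddy & H1 & H2 & H3 & H4 & H5). exists dy, ddy.
  do 4 (split; [assumption|]). intros t Ht. rewrite <- (H t Ht). auto.
Qed.

Lemma mathieu_cont (a : C) (b : bc) (y f : R -> C) : mathieu a b y f -> cont y.
Proof. intros (dy & _ & H & _). exact (has_deriv_cont _ _ H). Qed.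

Lemma mathieu_lin (a c : C) (b : bc) (y f z g : R -> C) :
  mathieu a b y f -> mathieu a b z g ->
  mathieu a b (fun t => y t + c * z t)%C (fun t => f t + c * g t)%C.
Proof.
  intros (dy & ddy & Hy & Hdy & Cy & By & Ey) (dz & ddz & Hz & Hdz & Cz & Bz & Ez).
  exists (fun t => dy t + c * dz t)%C, (fun t => ddy t + c * ddz t)%C.
  split; [now apply has_deriv_lin|]. split; [now apply has_deriv_lin|].
  split; [apply cont_plus; [exact Cy|now apply cont_scal]|]. split.
  - apply bc_holds_sign in By, Bz. apply bc_holds_sign.
    destruct By as [-> ->], Bz as [-> ->]. split; ring.
  - intros t Ht. rewrite (Ey t Ht), (Ez t Ht). ring.
Qed.

Definition eigenfunction (a : C) (n : nat) (delta : C) (y : R -> C) : Prop :=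
  mathieu a (bc_of_parity n) y (fun t => (RtoC (INR n ^ 2) + delta) * y t)%C.

Lemma coef_cont (n : nat) (y : R -> C) (j : Z) : cont y ->
  cont (fun t => y t * wave (2 * j - Z.of_nat n) t)%C.
Proof. intros H. apply cont_mult; [exact H|apply cont_wave]. Qed.

Lemma coef_bounded (n : nat) (y : R -> C) : cont y -> bounded (coef n y).
Proof.
  intros Hy. pose proof PI_RGT_0.
  destruct (continuity_ab_maj (fun t => Cmod (y (clamp t))) 0 PI) as [tM [HM _]]; [lra| |].
  { intros t _ eps He.
    destruct (cont_elim y Hy (clamp t) (clamp_on t) eps He) as [d [Hd Hd']].
    exists d. split; [exact Hd|]. intros s [_ Hs]. simpl in *. unfold Rdist in *.
    eapply Rle_lt_trans; [|apply (Hd' (clamp s) (clamp_on s)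
      (Rle_lt_trans _ _ _ (clamp_lip t s) Hs))].
    apply Rabs_le.
    pose proof (Cmod_minus_ge (y (clamp s)) (- y (clamp t))) as A1.
    pose proof (Cmod_minus_ge (y (clamp t)) (- y (clamp s))) as A2.
    rewrite Cmod_opp in A1, A2.
    pose proof (Cmod_minus_comm (y (clamp s)) (y (clamp t))) as A3. unfold Cminus in *. lra. }
  exists (PI * Cmod (y (clamp tM))). intros j. apply integral_bound; [now apply coef_cont|].
  intros t Ht. rewrite Cmod_mult, Cmod_wave, Rmult_1_r.
  rewrite <- (clamp_id t Ht) at 1. apply HM. exact Ht.
Qed.

Lemma coef_zero (n : nat) (y : R -> C) : cont y -> (forall j, coef n y j = RtoC 0) ->
  forall t, on_0pi t -> y t = RtoC 0.
Proof.
  intros Hy H t Ht.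
  assert (E : (y t * wave (- Z.of_nat n) t = 0)%C).
  { apply (fourier_uniqueness (fun s => y s * wave (- Z.of_nat n) s)%C); [|intros j|exact Ht].
    - apply cont_mult; [exact Hy|apply cont_wave].
    - rewrite <- (H j). apply integral_ext. intros s _.
      rewrite <- Cmult_assoc, <- wave_add. do 2 f_equal. ring. }
  transitivity (y t * wave (- Z.of_nat n) t * wave (Z.of_nat n) t)%C.
  - rewrite <- Cmult_assoc, <- wave_add.
    replace (- Z.of_nat n + Z.of_nat n)%Z with 0%Z by ring. rewrite wave_zero. ring.
  - rewrite E. ring.
Qed.

(** By symmetry the operator acts on the exponential, which it maps to three
    exponentials. *)
Lemma coef_recurrence (a delta : C) (n : nat) (y : R -> C) (j : Z) :
  eigenfunction a n delta y -> recurrence a n delta (coef n y) j.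
Proof.
  intros Hy. pose proof (mathieu_cont _ _ _ _ Hy) as Cy.
  set (k := (2 * j - Z.of_nat n)%Z).
  pose proof (mathieu_symmetric _ _ _ _ _ _ Hy (wave_mathieu a n j)
    (cont_scal _ _ Cy)
    (cont_plus _ _ (cont_scal _ _ (cont_wave k))
       (cont_scal _ _ (cont_plus _ _ (cont_wave (k - 2)) (cont_wave (k + 2)))))) as E.
  fold k in E.
  assert (CF : forall i, cont (fun t => y t * wave (2 * i - Z.of_nat n) t)%C)
    by (intros; now apply coef_cont).
  rewrite (integral_ext _ (fun t => (RtoC (INR n ^ 2) + delta) * (y t * wave k t))%C) in E
    by (intros; ring).
  rewrite (integral_scal _ _ (CF j)) in E.
  rewrite (integral_ext
    (fun t => y t * (RtoC (IZR k ^ 2) * wave k t + a * (wave (k - 2) t + wave (k + 2) t)))%C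
    (fun t => RtoC (IZR k ^ 2) * (y t * wave k t)
       + (a * (y t * wave (2 * (j - 1) - Z.of_nat n) t)
          + a * (y t * wave (2 * (j + 1) - Z.of_nat n) t)))%C) in E.
  2:{ intros t _. replace (2 * (j - 1) - Z.of_nat n)%Z with (k - 2)%Z by (unfold k; ring).
      replace (2 * (j + 1) - Z.of_nat n)%Z with (k + 2)%Z by (unfold k; ring). ring. }
  assert (CS : forall c i, cont (fun t => c * (y t * wave (2 * i - Z.of_nat n) t))%C)
    by (intros; apply cont_scal, CF).
  rewrite (integral_plus _ _ (CS _ j) (cont_plus _ _ (CS _ _) (CS _ _))) in E.
  rewrite (integral_plus _ _ (CS _ _) (CS _ _)) in E.
  rewrite (integral_scal _ _ (CF j)), (integral_scal _ _ (CF (j - 1)%Z)),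
    (integral_scal _ _ (CF (j + 1)%Z)) in E.
  fold (coef n y j) (coef n y (j - 1)) (coef n y (j + 1)) in E.
  change (integral (fun t => y t * wave k t)%C) with (coef n y j) in E.
  unfold recurrence, denom.
  replace (RtoC (offset n j)) with (RtoC (INR n ^ 2) - RtoC (IZR k ^ 2))%C.
  2:{ rewrite <- RtoC_minus. f_equal. unfold offset, k.
      rewrite minus_IZR, mult_IZR, <- INR_IZR_INZ. ring. }
  transitivity ((RtoC (INR n ^ 2) + delta) * coef n y j - RtoC (IZR k ^ 2) * coef n y j)%C; [ring|].
  rewrite E. ring.
Qed.

(** If the part of the coefficient sequence with parity [eps] does not vanish at
    [0], then dividing it by its entry there yields a mode, and [mode_unique]
    applies. *)
Lemma coef_parity_mode (a delta eps d : C) (n : nat) (x : Z -> C) (y : R -> C) :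
  large a n -> Cmod eps = 1 -> (eps * eps = 1)%C ->
  Cmod d <= 1 -> mode a n eps d x -> bounded x ->
  Cmod delta <= 1 -> eigenfunction a n delta y ->
  (coef n y 0 + eps * coef n y (Z.of_nat n) <> 0)%C -> delta = d.
Proof.
  intros Hn He He2 Hd Hm Hb Hdelta Hy Hne.
  pose proof (mathieu_cont _ _ _ _ Hy) as Cy.
  set (s := (coef n y 0 + eps * coef n y (Z.of_nat n))%C) in *.
  set (c := coef n y).
  refine (proj1 (mode_unique a n Hn eps delta d
    (fun j => / s * c j + (/ s * eps) * c (Z.of_nat n - j)%Z)%C x He Hdelta _ _ Hd Hm Hb)).
  - split.
    + rewrite Z.sub_0_r. transitivity (/ s * s)%C; [unfold s, c; ring|now apply Cinv_l].
    + rewrite Z.sub_diag.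
      transitivity (/ s * ((eps * eps) * c (Z.of_nat n) + eps * c 0%Z))%C; [rewrite He2; ring|].
      transitivity (eps * (/ s * s))%C; [unfold s, c; ring|rewrite Cinv_l by exact Hne; ring].
    + intros j.
      apply (recurrence_lin a n delta (/ s) (/ s * eps) c (fun i => c (Z.of_nat n - i)%Z)).
      * now apply coef_recurrence.
      * now apply recurrence_reverse, coef_recurrence.
  - destruct (coef_bounded n y Cy) as [B HB].
    exists (Cmod (/ s) * B + Cmod (/ s) * B). intros j.
    triangle. rewrite !Cmod_mult, He, Rmult_1_r.
    apply Rplus_le_compat; apply Rmult_le_compat_l; try apply Cmod_ge_0; apply HB.
Qed.

Lemma coef_resonant_zero (a delta : C) (n : nat) (y : R -> C) :
  large a n -> Cmod delta <= 1 -> eigenfunction a n delta y ->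
  coef n y 0 = RtoC 0 -> coef n y (Z.of_nat n) = RtoC 0 ->
  forall t, on_0pi t -> y t = RtoC 0.
Proof.
  intros Hn Hd Hy H0 H1. pose proof (mathieu_cont _ _ _ _ Hy) as Cy.
  apply (coef_zero n y Cy). apply (recurrence_unique a n Hn delta); [exact Hd| | |].
  - now apply coef_bounded.
  - intros j [-> | ->]; assumption.
  - intros j _. now apply coef_recurrence.
Qed.

(** * The spectrum in the disc *)

Definition is_sign (eps : C) : Prop := eps = RtoC 1 \/ eps = RtoC (-1).

Lemma Cmod_sign (eps : C) : is_sign eps -> Cmod eps = 1.
Proof. intros [-> | ->]; rewrite Cmod_R; [apply Rabs_R1|rewrite Rabs_left; lra]. Qed.

Lemma square_sign (eps : C) : is_sign eps -> (eps * eps = 1)%C.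
Proof. intros [-> | ->]; rewrite <- RtoC_mult; f_equal; ring. Qed.

Lemma opp_sign (eps : C) : is_sign eps -> is_sign (- eps).
Proof.
  intros [-> | ->]; [right|left]; rewrite <- RtoC_opp; f_equal; ring.
Qed.

Section Spectrum.
Variables (a : C) (n : nat) (eps d d' : C) (x x' : Z -> C).
Hypothesis Hn : large a n.
Hypothesis Heps : is_sign eps.
Let sign_Cmod : Cmod eps = 1 := Cmod_sign eps Heps.
Let sign_square : (eps * eps = 1)%C := square_sign eps Heps.
Hypothesis Hd : Cmod d <= 1.
Hypothesis Hm : mode a n eps d x.
Hypothesis Hw : forall j, Cmod (x j) <= weight a n j.
Hypothesis Hd' : Cmod d' <= 1.
Hypothesis Hm' : mode a n (- eps) d' x'.
Hypothesis Hw' : forall j, Cmod (x' j) <= weight a n j.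
Hypothesis Hne : d <> d'.

Lemma synth_eigenfunction : eigenfunction a n d (synth n x).
Proof.
  destruct Hm as [_ _ Hr]. apply synth_mathieu; [|exact Hr]. now apply (weight_decays a).
Qed.

Lemma eigen_shift_cases (delta : C) (y : R -> C) :
  Cmod delta <= 1 -> eigenfunction a n delta y ->
  (exists t, on_0pi t /\ y t <> RtoC 0) -> delta = d \/ delta = d'.
Proof.
  intros Hdelta Hy [t [Ht Hyt]].
  destruct (Ceq_dec (coef n y 0 + eps * coef n y (Z.of_nat n)) 0) as [E1|E1].
  - right. destruct (Ceq_dec (coef n y 0 + - eps * coef n y (Z.of_nat n)) 0) as [E2|E2].
    + exfalso. apply Hyt. apply (coef_resonant_zero a delta n y); auto.
      * transitivity (/ 2 * ((coef n y 0 + eps * coef n y (Z.of_nat n))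
          + (coef n y 0 + - eps * coef n y (Z.of_nat n))))%C; [field|rewrite E1, E2; ring].
      * transitivity (eps * / 2 * ((coef n y 0 + eps * coef n y (Z.of_nat n))
          - (coef n y 0 + - eps * coef n y (Z.of_nat n))))%C; [|rewrite E1, E2; ring].
        transitivity ((eps * eps) * coef n y (Z.of_nat n))%C; [rewrite sign_square; ring|field].
    + apply (coef_parity_mode a delta (- eps) d' n x' y); eauto using weight_bounded.
      * rewrite Cmod_opp. apply sign_Cmod.
      * rewrite <- sign_square. ring.
  - left. apply (coef_parity_mode a delta eps d n x y);
      eauto using weight_bounded, sign_Cmod, sign_square.
Qed.

(** A nonzero part of the opposite parity would force [d = d']. *)
Lemma eigen_coef_parity (y : R -> C) : eigenfunction a n d y ->
  (coef n y 0 + - eps * coef n y (Z.of_nat n) = 0)%C.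
Proof.
  intros Hy. destruct (Ceq_dec (coef n y 0 + - eps * coef n y (Z.of_nat n)) 0) as [E|E];
    [exact E|]. exfalso. apply Hne.
  apply (coef_parity_mode a d (- eps) d' n x' y); eauto using weight_bounded.
  - rewrite Cmod_opp. apply sign_Cmod.
  - rewrite <- sign_square. ring.
Qed.

Lemma eigen_coef_0 (y : R -> C) : eigenfunction a n d y -> coef n y 0 = RtoC 0 ->
  forall t, on_0pi t -> y t = RtoC 0.
Proof.
  intros Hy H0. apply (coef_resonant_zero a d n y Hn Hd Hy H0).
  pose proof (eigen_coef_parity y Hy) as E. rewrite H0 in E.
  transitivity ((eps * eps) * coef n y (Z.of_nat n))%C; [rewrite sign_square; ring|].
  transitivity (- eps * (0 + - eps * coef n y (Z.of_nat n)))%C; [ring|rewrite E; ring].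
Qed.

Let phi := synth n x.

Lemma phi_square : integral (fun t => phi t * phi t)%C <> RtoC 0.
Proof.
  apply (synth_square_integral a eps d n x Hn sign_Cmod sign_square Hm Hw).
  exact (mathieu_cont _ _ _ _ synth_eigenfunction).
Qed.

Lemma phi_nonzero : exists t, on_0pi t /\ phi t <> RtoC 0.
Proof.
  apply NNPP. intros H. apply phi_square.
  rewrite (integral_ext _ (fun t => 0 * (phi t * phi t))%C).
  - pose proof (mathieu_cont _ _ _ _ synth_eigenfunction) as Cp.
    rewrite integral_scal by now apply cont_mult. ring.
  - intros t Ht. destruct (Ceq_dec (phi t) 0) as [E|E]; [rewrite E; ring|].
    exfalso. apply H. now exists t.
Qed.

Lemma eigenspace_dim_1 (y : R -> C) : eigenfunction a n d y ->
  exists c, forall t, on_0pi t -> y t = (c * phi t)%C.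
Proof.
  intros Hy.
  assert (Hp : coef n phi 0 <> RtoC 0).
  { intros H0. destruct phi_nonzero as [t [Ht Hpt]]. apply Hpt.
    now apply (eigen_coef_0 phi synth_eigenfunction H0). }
  set (c := (coef n y 0 / coef n phi 0)%C). exists c. intros t Ht.
  apply Ceq_minus.
  cut ((fun t => y t + (- c) * phi t)%C t = RtoC 0).
  { simpl. intros E. rewrite <- E. ring. }
  apply eigen_coef_0; [| |exact Ht].
  - refine (mathieu_ext _ _ _ _ _ _ (mathieu_lin a (- c) _ _ _ _ _ Hy synth_eigenfunction)).
    intros s _. simpl. unfold phi. ring.
  - unfold coef.
    pose proof (mathieu_cont _ _ _ _ Hy) as Cy.
    pose proof (mathieu_cont _ _ _ _ synth_eigenfunction) as Cp.
    rewrite (integral_ext _ (fun t => y t * wave (2 * 0 - Z.of_nat n) t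
       + (- c) * (phi t * wave (2 * 0 - Z.of_nat n) t))%C) by (intros; ring).
    pose proof (coef_cont n y 0 Cy) as C1. pose proof (coef_cont n phi 0 Cp) as C2.
    rewrite (integral_plus _ _ C1 (cont_scal (- c) _ C2)), (integral_scal (- c) _ C2).
    change (coef n y 0 + - c * coef n phi 0 = 0)%C. unfold c. field. exact Hp.
Qed.

(** If [(L - mu) y = c phi], then pairing with [phi] gives [c] times the
    integral of [phi ^ 2] equal to [0] by symmetry of [L], hence [c = 0]. *)
Lemma root_space_dim_1 (k : nat) (y : R -> C) :
  in_ker_pow a (bc_of_parity n) (RtoC (INR n ^ 2) + d)%C k y ->
  exists c, forall t, on_0pi t -> y t = (c * phi t)%C.
Proof.
  revert y. induction k as [|k IH]; intros y Hy.
  - exists (RtoC 0). intros t Ht. rewrite (Hy t Ht). ring.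
  - destruct Hy as [f [Hf Hk]]. destruct (IH _ Hk) as [c Hc]. cbv beta in Hc.
    set (mu := (RtoC (INR n ^ 2) + d)%C) in *.
    pose proof (mathieu_cont _ _ _ _ Hf) as Cy.
    pose proof (mathieu_cont _ _ _ _ synth_eigenfunction) as Cp. fold phi in Cp.
    assert (Ef : forall t, on_0pi t -> (c * phi t + mu * y t)%C = f t).
    { intros t Ht. rewrite <- (Hc t Ht). ring. }
    assert (Cf : cont f).
    { apply (cont_ext _ _ Ef). apply cont_plus; now apply cont_scal. }
    assert (E : integral (fun t => f t * phi t)%C = integral (fun t => y t * (mu * phi t))%C)
      by exact (mathieu_symmetric _ _ _ _ _ _ Hf synth_eigenfunction Cf (cont_scal mu _ Cp)).
    assert (C1 : cont (fun t => phi t * phi t)%C) by now apply cont_mult.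
    assert (C2 : cont (fun t => y t * phi t)%C) by now apply cont_mult.
    rewrite (integral_ext _ (fun t => c * (phi t * phi t) + mu * (y t * phi t))%C) in E
      by (intros t Ht; rewrite <- (Ef t Ht); ring).
    rewrite (integral_ext (fun t => y t * (mu * phi t))%C (fun t => mu * (y t * phi t))%C) in E
      by (intros t Ht; ring).
    rewrite (integral_plus _ _ (cont_scal c _ C1) (cont_scal mu _ C2)),
      (integral_scal c _ C1), (integral_scal mu _ C2) in E.
    assert (E0 : (c * integral (fun t => phi t * phi t) = 0)%C).
    { transitivity (c * integral (fun t => phi t * phi t) + mu * integral (fun t => y t * phi t)
        - mu * integral (fun t => y t * phi t))%C; [ring|rewrite E; ring]. }
    assert (Ec : c = RtoC 0).
    { destruct (Ceq_dec c 0) as [H|H]; [exact H|].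
      exfalso. exact (Cmult_neq_0 _ _ H phi_square E0). }
    apply eigenspace_dim_1. apply (mathieu_ext _ _ _ f); [|exact Hf].
    intros t Ht. rewrite <- (Ef t Ht), Ec. fold mu. ring.
Qed.

Lemma phi_root_space : root_space a (bc_of_parity n) (RtoC (INR n ^ 2) + d)%C phi.
Proof.
  exists 1%nat. exists (fun t => (RtoC (INR n ^ 2) + d) * phi t)%C.
  split; [exact synth_eigenfunction|]. intros t _. ring.
Qed.

Lemma alg_mult_1 : alg_mult a (bc_of_parity n) (RtoC (INR n ^ 2) + d)%C 1.
Proof.
  exists (fun _ => phi).
  assert (L : forall c t, lin_comb 1 c (fun _ => phi) t = (c 1%nat * phi t)%C).
  { intros c t. unfold lin_comb. now rewrite sum_n_n. }
  split; [intros; exact phi_root_space|]. split.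
  - intros c Hc i Hi. replace i with 1%nat by lia.
    destruct phi_nonzero as [t [Ht Hpt]]. specialize (Hc t Ht). rewrite L in Hc.
    destruct (Ceq_dec (c 1%nat) 0) as [H|H]; [exact H|].
    exfalso. exact (Cmult_neq_0 _ _ H Hpt Hc).
  - intros y [k Hk]. destruct (root_space_dim_1 k y Hk) as [c Hc].
    exists (fun _ => c). intros t Ht. rewrite L. now apply Hc.
Qed.

Lemma phi_eigenvalue : eigenvalue a (bc_of_parity n) (RtoC (INR n ^ 2) + d)%C.
Proof. exists phi. split; [exact synth_eigenfunction|exact phi_nonzero]. Qed.

End Spectrum.

Theorem spectrum_in_disc (a : C) (n : nat) (eps d d' : C) (x x' : Z -> C) :
  large a n -> is_sign eps ->
  Cmod d < 1 -> mode a n eps d x -> (forall j, Cmod (x j) <= weight a n j) ->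
  Cmod d' < 1 -> mode a n (- eps) d' x' -> (forall j, Cmod (x' j) <= weight a n j) ->
  d <> d' ->
  eigenvalues_in_disc a (bc_of_parity n) (RtoC (INR n ^ 2)) 1
    ((RtoC (INR n ^ 2) + d)%C :: (RtoC (INR n ^ 2) + d')%C :: nil).
Proof.
  intros Hn He Hd Hm Hw Hd' Hm' Hw' Hne.
  set (m := RtoC (INR n ^ 2)).
  pose proof (opp_sign eps He) as He'.
  assert (Hm2 : mode a n (- - eps)%C d x) by (replace (- - eps)%C with eps by ring; exact Hm).
  assert (Hne' : d' <> d) by congruence.
  assert (Hmu : (m + d)%C <> (m + d')%C).
  { intros E. apply Hne. transitivity ((m + d) - m)%C; [ring|rewrite E; ring]. }
  split.
  - intros mu. split.
    + intros [<-|[<-|[]]]; (split; [|match goal with |- Cmod ?z < 1 =>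
        ring_simplify z; assumption end]).
      * eapply (phi_eigenvalue a n eps d x); eauto; lra.
      * eapply (phi_eigenvalue a n (- eps)%C d' x'); eauto; lra.
    + intros [[y [Hy Hyt]] Hr].
      assert (Hcase : (mu - m)%C = d \/ (mu - m)%C = d').
      { apply (eigen_shift_cases a n eps d d' x x') with (y := y); auto; try lra.
        unfold eigenfunction. fold m. replace (m + (mu - m))%C with mu by ring. exact Hy. }
      destruct Hcase as [E|E]; [left|right; left]; rewrite <- E; ring.
  - intros mu [<-|[<-|[]]]; simpl.
    + destruct (Ceq_dec (m + d) (m + d)); [|easy]. destruct (Ceq_dec (m + d') (m + d)); [congruence|].
      eapply (alg_mult_1 a n eps d d' x x'); eauto; lra.
    + destruct (Ceq_dec (m + d) (m + d')); [easy|]. destruct (Ceq_dec (m + d') (m + d')); [|easy].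
      eapply (alg_mult_1 a n (- eps)%C d' d x' x); eauto; lra.
Qed.

(** * The identity for the gap *)

Section Gap.
Variables (a : C) (n : nat) (d1 d2 : C) (c s : Z -> C).
Hypothesis Hn : large a n.
Hypothesis Ha : a <> RtoC 0.
Hypothesis Hd1 : Cmod d1 <= 1.
Hypothesis Hd2 : Cmod d2 <= 1.
Hypothesis Hc : mode a n 1 d1 c.
Hypothesis Hs : mode a n (-1) d2 s.
Hypothesis Wc : forall j, Cmod (c j) <= weight a n j.
Hypothesis Ws : forall j, Cmod (s j) <= weight a n j.

Let casoratian (j : Z) : C := (c (j + 1)%Z * s j - c j * s (j + 1)%Z)%C.

(** The discrete Lagrange identity. *)
Lemma casoratian_step (j : Z) :
  (a * (casoratian j - casoratian (j - 1)) = (d1 - d2) * (c j * s j))%C.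
Proof.
  destruct Hc as [_ _ Rc]. destruct Hs as [_ _ Rs].
  pose proof (Rc j) as E1. pose proof (Rs j) as E2. unfold recurrence, denom in E1, E2.
  unfold casoratian. replace (j - 1 + 1)%Z with j by ring.
  transitivity ((a * (c (j - 1)%Z + c (j + 1)%Z)) * s j - (a * (s (j - 1)%Z + s (j + 1)%Z)) * c j)%C;
    [ring|]. rewrite <- E1, <- E2. ring.
Qed.

Let low_sum (m : nat) : C :=
  csum (fun i => c (- Z.of_nat (i + 2))%Z * s (- Z.of_nat (i + 2))%Z)%C m.

Lemma casoratian_low (m : nat) :
  (a * (casoratian 0 - casoratian (- Z.of_nat (m + 2)))
   = (d1 - d2) * (1 + c (-1)%Z * s (-1)%Z + low_sum m))%C.
Proof.
  induction m as [|m IH].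
  - pose proof (casoratian_step 0) as E0. pose proof (casoratian_step (-1)) as E1.
    simpl in E0, E1. destruct Hc as [c0 _ _]. destruct Hs as [s0 _ _]. rewrite c0, s0 in E0.
    unfold low_sum. cbn [csum]. change (- Z.of_nat (0 + 2))%Z with (-2)%Z.
    transitivity (a * (casoratian 0 - casoratian (-1)) + a * (casoratian (-1) - casoratian (-2)))%C;
      [ring|]. rewrite E0, E1. ring.
  - pose proof (casoratian_step (- Z.of_nat (m + 2))) as E.
    replace (- Z.of_nat (m + 2) - 1)%Z with (- Z.of_nat (S m + 2))%Z in E by lia.
    transitivity (a * (casoratian 0 - casoratian (- Z.of_nat (m + 2)))
      + a * (casoratian (- Z.of_nat (m + 2)) - casoratian (- Z.of_nat (S m + 2))))%C; [ring|].
    rewrite IH, E. unfold low_sum. cbn [csum]. ring.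
Qed.

Lemma decay_half (k l : nat) : decay a n ^ (k + l) <= decay a n ^ k * (/ 2) ^ l.
Proof.
  pose proof (decay_bounds a n Hn). rewrite pow_add.
  apply Rmult_le_compat_l; [apply pow_le; lra|apply pow_incr; lra].
Qed.

Lemma weight_below (k : nat) : weight a n (- Z.of_nat k) <= 2 * decay a n ^ k.
Proof. apply (weight_near a n Hn); lia. Qed.

Lemma low_sum_bound (m : nat) : Cmod (low_sum m) <= 8 * decay a n ^ 4.
Proof.
  cut (Cmod (low_sum m) <= 8 * decay a n ^ 4 * (1 - (/ 2) ^ m)).
  { intros H. pose proof (half_pow_pos m). nra. }
  unfold low_sum. induction m as [|m IH]; cbn [csum].
  - rewrite Cmod_0. simpl. lra.
  - triangle. rewrite Cmod_mult.
    assert (B : Cmod (c (- Z.of_nat (m + 2))) * Cmod (s (- Z.of_nat (m + 2)))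
                <= (2 * (decay a n ^ 2 * (/ 2) ^ m)) * (2 * (decay a n ^ 2 * 1))).
    { pose proof (weight_below (m + 2)) as Wb. pose proof (decay_half 2 m) as Hh.
      rewrite (Nat.add_comm 2 m) in Hh.
      assert (Hh2 : (/ 2) ^ m <= 1) by (rewrite <- (pow1 m); apply pow_incr; lra).
      apply Rmult_le_compat; try apply Cmod_ge_0.
      - eapply Rle_trans; [apply Wc|]. lra.
      - eapply Rle_trans; [apply Ws|]. nra. }
    replace (8 * decay a n ^ 4 * (1 - (/ 2) ^ S m))
      with (8 * decay a n ^ 4 * (1 - (/ 2) ^ m)
            + (2 * (decay a n ^ 2 * (/ 2) ^ m)) * (2 * (decay a n ^ 2 * 1))) by (simpl; field).
    lra.
Qed.

(** The Casoratian tends to [0] at minus infinity, so [a] times its value at [0]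
    is the gap times the sum of [c j * s j] over [j <= 0]. *)
Lemma casoratian_0 :
  Cmod (a * casoratian 0 - (d1 - d2) * (1 + c (-1)%Z * s (-1)%Z))
  <= Cmod (d1 - d2) * (8 * decay a n ^ 4).
Proof.
  pose proof (decay_bounds a n Hn) as Hq.
  apply (le_of_half_pow _ _ (Cmod a * 8)). intros m.
  replace (a * casoratian 0 - (d1 - d2) * (1 + c (-1)%Z * s (-1)%Z))%C
    with ((d1 - d2) * low_sum m + a * casoratian (- Z.of_nat (m + 2)))%C.
  2:{ transitivity ((d1 - d2) * (1 + c (-1)%Z * s (-1)%Z + low_sum m)
        - (d1 - d2) * (1 + c (-1)%Z * s (-1)%Z) + a * casoratian (- Z.of_nat (m + 2)))%C; [ring|].
      rewrite <- casoratian_low. ring. }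
  triangle. rewrite !Cmod_mult.
  apply Rplus_le_compat.
  - apply Rmult_le_compat_l; [apply Cmod_ge_0|apply low_sum_bound].
  - rewrite Rmult_assoc. apply Rmult_le_compat_l; [apply Cmod_ge_0|].
    unfold casoratian. unfold Cminus.
    triangle. rewrite Cmod_opp, !Cmod_mult.
    replace (- Z.of_nat (m + 2) + 1)%Z with (- Z.of_nat (m + 1))%Z by lia.
    assert (Hh : forall k, (m <= k)%nat -> weight a n (- Z.of_nat k) <= 2 * (/ 2) ^ m).
    { intros k Hk. eapply Rle_trans; [apply weight_below|].
      apply Rmult_le_compat_l; [lra|]. eapply Rle_trans; [apply (decay_pow_le a n Hn m k Hk)|].
      apply pow_incr. lra. }
    assert (B : forall i j, (m <= i)%nat ->
              Cmod (c (- Z.of_nat i)) * Cmod (s (- Z.of_nat j)) <= 2 * (/ 2) ^ m * 2).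
    { intros i j Hi. apply Rmult_le_compat; try apply Cmod_ge_0.
      - eapply Rle_trans; [apply Wc|]. now apply Hh.
      - eapply Rle_trans; [apply Ws|]. now apply weight_bounds. }
    pose proof (B (m + 1)%nat (m + 2)%nat ltac:(lia)). pose proof (B (m + 2)%nat (m + 1)%nat ltac:(lia)).
    lra.
Qed.

Let f1 (i : nat) : C := fwd a n d1 i.
Let f2 (i : nat) : C := fwd a n d2 i.

Lemma fwd_casoratian (i : nat) :
  (a * (f1 (S i) * f2 i - f1 i * f2 (S i)) = (d1 - d2) * csum (fun k => f1 (S k) * f2 (S k)) i)%C.
Proof.
  induction i as [|i IH].
  - unfold f1, f2, fwd. simpl. ring.
  - cbn [csum].
    pose proof (fwd_rec a n d1 Ha i) as R1. pose proof (fwd_rec a n d2 Ha i) as R2.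
    fold (f1 (S (S i))) (f1 (S i)) (f1 i) in R1. fold (f2 (S (S i))) (f2 (S i)) (f2 i) in R2.
    transitivity ((a * f1 (S (S i))) * f2 (S i) - f1 (S i) * (a * f2 (S (S i))))%C; [ring|].
    rewrite R1, R2.
    transitivity ((d1 - d2) * (f1 (S i) * f2 (S i)) + a * (f1 (S i) * f2 i - f1 i * f2 (S i)))%C;
      [unfold denom; ring|]. rewrite IH. ring.
Qed.

Lemma fwd_sum_bound (i : nat) : (i < n)%nat ->
  Cmod (csum (fun k => f1 (S k) * f2 (S k))%C i) <= 2 * (Cmod (f1 i) * Cmod (f2 i)).
Proof.
  pose proof (decay_bounds a n Hn) as Hq.
  induction i as [|i IH]; intros Hi; cbn [csum].
  - rewrite Cmod_0. pose proof (Cmod_ge_0 (f1 0)). pose proof (Cmod_ge_0 (f2 0)). nra.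
  - triangle. rewrite Cmod_mult.
    specialize (IH ltac:(lia)).
    destruct (fwd_growth a n d1 Hn Ha Hd1 i ltac:(lia)) as [_ G1]. fold (f1 i) (f1 (S i)) in G1.
    destruct (fwd_growth a n d2 Hn Ha Hd2 i ltac:(lia)) as [_ G2]. fold (f2 i) (f2 (S i)) in G2.
    pose proof (Cmod_ge_0 (f1 i)). pose proof (Cmod_ge_0 (f2 i)).
    pose proof (Cmod_ge_0 (f1 (S i))). pose proof (Cmod_ge_0 (f2 (S i))).
    assert (Cmod (f1 i) * Cmod (f2 i)
            <= (/ 2 * Cmod (f1 (S i))) * (1 * Cmod (f2 (S i)))).
    { apply Rmult_le_compat; auto; nra. }
    lra.
Qed.

(** By [mode_fwd] the Casoratian of the modes at [0] splits into the difference
    of the quotients [fwd (n - 1) / fwd n] and the sum of the [/ fwd n].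
    The Lagrange identity makes [a] times the Casoratian and [a] times the
    difference multiples of the gap; [rho] collects the terms of their sums that are not written out. *)
Theorem gap_identity : exists rho, Cmod rho <= 10 * decay a n ^ 4 /\
  ((d1 - d2) * (1 + (c (-1)%Z * s (-1)%Z + f1 (n - 1)%nat / f1 n * (f2 (n - 1)%nat / f2 n) + rho))
   = a / f1 n + a / f2 n)%C.
Proof.
  pose proof (nat_large a n Hn) as Hnat. pose proof (decay_bounds a n Hn) as Hq.
  pose proof (pow_le (decay a n) 4 ltac:(lra)) as P4.
  assert (N1 : f1 n <> RtoC 0) by now apply fwd_n_neq_0.
  assert (N2 : f2 n <> RtoC 0) by now apply fwd_n_neq_0.
  assert (Hone : (1 * 1 = 1)%C) by ring.
  assert (Hmone : (-1 * -1 = 1)%C) by (rewrite <- RtoC_mult; f_equal; ring).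
  pose proof (weight_bounded a n Hn c Wc) as Bc. pose proof (weight_bounded a n Hn s Ws) as Bs.
  pose proof (mode_fwd a n d1 Hn Ha Hd1 1 c Hone Hc Bc) as M1.
  pose proof (mode_fwd a n d2 Hn Ha Hd2 (-1) s Hmone Hs Bs) as M2.
  fold (f1 n) (f1 (n - 1)) in M1. fold (f2 n) (f2 (n - 1)) in M2.
  set (g := (d1 - d2)%C) in *.
  set (r1 := (f1 (n - 1)%nat / f1 n)%C). set (r2 := (f2 (n - 1)%nat / f2 n)%C).
  assert (E0 : casoratian 0 = (r1 - r2 + (/ f1 n + / f2 n))%C).
  { unfold casoratian. simpl (0 + 1)%Z. destruct Hc as [c0 _ _]. destruct Hs as [s0 _ _].
    rewrite c0, s0.
    transitivity ((c 1%Z * f1 n) / f1 n - (s 1%Z * f2 n) / f2 n)%C; [field; split; assumption|].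
    rewrite M1, M2. unfold r1, r2. field. split; assumption. }
  set (T := csum (fun k => f1 (S k) * f2 (S k))%C (n - 2)).
  assert (BT : Cmod (T / (f1 n * f2 n)) <= 2 * decay a n ^ 4).
  { apply Cmod_div_le; [now apply Cmult_neq_0|]. rewrite Cmod_mult.
    eapply Rle_trans; [apply fwd_sum_bound; lia|].
    pose proof (fwd_before_last a n d1 Hn Ha Hd1) as L1. fold (f1 (n - 2)) (f1 n) in L1.
    pose proof (fwd_before_last a n d2 Hn Ha Hd2) as L2. fold (f2 (n - 2)) (f2 n) in L2.
    replace (2 * decay a n ^ 4 * (Cmod (f1 n) * Cmod (f2 n)))
      with (2 * ((decay a n ^ 2 * Cmod (f1 n)) * (decay a n ^ 2 * Cmod (f2 n)))) by ring.
    apply Rmult_le_compat_l; [lra|]. apply Rmult_le_compat; auto using Cmod_ge_0. }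
  assert (E1 : (a * (r1 - r2) = - g * (r1 * r2 + T / (f1 n * f2 n)))%C).
  { pose proof (fwd_casoratian (n - 1)) as F. fold g in F.
    replace (S (n - 1)) with n in F by lia.
    replace (n - 1)%nat with (S (n - 2)) in F at 3 by lia. cbn [csum] in F. fold T in F.
    replace (S (n - 2)) with (n - 1)%nat in F by lia.
    transitivity (- (a * (f1 n * f2 (n - 1)%nat - f1 (n - 1)%nat * f2 n)) / (f1 n * f2 n))%C.
    - unfold r1, r2. field. split; assumption.
    - rewrite F. unfold r1, r2. field. split; assumption. }
  pose proof casoratian_0 as B0. fold g in B0.
  destruct (Ceq_dec g 0) as [Eg|Eg].
  - exists (RtoC 0). split; [rewrite Cmod_0; lra|].
    rewrite Eg, Cmod_0, Rmult_0_l in B0.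
    assert (Z0 : (a * casoratian 0 = 0)%C).
    { apply Cmod_le_0.
      replace (a * casoratian 0)%C with (a * casoratian 0 - 0 * (1 + c (-1)%Z * s (-1)%Z))%C by ring.
      exact B0. }
    rewrite E0 in Z0. rewrite Eg in E1 |- *.
    transitivity (a * (r1 - r2 + (/ f1 n + / f2 n)) - a * (r1 - r2))%C; [rewrite Z0, E1; ring|].
    field. split; assumption.
  - set (rho1 := ((a * casoratian 0 - g * (1 + c (-1)%Z * s (-1)%Z)) / g)%C).
    exists (rho1 + T / (f1 n * f2 n))%C. split.
    + triangle.
      assert (Cmod rho1 <= 8 * decay a n ^ 4); [|lra].
      unfold rho1. apply Cmod_div_le; [exact Eg|]. lra.
    + transitivity (a * casoratian 0 + g * (r1 * r2 + T / (f1 n * f2 n)))%C.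
      * unfold rho1. field. repeat split; assumption.
      * rewrite E0.
        transitivity (a * (r1 - r2) + g * (r1 * r2 + T / (f1 n * f2 n)) + (a / f1 n + a / f2 n))%C;
          [field; split; assumption|]. rewrite E1. ring.
Qed.

End Gap.

(** * The asymptotic formula *)

Lemma a_over_fwd (a delta : C) (n : nat) : large a n -> a <> RtoC 0 -> Cmod delta <= 1 ->
  (a / fwd a n delta n
   = 4 * (a / 4) ^ n / RtoC (INR (fact (n - 1)) ^ 2) * / rel_det a n delta)%C.
Proof.
  intros Hn Ha Hd. pose proof (nat_large a n Hn) as Hnat.
  pose proof (fwd_n_factor a n delta Hn Hd) as E.
  pose proof (fwd_n_neq_0 a n delta Hn Ha Hd) as Nf.
  pose proof (rel_det_neq_0 a n delta Hn Ha Hd) as Nw.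
  pose proof (prod_offset n (n - 1) 0 ltac:(lia)) as P. simpl (fact 0) in P.
  fold (offs n) in P.
  change (cprod (fun i => RtoC (4 * INR (S i) * (INR n - INR (S i)))) (n - 1))
    with (cprod (fun i => RtoC (offs n i)) (n - 1)) in P.
  simpl (INR 1) in P. rewrite Cmult_1_r in P. rewrite P in E. clear P.
  set (F := RtoC (INR (fact (n - 1)))) in *.
  assert (NF : F <> RtoC 0).
  { apply RtoC_neq_0, INR_fact_neq_0. }
  rewrite RtoC_pow in E. rewrite RtoC_pow. fold F.
  assert (N4 : forall k, (RtoC 4 ^ k)%C <> RtoC 0).
  { intros k. apply Cpow_nz, RtoC_neq_0. lra. }
  assert (Nan : (a ^ (n - 1))%C <> RtoC 0) by now apply Cpow_nz.
  assert (E4 : (4 * (a / 4) ^ n = a * a ^ (n - 1) / 4 ^ (n - 1))%C).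
  { replace n with (S (n - 1)) at 1 by lia. rewrite Cpow_S. unfold Cdiv at 2.
    rewrite Cpow_mult_l. rewrite Cpow_inv by (apply RtoC_neq_0; lra).
    field. apply N4. }
  rewrite E4. set (w := rel_det a n delta) in *. set (f := fwd a n delta n) in *.
  set (an := (a ^ (n - 1))%C) in *. set (p4 := (RtoC 4 ^ (n - 1))%C) in *.
  transitivity (a * an / (f * an))%C; [field; split; assumption|].
  rewrite E. field. repeat split; auto. apply N4.
Qed.

Lemma lex_le_total (z w : C) : lex_le z w \/ lex_le w z.
Proof.
  unfold lex_le. destruct (Rtotal_order (Re z) (Re w)) as [H|[H|H]]; [tauto| |tauto].
  destruct (Rle_dec (Im z) (Im w)); [tauto|]. right. right. split; [now symmetry|lra].
Qed.

Section Asymptotics.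
Variables (a : C) (d1 d2 : nat -> C) (c s : nat -> Z -> C).
Hypothesis Ha : a <> RtoC 0.
Hypothesis Hd1 : forall n, large a n -> Cmod (d1 n) <= 1.
Hypothesis Hd2 : forall n, large a n -> Cmod (d2 n) <= 1.
Hypothesis Hc : forall n, large a n -> mode a n 1 (d1 n) (c n).
Hypothesis Hs : forall n, large a n -> mode a n (-1) (d2 n) (s n).
Hypothesis Wc : forall n, large a n -> forall j, Cmod (c n j) <= weight a n j.
Hypothesis Ws : forall n, large a n -> forall j, Cmod (s n j) <= weight a n j.

(** [gap_identity] writes the gap as a sum of two [a / fwd n], each the leading
    term over a [rel_det], divided by [1 + corr]. The terms in [n ^ -2] of
    [rel_det] and of [corr] are opposite, so the term in [n ^ -3] of [rel_det]
    is the first to survive. *)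
Lemma gap_expansion :
  exists R : nat -> C, bigO 4 (fun n => R n - (1 - a ^ 2 / 4 * recip n ^ 3))%C /\
    forall n, large a n ->
      (d1 n - d2 n = 8 * (a / 4) ^ n / RtoC (INR (fact (n - 1)) ^ 2) * R n)%C.
Proof.
  set (r1 := fun n => (fwd a n (d1 n) (n - 1) / fwd a n (d1 n) n)%C).
  set (r2 := fun n => (fwd a n (d2 n) (n - 1) / fwd a n (d2 n) n)%C).
  assert (Hrho : forall n, exists rho, large a n -> Cmod rho <= 10 * decay a n ^ 4 /\
    ((d1 n - d2 n) * (1 + (c n (-1)%Z * s n (-1)%Z + r1 n * r2 n + rho))
     = a / fwd a n (d1 n) n + a / fwd a n (d2 n) n)%C).
  { intros n. destruct (classic (large a n)) as [Hn|Hn].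
    - destruct (gap_identity a n (d1 n) (d2 n) (c n) (s n)) as [rho H]; auto.
      exists rho. intros _. exact H.
    - exists (RtoC 0). tauto. }
  apply functional_choice in Hrho. destruct Hrho as [rho Hrho].
  pose proof (shift_expansion a 1 d1 c Hd1 Hc Wc) as X1.
  pose proof (shift_expansion a (-1) d2 s Hd2 Hs Ws) as X2.
  set (w1 := fun n => (rel_det a n (d1 n) - 1)%C). set (w2 := fun n => (rel_det a n (d2 n) - 1)%C).
  set (t := fun n => (- (a ^ 2 / 8) * recip n ^ 2 + a ^ 2 / 4 * recip n ^ 3)%C).
  assert (Ht : bigO 2 t) by (apply bigO_plus; apply bigO_scal, bigO_recip_le; lia).
  assert (V1 : bigO 4 (fun n => w1 n - t n)%C).
  { refine (bigO_ext a _ _ _ _ (rel_det_expansion a d1 Ha Hd1 X1)).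
    intros n _. unfold w1, t. ring. }
  assert (V2 : bigO 4 (fun n => w2 n - t n)%C).
  { refine (bigO_ext a _ _ _ _ (rel_det_expansion a d2 Ha Hd2 X2)).
    intros n _. unfold w2, t. ring. }
  assert (O2 : forall w, bigO 4 (fun n => w n - t n)%C -> bigO 2 w).
  { intros w H. apply (bigO_ext a _ (fun n => (w n - t n) + t n)%C); [intros; ring|].
    apply bigO_plus; [exact (bigO_weaken 2 4 _ ltac:(lia) H)|exact Ht]. }
  assert (I1 : bigO 4 (fun n => / (1 + w1 n) - (1 - w1 n))%C).
  { apply (bigO_inv a 2 w1); [|lia|now apply O2].
    intros n Hn. unfold w1. ring_simplify (1 + (rel_det a n (d1 n) - 1))%C.
    apply rel_det_neq_0; auto. }
  assert (I2 : bigO 4 (fun n => / (1 + w2 n) - (1 - w2 n))%C).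
  { apply (bigO_inv a 2 w2); [|lia|now apply O2].
    intros n Hn. unfold w2. ring_simplify (1 + (rel_det a n (d2 n) - 1))%C.
    apply rel_det_neq_0; auto. }
  set (corr := fun n => (c n (-1)%Z * s n (-1)%Z + r1 n * r2 n + rho n)%C).
  (* the corrections of order [n ^ -3] of the two products have opposite signs *)
  assert (VZ : bigO 4 (fun n => corr n - a ^ 2 / 8 * recip n ^ 2)%C).
  { set (p := fun n => (a * (- / 4 * recip n ^ 1 + / 4 * recip n ^ 2))%C).
    set (q := fun n => (a * (/ 4 * recip n ^ 1 + / 4 * recip n ^ 2))%C).
    assert (Hp : bigO 1 p) by (apply bigO_scal, bigO_plus; apply bigO_scal, bigO_recip_le; lia).
    assert (Hq : bigO 1 q) by (apply bigO_scal, bigO_plus; apply bigO_scal, bigO_recip_le; lia).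
    assert (C1 : bigO 3 (fun n => c n (-1)%Z - p n)%C).
    { refine (bigO_ext a _ _ _ _ (entry_1_second a 1 d1 c Hd1 Hc Wc (-1) (or_intror eq_refl))).
      intros n _. unfold p. field. }
    assert (C2 : bigO 3 (fun n => s n (-1)%Z - p n)%C).
    { refine (bigO_ext a _ _ _ _ (entry_1_second a (-1) d2 s Hd2 Hs Ws (-1) (or_intror eq_refl))).
      intros n _. unfold p. field. }
    assert (F1 : bigO 3 (fun n => r1 n - q n)%C).
    { refine (bigO_ext a _ _ _ _ (fwd_ratio_expansion a d1 Ha Hd1 X1)).
      intros n _. unfold r1, q. ring. }
    assert (F2 : bigO 3 (fun n => r2 n - q n)%C).
    { refine (bigO_ext a _ _ _ _ (fwd_ratio_expansion a d2 Ha Hd2 X2)).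
      intros n _. unfold r2, q. ring. }
    assert (PR : forall u v z, bigO 1 z -> bigO 3 (fun n => u n - z n)%C ->
        bigO 3 (fun n => v n - z n)%C -> bigO 4 (fun n => u n * v n - z n * z n)%C).
    { intros u v z Hz Hu Hv.
      apply (bigO_ext a _ (fun n => (u n - z n) * (v n - z n)
         + ((u n - z n) * z n + z n * (v n - z n)))%C); [intros; ring|].
      apply bigO_plus; [|apply bigO_plus].
      - apply (bigO_weaken 4 6); [lia|]. now apply (bigO_mult 3 3).
      - now apply (bigO_mult 3 1).
      - now apply (bigO_mult 1 3). }
    assert (HR : bigO 4 rho).
    { apply (bigO_bound a 4 (10 * Cmod a ^ 4)). intros n Hn.
      destruct (Hrho n Hn) as [H _]. eapply Rle_trans; [exact H|].
      unfold decay, Rdiv. rewrite Rpow_mult_distr. lra. }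
    apply (bigO_ext a _ (fun n => (c n (-1)%Z * s n (-1)%Z - p n * p n)
       + ((r1 n * r2 n - q n * q n) + (rho n + a ^ 2 / 8 * recip n ^ 4)))%C).
    - intros n _. unfold corr, p, q. field.
    - apply bigO_plus; [now apply PR|]. apply bigO_plus; [now apply PR|].
      apply bigO_plus; [exact HR|apply bigO_scal, bigO_recip]. }
  assert (OZ : bigO 2 corr).
  { apply (bigO_ext a _ (fun n => (corr n - a ^ 2 / 8 * recip n ^ 2) + a ^ 2 / 8 * recip n ^ 2)%C);
      [intros; ring|].
    apply bigO_plus; [exact (bigO_weaken 2 4 _ ltac:(lia) VZ)|apply bigO_scal, bigO_recip]. }
  assert (NZ : forall n, large a n -> (1 + corr n)%C <> RtoC 0).
  { intros n Hn H0.
    assert (HZ : Cmod (corr n) <= / 2).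
    { pose proof (decay_bounds a n Hn) as Hq. destruct (Hrho n Hn) as [B _].
      assert (B4 : decay a n ^ 4 <= / 200).
      { apply Rle_trans with (decay a n ^ 1); [apply (decay_pow_le a n Hn); lia|rewrite pow_1; lra]. }
      assert (Bw : weight a n (-1) <= / 100).
      { pose proof (weight_below a n Hn 1) as W1. simpl in W1. lra. }
      destruct (fwd_ratio a n (d1 n) Hn Ha (Hd1 n Hn)) as [u1 [E1 G1]].
      destruct (fwd_ratio a n (d2 n) Hn Ha (Hd2 n Hn)) as [u2 [E2 G2]].
      assert (R1 : r1 n = u1).
      { unfold r1. rewrite E1. field. now apply fwd_n_neq_0; auto. }
      assert (R2 : r2 n = u2).
      { unfold r2. rewrite E2. field. now apply fwd_n_neq_0; auto. }
      unfold corr. rewrite R1, R2.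
      triangle.
      eapply Rle_trans; [apply Rplus_le_compat_r, Cmod_triangle|]. rewrite !Cmod_mult.
      pose proof (Wc n Hn (-1)%Z). pose proof (Ws n Hn (-1)%Z).
      pose proof (Cmod_ge_0 (c n (-1)%Z)). pose proof (Cmod_ge_0 (s n (-1)%Z)).
      pose proof (Cmod_ge_0 u1). pose proof (Cmod_ge_0 u2).
      assert (Cmod (c n (-1)%Z) * Cmod (s n (-1)%Z) <= / 100 * / 100) by (apply Rmult_le_compat; lra).
      assert (Cmod u1 * Cmod u2 <= / 100 * / 100) by (apply Rmult_le_compat; lra). lra. }
    pose proof (Cmod_minus_ge 1 (corr n)) as G. rewrite H0, Cmod_0, Cmod_1 in G. lra. }
  pose proof (bigO_inv a 2 corr NZ ltac:(lia) OZ) as IZ. simpl (2 + 2)%nat in IZ.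
  set (Q := fun n => (/ 2 * (/ (1 + w1 n) + / (1 + w2 n)))%C).
  exists (fun n => Q n * / (1 + corr n))%C. split.
  - set (e := fun n => (Q n - (1 - t n))%C).
    assert (He : bigO 4 e).
    { apply (bigO_ext a _ (fun n => / 2 * (((/ (1 + w1 n) - (1 - w1 n)) - (w1 n - t n))
          + ((/ (1 + w2 n) - (1 - w2 n)) - (w2 n - t n))))%C).
      - intros n _. unfold e, Q. generalize (/ (1 + w1 n))%C, (/ (1 + w2 n))%C. intros. field.
      - apply bigO_scal, bigO_plus; now apply bigO_minus. }
    set (e' := fun n => (/ (1 + corr n) - (1 - corr n))%C).
    assert (Oe' : bigO 2 (fun n => e' n - corr n)%C).
    { apply bigO_minus; [exact (bigO_weaken 2 4 _ ltac:(lia) IZ)|exact OZ]. }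
    apply (bigO_ext a _ (fun n => e n + (e' n - (corr n - a ^ 2 / 8 * recip n ^ 2))
        + ((e n - t n) * (e' n - corr n)))%C).
    + intros n _. unfold e, e', t. ring.
    + apply bigO_plus; [apply bigO_plus|].
      * exact He.
      * now apply bigO_minus.
      * apply (bigO_mult 2 2); [|exact Oe'].
        apply bigO_minus; [exact (bigO_weaken 2 4 _ ltac:(lia) He)|exact Ht].
  - intros n Hn. destruct (Hrho n Hn) as [_ E]. fold (corr n) in E.
    rewrite (a_over_fwd a (d1 n) n Hn Ha (Hd1 n Hn)), (a_over_fwd a (d2 n) n Hn Ha (Hd2 n Hn)) in E.
    unfold Q. unfold w1, w2.
    replace (1 + (rel_det a n (d1 n) - 1))%C with (rel_det a n (d1 n)) by ring.
    replace (1 + (rel_det a n (d2 n) - 1))%C with (rel_det a n (d2 n)) by ring.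
    pose proof (NZ n Hn) as Nz.
    transitivity ((d1 n - d2 n) * (1 + corr n) * / (1 + corr n))%C; [field; exact Nz|].
    rewrite E. unfold Cdiv.
    generalize (/ rel_det a n (d1 n))%C, (/ rel_det a n (d2 n))%C, (/ (1 + corr n))%C,
      (/ RtoC (INR (fact (n - 1)) ^ 2))%C. intros. field.
Qed.

End Asymptotics.

Lemma modes_choice (a eps : C) : is_sign eps ->
  exists (d : nat -> C) (x : nat -> Z -> C), forall n, large a n ->
    Cmod (d n) < 1 /\ mode a n eps (d n) (x n) /\ forall j, Cmod (x n j) <= weight a n j.
Proof.
  intros He.
  assert (H : forall n, exists p : C * (Z -> C), large a n ->
    Cmod (fst p) < 1 /\ mode a n eps (fst p) (snd p) /\ forall j, Cmod (snd p j) <= weight a n j).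
  { intros n. destruct (classic (large a n)) as [Hn|Hn].
    - destruct (mode_exists a n Hn eps (Cmod_sign eps He) (square_sign eps He))
        as (d & x & Hd & Hm & Hw).
      exists (d, x). intros _. split; [|split]; assumption.
    - exists (RtoC 0, fun _ => RtoC 0). tauto. }
  apply functional_choice in H. destruct H as [p Hp].
  exists (fun n => fst (p n)), (fun n => snd (p n)). exact Hp.
Qed.

Theorem theorem13 :
  forall a : C, a <> RtoC 0 ->
  exists (N : nat) (K : R), forall n : nat, (N <= n)%nat ->
  exists lm lp : C,
    eigenvalues_in_disc a (bc_of_parity n) (RtoC (INR n ^ 2)) 1 (lm :: lp :: nil) /\
    lex_le lm lp /\
    exists s r : C,
      (s = RtoC 1 \/ s = RtoC (-1)) /\
      Cmod r <= K / INR n ^ 4 /\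
      (lp - lm =
         s * (8 * (a / 4) ^ n / RtoC (INR (fact (n - 1)) ^ 2)) *
         (1 - a ^ 2 / RtoC (4 * INR n ^ 3) + r))%C.
Proof.
  intros a Ha.
  destruct (modes_choice a 1 (or_introl eq_refl)) as (d1 & c & H1).
  destruct (modes_choice a (-1) (or_intror eq_refl)) as (d2 & s & H2).
  destruct (gap_expansion a d1 d2 c s Ha) as [R [HR HG]];
    try (intros n Hn; destruct (H1 n Hn) as (? & ? & ?); destruct (H2 n Hn) as (? & ? & ?); auto; lra).
  set (r := fun n => (R n - (1 - a ^ 2 / 4 * recip n ^ 3))%C) in *.
  destruct HR as [N1 [K HK]]. destruct (eventually_large a) as [N2 HN2].
  (* the bracket tends to [1], so that the two eigenvalues are distinct *)
  assert (HR0 : exists N3, forall n, (N3 <= n)%nat -> R n <> RtoC 0).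
  { assert (O1 : bigO 1 (fun n => R n - 1)%C).
    { apply (bigO_ext a _ (fun n => r n + - (a ^ 2 / 4) * recip n ^ 3)%C).
      - intros n _. unfold r. ring.
      - apply bigO_plus; [apply (bigO_weaken 1 4); [lia|now exists N1, K]|].
        apply bigO_scal, bigO_recip_le. lia. }
    destruct O1 as [M [K' HK']]. destruct (INR_unbounded (Rabs K')) as [M' HM'].
    exists (max 1 (max M M')). intros n Hn E. specialize (HK' n ltac:(lia)). rewrite E in HK'.
    replace (0 - 1)%C with (RtoC (-1)) in HK' by (rewrite <- RtoC_minus; f_equal; ring).
    rewrite Cmod_R, Rabs_left, pow_1 in HK' by lra.
    assert (Hn' : INR M' <= INR n) by (apply le_INR; lia).
    pose proof (Rle_abs K'). pose proof (Rabs_pos K').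
    apply (Rmult_le_compat_r (INR n)) in HK'; [|lra].
    rewrite Rmult_assoc, Rinv_l in HK' by lra. lra. }
  destruct HR0 as [N3 HN3].
  exists (max N1 (max N2 N3)), K. intros n Hn.
  pose proof (HN2 n ltac:(lia)) as Hl. pose proof (HN3 n ltac:(lia)) as HRn.
  destruct (H1 n Hl) as (A1 & A2 & A3). destruct (H2 n Hl) as (B1 & B2 & B3).
  set (mu := RtoC (INR n ^ 2)).
  set (G := (8 * (a / 4) ^ n / RtoC (INR (fact (n - 1)) ^ 2))%C).
  assert (EG : (d1 n - d2 n = G * R n)%C) by exact (HG n Hl).
  assert (NG : G <> RtoC 0).
  { unfold G. assert (N4 : RtoC 4 <> RtoC 0) by (apply RtoC_neq_0; lra).
    assert (N8 : RtoC 8 <> RtoC 0) by (apply RtoC_neq_0; lra).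
    apply Cmult_neq_0; [apply Cmult_neq_0; [exact N8|]|].
    - apply Cpow_nz. apply Cmult_neq_0; [exact Ha|].
      intros E. apply C1_nz. rewrite <- (Cinv_r 4 N4), E. ring.
    - rewrite <- RtoC_inv by (apply pow_nonzero, INR_fact_neq_0).
      apply RtoC_neq_0, Rinv_neq_0_compat, pow_nonzero, INR_fact_neq_0. }
  assert (Hne : d1 n <> d2 n).
  { intros E. apply (Cmult_neq_0 G (R n) NG HRn). rewrite <- EG, E. ring. }
  assert (Hr : Cmod (r n) <= K / INR n ^ 4).
  { unfold Rdiv. rewrite <- pow_inv. apply HK. lia. }
  assert (ER : R n = (1 - a ^ 2 / RtoC (4 * INR n ^ 3) + r n)%C).
  { unfold r. destruct (recip_inv a n Hl) as [Hz ->].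
    rewrite RtoC_mult, RtoC_pow. field. exact Hz. }
  assert (B2' : mode a n (- (1)) (d2 n) (s n)).
  { replace (- (1))%C with (RtoC (-1)) by (rewrite <- RtoC_opp; f_equal; ring). exact B2. }
  assert (A2' : mode a n (- (-1)) (d1 n) (c n)).
  { replace (- (-1))%C with (RtoC 1) by (rewrite <- RtoC_opp; f_equal; ring). exact A2. }
  destruct (lex_le_total (mu + d2 n) (mu + d1 n)) as [L|L].
  - exists (mu + d2 n)%C, (mu + d1 n)%C. split.
    + apply (spectrum_in_disc a n (-1) (d2 n) (d1 n) (s n) (c n)); auto. now right.
    + split; [exact L|]. exists (RtoC 1), (r n). split; [now left|]. split; [exact Hr|].
      rewrite <- ER. fold G. transitivity (d1 n - d2 n)%C; [ring|]. rewrite EG. ring.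
  - exists (mu + d1 n)%C, (mu + d2 n)%C. split.
    + apply (spectrum_in_disc a n 1 (d1 n) (d2 n) (c n) (s n)); auto. now left.
    + split; [exact L|]. exists (RtoC (-1)), (r n). split; [now right|]. split; [exact Hr|].
      rewrite <- ER. fold G. transitivity (- (d1 n - d2 n))%C; [ring|]. rewrite EG. ring.
Qed.
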